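(* Let $\upsilon:\mathfrak{h}(DE_{10})^*\to\mathfrak{h}(E_{10})^*$ be the linear isometry and $\mathfrak{g}^{(inv)}\subset E_{10}$ the $\mathbb{Z}_2$-invariant subalgebra defined in the context. There exists an injective homomorphism of Lie algebras $$\tilde\upsilon: DE_{10}\to\mathfrak{g}^{(inv)}\subset E_{10}$$ such that: (a) for every root $\alpha$ of $DE_{10}$, $\tilde\upsilon(\mathfrak{g}(DE_{10})_\alpha)\subset\mathfrak{g}(E_{10})_{\upsilon(\alpha)}$, and the restriction of $\tilde\upsilon$ to $\mathfrak{g}(DE_{10})_\alpha$ is injective; (b) $\tilde\upsilon$ restricts to an isomorphism between the Cartan subalgebras $\mathfrak{h}(DE_{10})$ and $\mathfrak{h}(E_{10})$; (c) if $\alpha$ is a real root of $DE_{10}$, then $\tilde\upsilon$ restricts to an isomorphism between the root spaces $\mathfrak{g}(DE_{10})_\alpha$ and $\mathfrak{g}(E_{10})_{\upsilon(\alpha)}$.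
   Context: All Kac–Moody algebras here are over $\mathbb{C}$; $\mathfrak{h}(X)$ is the Cartan subalgebra of $X$, $\mathfrak{g}(X)_\alpha$ the root space of $\alpha$, and $(\cdot|\cdot)$ the standard invariant form (real roots have square $2$). All Dynkin diagrams are simply laced. $E_{10}$: simple roots $\alpha_{-1},\alpha_0,\dots,\alpha_8$; the diagram is the chain $\alpha_{-1}-\alpha_0-\alpha_1-\cdots-\alpha_7$ plus a node $\alpha_8$ joined to $\alpha_5$. $DE_{10}$: simple roots $\gamma_{-1},\gamma_0,\dots,\gamma_8$; the diagram is the chain $\gamma_{-1}-\gamma_0-\gamma_1-\cdots-\gamma_6$ plus a node $\gamma_7$ joined to $\gamma_1$ and a node $\gamma_8$ joined to $\gamma_5$. $\mathbb{Z}_2$-charge (for the orbifold $T^5/\mathbb{Z}_2$): a root $\sum_{i=-1}^8k_i\alpha_i$ of $E_{10}$ (or the element $0$) is even if $k_3$ is even and odd otherwise. $\mathfrak{g}^{(inv)}$ is the Lie subalgebra of $E_{10}$ generated by $\mathfrak{h}(E_{10})$ and all root spaces of even roots. Let $\xi=\alpha_2+2\alpha_3+2\alpha_4+2\alpha_5+\alpha_6+\alpha_8$, a real root of $E_{10}$. The isometry $\upsilon$ is the linear map with $\upsilon(\gamma_{-1})=\alpha_{-1}$, $\upsilon(\gamma_0)=\alpha_0$, $\upsilon(\gamma_1)=\alpha_1$, $\upsilon(\gamma_2)=\xi$, $\upsilon(\gamma_3)=\alpha_7$, $\upsilon(\gamma_4)=\alpha_6$, $\upsilon(\gamma_5)=\alpha_5$,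 $\upsilon(\gamma_6)=\alpha_4$, $\upsilon(\gamma_7)=\alpha_2$, $\upsilon(\gamma_8)=\alpha_8$. *)

(* Defs.v *)
(* Library: MathComp, with the classical layer of MathComp-Analysis. *)
From HB Require Import structures.
From mathcomp Require Import all_boot all_order all_algebra.
From mathcomp Require Import generic_quotient.
From mathcomp Require Import boolp classical_sets functions reals.
From mathcomp Require Import complex.

Set Implicit Arguments.
Unset Strict Implicit.
Unset Printing Implicit Defensive.

Import Order.TTheory GRing.Theory Num.Theory.
Local Open Scope ring_scope.
Local Open Scope quotient_scope.
Local Open Scope classical_set_scope.

HB.mixin Record Lmodule_isLie (K : pzRingType) L of GRing.Lmodule K L := {
  lie_br : L -> L -> L;
  lie_linearl : forall z (a : K) x y,
    lie_br (a *: x + y) z = a *: lie_br x z + lie_br y z;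
  lie_linearr : forall z (a : K) x y,
    lie_br z (a *: x + y) = a *: lie_br z x + lie_br z y;
  lie_brxx : forall x, lie_br x x = 0;
  lie_jacobi : forall x y z,
    lie_br x (lie_br y z) + lie_br y (lie_br z x) + lie_br z (lie_br x y) = 0
}.

#[short(type="lieType")]
HB.structure Definition LieAlgebra (K : pzRingType) :=
  { L of Lmodule_isLie K L & GRing.Lmodule K L }.

Definition lie_morphism (K : pzRingType) (L M : lieType K) (f : L -> M) : Prop :=
  forall x y, f (lie_br x y) = lie_br (f x) (f y).

Definition lie_subalgebra (K : pzRingType) (L : lieType K) (S : set L) : Prop :=
  [/\ S 0, (forall (a : K) x y, S x -> S y -> S (a *: x + y))
    & forall x y, S x -> S y -> S (lie_br x y)].

Definition lie_generated (K : pzRingType) (L : lieType K) (G : set L) : set L :=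
  smallest (@lie_subalgebra K L) G.

Inductive lie_expr (K X : Type) : Type :=
| LGen of X
| LZero
| LAdd of lie_expr K X & lie_expr K X
| LScale of K & lie_expr K X
| LBr of lie_expr K X & lie_expr K X.

Arguments LGen {K X}.
Arguments LZero {K X}.
Arguments LAdd {K X}.
Arguments LScale {K X}.
Arguments LBr {K X}.

HB.instance Definition _ (K X : Type) := gen_eqMixin (lie_expr K X).
HB.instance Definition _ (K X : Type) := gen_choiceMixin (lie_expr K X).

Section Presentation.
Variables (K : fieldType) (X : Type).
Variable rels : lie_expr K X -> lie_expr K X -> Prop.

(* The least congruence that contains the Lie algebra axioms and [rels]: the
   quotient is the free Lie algebra on X modulo the ideal generated by the
   elements s - t with [rels s t]. *)
Inductive lie_cong : lie_expr K X -> lie_expr K X -> Prop :=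
| lc_rel s t : rels s t -> lie_cong s t
| lc_refl s : lie_cong s s
| lc_sym s t : lie_cong s t -> lie_cong t s
| lc_trans s t u : lie_cong s t -> lie_cong t u -> lie_cong s u
| lc_add s s' t t' :
    lie_cong s s' -> lie_cong t t' -> lie_cong (LAdd s t) (LAdd s' t')
| lc_scale a s s' : lie_cong s s' -> lie_cong (LScale a s) (LScale a s')
| lc_br s s' t t' :
    lie_cong s s' -> lie_cong t t' -> lie_cong (LBr s t) (LBr s' t')
| lc_addA s t u : lie_cong (LAdd s (LAdd t u)) (LAdd (LAdd s t) u)
| lc_addC s t : lie_cong (LAdd s t) (LAdd t s)
| lc_add0 s : lie_cong (LAdd LZero s) s
| lc_addN s : lie_cong (LAdd (LScale (-1) s) s) LZero
| lc_scaleA a b s : lie_cong (LScale a (LScale b s)) (LScale (a * b) s)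
| lc_scale1 s : lie_cong (LScale 1 s) s
| lc_scaleDr a s t :
    lie_cong (LScale a (LAdd s t)) (LAdd (LScale a s) (LScale a t))
| lc_scaleDl a b s :
    lie_cong (LScale (a + b) s) (LAdd (LScale a s) (LScale b s))
| lc_brl a s t u :
    lie_cong (LBr (LAdd (LScale a s) t) u)
             (LAdd (LScale a (LBr s u)) (LBr t u))
| lc_brr a s t u :
    lie_cong (LBr u (LAdd (LScale a s) t))
             (LAdd (LScale a (LBr u s)) (LBr u t))
| lc_brxx s : lie_cong (LBr s s) LZero
| lc_jacobi s t u :
    lie_cong (LAdd (LAdd (LBr s (LBr t u)) (LBr t (LBr u s)))
                   (LBr u (LBr s t))) LZero.

Definition lie_congb : rel (lie_expr K X) := fun s t => `[< lie_cong s t >].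

Lemma lie_congb_refl : reflexive lie_congb.
Proof. by move=> s; apply/asboolP; apply: lc_refl. Qed.

Lemma lie_congb_sym : symmetric lie_congb.
Proof. by move=> s t; apply/asboolP/asboolP; apply: lc_sym. Qed.

Lemma lie_congb_trans : transitive lie_congb.
Proof.
by move=> t s u /asboolP st /asboolP tu; apply/asboolP; apply: lc_trans tu.
Qed.

Canonical lie_congb_equiv :=
  EquivRel lie_congb lie_congb_refl lie_congb_sym lie_congb_trans.

Definition lie_pres : Type := {eq_quot lie_congb}.

HB.instance Definition _ := Choice.on lie_pres.
HB.instance Definition _ := EqQuotient.on lie_pres.

Definition lp_class (s : lie_expr K X) : lie_pres := \pi_lie_pres s.

Lemma lp_classP s t : lp_class s = lp_class t <-> lie_cong s t.
Proof. by split=> [/eqmodP/asboolP|st] //; apply/eqmodP/asboolP. Qed.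

Lemma lp_reprK (x : lie_pres) : lp_class (repr x) = x.
Proof. exact: reprK. Qed.

Lemma lp_class_surj (x : lie_pres) : exists s, x = lp_class s.
Proof. by exists (repr x); rewrite lp_reprK. Qed.

Lemma lp_repr s : lie_cong (repr (lp_class s)) s.
Proof. by apply/lp_classP; rewrite lp_reprK. Qed.

Definition lp_add (x y : lie_pres) : lie_pres :=
  lp_class (LAdd (repr x) (repr y)).
Definition lp_scale (a : K) (x : lie_pres) : lie_pres :=
  lp_class (LScale a (repr x)).
Definition lp_br (x y : lie_pres) : lie_pres :=
  lp_class (LBr (repr x) (repr y)).

Lemma lp_addE s t : lp_add (lp_class s) (lp_class t) = lp_class (LAdd s t).
Proof. by apply/lp_classP; apply: lc_add; apply: lp_repr. Qed.

Lemma lp_scaleE a s : lp_scale a (lp_class s) = lp_class (LScale a s).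
Proof. by apply/lp_classP; apply: lc_scale; apply: lp_repr. Qed.

Lemma lp_brE s t : lp_br (lp_class s) (lp_class t) = lp_class (LBr s t).
Proof. by apply/lp_classP; apply: lc_br; apply: lp_repr. Qed.

Let lpE := (lp_addE, lp_scaleE, lp_brE).

Fact lp_addA : associative lp_add.
Proof.
move=> x y z; have [s ->] := lp_class_surj x; have [t ->] := lp_class_surj y.
by have [u ->] := lp_class_surj z; rewrite !lpE; apply/lp_classP/lc_addA.
Qed.

Fact lp_addC : commutative lp_add.
Proof.
move=> x y; have [s ->] := lp_class_surj x; have [t ->] := lp_class_surj y.
by rewrite !lpE; apply/lp_classP/lc_addC.
Qed.

Fact lp_add0 : left_id (lp_class LZero) lp_add.
Proof.
move=> x; have [s ->] := lp_class_surj x.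
by rewrite !lpE; apply/lp_classP/lc_add0.
Qed.

Fact lp_addN : left_inverse (lp_class LZero) (lp_scale (-1)) lp_add.
Proof.
move=> x; have [s ->] := lp_class_surj x.
by rewrite !lpE; apply/lp_classP/lc_addN.
Qed.

HB.instance Definition _ :=
  GRing.isZmodule.Build lie_pres lp_addA lp_addC lp_add0 lp_addN.

Fact lp_scaleA a b x : lp_scale a (lp_scale b x) = lp_scale (a * b) x.
Proof.
have [s ->] := lp_class_surj x.
by rewrite !lpE; apply/lp_classP/lc_scaleA.
Qed.

Fact lp_scale1 : left_id 1 lp_scale.
Proof.
move=> x; have [s ->] := lp_class_surj x.
by rewrite !lpE; apply/lp_classP/lc_scale1.
Qed.

Fact lp_scaleDr : right_distributive lp_scale +%R.
Proof.
move=> a x y; have [s ->] := lp_class_surj x; have [t ->] := lp_class_surj y.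
by rewrite /GRing.add/= !lpE; apply/lp_classP/lc_scaleDr.
Qed.

Fact lp_scaleDl x : {morph lp_scale^~ x : a b / a + b}.
Proof.
move=> a b; have [s ->] := lp_class_surj x.
by rewrite [RHS]/GRing.add/= !lpE; apply/lp_classP/lc_scaleDl.
Qed.

HB.instance Definition _ := GRing.Zmodule_isLmodule.Build K lie_pres
  lp_scaleA lp_scale1 lp_scaleDr lp_scaleDl.

Lemma lp_class0 : lp_class LZero = 0. Proof. by []. Qed.

Lemma lp_classD s t : lp_class (LAdd s t) = lp_class s + lp_class t.
Proof. by rewrite -lp_addE. Qed.

Lemma lp_classZ a s : lp_class (LScale a s) = a *: lp_class s.
Proof. by rewrite -lp_scaleE. Qed.

Fact lp_brl z a x y : lp_br (a *: x + y) z = a *: lp_br x z + lp_br y z.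
Proof.
have [s ->] := lp_class_surj x; have [t ->] := lp_class_surj y.
have [u ->] := lp_class_surj z.
by rewrite -lp_classZ -lp_classD !lpE -lp_classZ -lp_classD; apply/lp_classP/lc_brl.
Qed.

Fact lp_brr z a x y : lp_br z (a *: x + y) = a *: lp_br z x + lp_br z y.
Proof.
have [s ->] := lp_class_surj x; have [t ->] := lp_class_surj y.
have [u ->] := lp_class_surj z.
by rewrite -lp_classZ -lp_classD !lpE -lp_classZ -lp_classD; apply/lp_classP/lc_brr.
Qed.

Fact lp_brxx x : lp_br x x = 0.
Proof.
have [s ->] := lp_class_surj x.
by rewrite lpE; apply/lp_classP/lc_brxx.
Qed.

Fact lp_jacobi x y z :
  lp_br x (lp_br y z) + lp_br y (lp_br z x) + lp_br z (lp_br x y) = 0.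
Proof.
have [s ->] := lp_class_surj x; have [t ->] := lp_class_surj y.
have [u ->] := lp_class_surj z.
by rewrite !lpE -!lp_classD; apply/lp_classP/lc_jacobi.
Qed.

HB.instance Definition _ := Lmodule_isLie.Build K lie_pres
  lp_brl lp_brr lp_brxx lp_jacobi.

Lemma lp_classBr s t : lp_class (LBr s t) = lie_br (lp_class s) (lp_class t).
Proof. by rewrite -lp_brE. Qed.

End Presentation.

Inductive chevalley (n : nat) : Type :=
| ChevE of 'I_n
| ChevF of 'I_n
| ChevH of 'I_n.

Section KacMoody.
Variables (K : fieldType) (n : nat) (A : 'M[int]_n).

Local Notation expr := (lie_expr K (chevalley n)).
Local Notation e i := (LGen (ChevE i) : expr).
Local Notation f i := (LGen (ChevF i) : expr).
Local Notation h i := (LGen (ChevH i) : expr).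

Inductive chevalley_serre : expr -> expr -> Prop :=
| cs_hh i j : chevalley_serre (LBr (h i) (h j)) LZero
| cs_ef i : chevalley_serre (LBr (e i) (f i)) (h i)
| cs_ef0 i j : i != j -> chevalley_serre (LBr (e i) (f j)) LZero
| cs_he i j : chevalley_serre (LBr (h i) (e j)) (LScale (A i j)%:~R (e j))
| cs_hf i j : chevalley_serre (LBr (h i) (f j)) (LScale (- (A i j)%:~R) (f j))
| cs_ee i j : i != j ->
    chevalley_serre (iter `|1 - A i j|%N (LBr (e i)) (e j)) LZero
| cs_ff i j : i != j ->
    chevalley_serre (iter `|1 - A i j|%N (LBr (f i)) (f j)) LZero.

(* For \det A != 0 the minimal realization of A has the coroots h_i as a basis
   of its Cartan subalgebra, so no further Cartan generators are needed; the
   determinants of the two matrices used below are -1 and -4.  For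
   symmetrizable A the Serre relations generate the maximal ideal that meets
   the Cartan subalgebra trivially (Gabber-Kac), so this is Kac's g(A). *)
Definition kac_moody : Type := lie_pres chevalley_serre.

HB.instance Definition _ := LieAlgebra.on kac_moody.

Definition km_e (i : 'I_n) : kac_moody := lp_class chevalley_serre (e i).
Definition km_f (i : 'I_n) : kac_moody := lp_class chevalley_serre (f i).
Definition km_h (i : 'I_n) : kac_moody := lp_class chevalley_serre (h i).

Definition cartan_elt (c : 'rV[K]_n) : kac_moody := \sum_i c 0 i *: km_h i.

Definition cartan : set kac_moody := range cartan_elt.

(* For \det A != 0 the simple roots are a basis of the dual of the Cartan
   subalgebra: the row vector k stands for the weight \sum_j k_j alpha_j, with
   alpha_j (h_i) = A i j. *)
Definition weight_eval (k c : 'rV[K]_n) : K :=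
  \sum_i \sum_j c 0 i * (A i j)%:~R * k 0 j.

Definition root_space (k : 'rV[K]_n) : set kac_moody :=
  [set x | forall c, lie_br (cartan_elt c) x = weight_eval k c *: x].

Definition is_root (k : 'rV[K]_n) : Prop :=
  k != 0 /\ exists2 x, root_space k x & x != 0.

Definition simple_reflection (i : 'I_n) (k : 'rV[K]_n) : 'rV[K]_n :=
  k - weight_eval k (delta_mx 0 i) *: delta_mx 0 i.

Definition is_real_root (k : 'rV[K]_n) : Prop :=
  is_root k /\
  exists (w : seq 'I_n) (i : 'I_n),
    k = foldr simple_reflection (delta_mx 0 i) w.

End KacMoody.

Arguments kac_moody K {n} A.
Arguments km_e {K n} A i.
Arguments km_f {K n} A i.
Arguments km_h {K n} A i.
Arguments cartan_elt {K n} A c.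
Arguments cartan K {n} A.
Arguments weight_eval {K n} A k c.
Arguments root_space {K n} A k.
Arguments is_root {K n} A k.
Arguments simple_reflection {K n} A i k.
Arguments is_real_root {K n} A k.

(* The ten nodes are labelled -1, 0, ..., 8. *)
Definition label (i : 'I_10) : int := i%:Z - 1.

Definition diagram_cartan (edges : seq (int * int)) : 'M[int]_10 :=
  \matrix_(i, j)
    if i == j then 2
    else if ((label i, label j) \in edges) || ((label j, label i) \in edges)
    then -1 else 0.

Definition E10_matrix : 'M[int]_10 := diagram_cartan
  [:: (-1, 0); (0, 1); (1, 2); (2, 3); (3, 4); (4, 5); (5, 6); (6, 7); (5, 8)].

Definition DE10_matrix : 'M[int]_10 := diagram_cartan
  [:: (-1, 0); (0, 1); (1, 2); (2, 3); (3, 4); (4, 5); (5, 6); (1, 7); (5, 8)].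

Section E10.
Variable R : realType.
Local Notation C := (complex R).

Definition E10 : Type := kac_moody C E10_matrix.
Definition DE10 : Type := kac_moody C DE10_matrix.

HB.instance Definition _ := LieAlgebra.on E10.
HB.instance Definition _ := LieAlgebra.on DE10.

Definition alpha (m : int) : 'rV[C]_10 := \row_j (label j == m)%:R.

Definition xi : 'rV[C]_10 :=
  alpha 2 + 2 *: alpha 3 + 2 *: alpha 4 + 2 *: alpha 5 + alpha 6 + alpha 8.

(* The images of gamma_{-1}, gamma_0, ..., gamma_8. *)
Definition upsilon_images : seq 'rV[C]_10 :=
  [:: alpha (-1); alpha 0; alpha 1; xi; alpha 7; alpha 6; alpha 5; alpha 4;
      alpha 2; alpha 8].

Definition upsilon (k : 'rV[C]_10) : 'rV[C]_10 :=
  \sum_(i < 10) k 0 i *: upsilon_images`_i.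

(* Roots have integer coordinates, so this is the parity of k_3. *)
Definition even_weight (k : 'rV[C]_10) : Prop :=
  forall j, label j = 3 -> exists m : int, k 0 j = (2 * m)%:~R.

Definition g_inv : set E10 :=
  lie_generated (cartan C E10_matrix `|`
    \bigcup_(k in [set k | is_root E10_matrix k /\ even_weight k])
      root_space E10_matrix k).

End E10.

(* Main.v *)
(* Let b_i be the images under upsilon of the simple roots of DE10.  They are real
   roots of E10, so there are E_i, F_i of weights b_i, - b_i with [E_i, F_i] the
   coroot of b_i.  A vector of norm greater than 2 is not a root of E10: simple
   reflections preserve the norm and lower the height until the vector has
   coefficients of both signs or is a multiple of a simple root.  Since b_i - b_j
   (i <> j), b_i + b_j (A_ij = 0) and 2 b_i + b_j (A_ij = -1) have norm greater
   than 2, the elements E_i, F_i satisfy the relations of DE10.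

   The kernel of the resulting homomorphism meets the Cartan subalgebra trivially,
   so it is zero by the theorem of Gabber and Kac.  To prove the latter, let N be
   the smallest height at which the invariant form is degenerate, and let x be a
   vector of the radical of weight - k, where k has height N.  Every [e_i, x] is
   zero, so (k|k) <= 0 by sl2-theory.  In a highest weight module with highest
   weight 0 and generator v0, the Casimir operator truncated to heights below N
   acts by 0 on the span of the nonempty words in the f_i applied to v0, up to
   depth N, and by (k|k) - 2 N < 0 on x v0.  Hence x v0 = 0.  The module coinduced
   from the adjoint action of the lower triangular part on g has such a vector v0
   with x v0 <> 0 for x <> 0. *)

(* The norm argument has a second output: the descent by reflections also shows that weight spaces
   of norm 2 have dimension at most one, and this gives surjectivity in (c).

   The algebra is known only through its presentation, so even the independence of the h_i must come
   from a module. The coinduced module consists of functions on words in the e_i, which avoids a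
   basis of the enveloping algebra. The Serre relations for the f_i hold on all of it, those for the
   e_i only on the submodule generated by v0, so all actions are restricted to that submodule.

   The Casimir operator is truncated because it needs dual bases, which exist only at heights where
   the form is already nondegenerate. The missing heights would contribute nothing: the highest
   weight is 0, so an element whose height is at least the depth of a nonempty word kills that word
   applied to v0. The module is faithful on v0 because v0 lies over [rhov], which the h_i kill and
   for which [x, rhov] = N x when x has height - N.

   The matrix of upsilon has determinant 2 or -2, in accordance with the index 2 of the lattice of
   weights with k_3 even. *)
From HB Require Import structures.
Require Import Defs.
From mathcomp Require Import all_boot all_order all_algebra.
From mathcomp Require Import boolp classical_sets functions reals.
From mathcomp Require Import complex.
From mathcomp Require Import ring zify.

Set Implicit Arguments.
Unset Strict Implicit.
Unset Printing Implicit Defensive.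

Import Order.TTheory GRing.Theory Num.Theory.
Local Open Scope ring_scope.
Local Open Scope classical_set_scope.

(** * Lie algebras and presentations *)

(* The square-zero extension K + V is a commutative ring in which the K-module
   V embeds, so that [ring] decides linear identities in V. *)
Section SquareZero.
Variables (K : comNzRingType) (V : lmodType K).

Definition sqz : Type := (K * V)%type.
HB.instance Definition _ := GRing.Zmodule.on sqz.

Definition sqz_mul (x y : sqz) : sqz := (x.1 * y.1, x.1 *: y.2 + y.1 *: x.2).

Fact sqz_mulA : associative sqz_mul.
Proof.
move=> [a u] [b v] [c w]; congr pair => /=; first by rewrite mulrA.
by rewrite !scalerDr !scalerA addrA (mulrC c a) (mulrC c b).
Qed.
Fact sqz_mulC : commutative sqz_mul.
Proof. by move=> x y; congr pair; rewrite 1?mulrC 1?addrC. Qed.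
Fact sqz_mul1 : left_id (1, 0) sqz_mul.
Proof. by case=> a u; congr pair; rewrite /= ?mul1r // scale1r scaler0 addr0. Qed.
Fact sqz_mulDl : left_distributive sqz_mul +%R.
Proof.
move=> [a u] [b v] [c w]; congr pair => /=; first by rewrite mulrDl.
by rewrite scalerDl scalerDr addrACA.
Qed.
Fact sqz_oner_neq0 : ((1, 0) : sqz) != 0.
Proof. by apply/eqP=> -[/eqP]; rewrite oner_eq0. Qed.

HB.instance Definition _ := GRing.Zmodule_isComNzRing.Build sqz
  sqz_mulA sqz_mulC sqz_mul1 sqz_mulDl sqz_oner_neq0.

Definition sqz_s (a : K) : sqz := (a, 0).
Definition sqz_v (u : V) : sqz := (0, u).

Fact sqz_s_is_zmod : zmod_morphism sqz_s.
Proof. by move=> a b; congr pair; rewrite subrr. Qed.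
Fact sqz_s_is_monoid : monoid_morphism sqz_s.
Proof. by split=> // a b; congr pair; rewrite /= !scaler0 addr0. Qed.
HB.instance Definition _ := GRing.isZmodMorphism.Build K sqz sqz_s sqz_s_is_zmod.
HB.instance Definition _ := GRing.isMonoidMorphism.Build K sqz sqz_s sqz_s_is_monoid.

Lemma sqz_v_inj u v : sqz_v u = sqz_v v -> u = v.
Proof. by case. Qed.
Lemma sqz_vD u v : sqz_v (u + v) = sqz_v u + sqz_v v.
Proof. by congr pair; rewrite addr0. Qed.
Lemma sqz_vN u : sqz_v (- u) = - sqz_v u.
Proof. by congr pair; rewrite oppr0. Qed.
Lemma sqz_v0 : sqz_v 0 = 0.
Proof. by []. Qed.
Lemma sqz_vZ a u : sqz_v (a *: u) = sqz_s a * sqz_v u.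
Proof. by congr pair; rewrite /= ?mulr0 // scale0r addr0. Qed.
Lemma sqz_vMn u n : sqz_v (u *+ n) = sqz_v u * n%:R.
Proof.
rewrite mulr_natr; elim: n => [|n IH]; first by rewrite !mulr0n.
by rewrite !mulrS sqz_vD IH.
Qed.

Definition sqz_vE := (sqz_vD, sqz_vN, sqz_v0, sqz_vZ, sqz_vMn).
End SquareZero.

Ltac lmod := apply: sqz_v_inj; rewrite ?sqz_vE; ring.

Section LieTheory.
Variables (K : fieldType) (L : lieType K).
Implicit Types (a : K) (x y z : L).

HB.instance Definition _ (x : L) :=
  GRing.isLinear.Build K L L *:%R (lie_br x) (fun a y z => lie_linearr x a y z).

Lemma brDl x y z : lie_br (x + y) z = lie_br x z + lie_br y z.
Proof. by have := lie_linearl z 1 x y; rewrite !scale1r. Qed.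

Lemma br0l x : lie_br 0 x = 0.
Proof. by apply: (addrI (lie_br 0 x)); rewrite -brDl !addr0. Qed.

Lemma brZl a x y : lie_br (a *: x) y = a *: lie_br x y.
Proof. by have := lie_linearl y a x 0; rewrite !addr0 br0l addr0. Qed.

Lemma brNl x y : lie_br (- x) y = - lie_br x y.
Proof. by rewrite -scaleN1r brZl scaleN1r. Qed.

Lemma brDr x y z : lie_br z (x + y) = lie_br z x + lie_br z y.
Proof. exact: raddfD. Qed.

Lemma brZr a x y : lie_br x (a *: y) = a *: lie_br x y.
Proof. exact: linearZ. Qed.

Lemma br0r x : lie_br x 0 = 0.
Proof. exact: raddf0. Qed.

Lemma brNr x y : lie_br x (- y) = - lie_br x y.
Proof. exact: raddfN. Qed.

Lemma br_suml I (r : seq I) P (F : I -> L) z :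
  lie_br (\sum_(i <- r | P i) F i) z = \sum_(i <- r | P i) lie_br (F i) z.
Proof. by elim/big_rec2: _ => [|i x y _ <-]; rewrite ?br0l ?brDl. Qed.

Lemma br_sumr I (r : seq I) P (F : I -> L) z :
  lie_br z (\sum_(i <- r | P i) F i) = \sum_(i <- r | P i) lie_br z (F i).
Proof. exact: raddf_sum. Qed.

Lemma brC x y : lie_br x y = - lie_br y x.
Proof.
apply/eqP; rewrite -addr_eq0; apply/eqP.
by have := lie_brxx (x + y); rewrite brDl !brDr !lie_brxx add0r addr0.
Qed.

Lemma brA x y z :
  lie_br x (lie_br y z) = lie_br (lie_br x y) z + lie_br y (lie_br x z).
Proof.
have := lie_jacobi x y z; rewrite (brC z (lie_br x y)) (brC z x) brNr => J.
rewrite -[RHS]addr0 -J; lmod.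
Qed.

Lemma brAl x y z :
  lie_br (lie_br x y) z = lie_br x (lie_br y z) - lie_br y (lie_br x z).
Proof. by rewrite brA addrK. Qed.

End LieTheory.

(** * Subspaces and spans as predicates *)

Definition lin_closed (K : pzRingType) (V : lmodType K) (S : set V) : Prop :=
  S 0 /\ forall (a : K) x y, S x -> S y -> S (a *: x + y).

Section Span.
Variables (K : pzRingType) (V : lmodType K).
Implicit Types (P S : set V).

Inductive lin_span P : V -> Prop :=
| lin_span0 : lin_span P 0
| lspanP a x y : P x -> lin_span P y -> lin_span P (a *: x + y).

(** The standard induction below: a linear property, given as a kernel or as the preimage of a
    subspace, is checked on spanning words only. *)
Lemma lin_span_sub P S : lin_closed S -> P `<=` S -> lin_span P `<=` S.
Proof. by case=> S0 SD sPS x; elim=> // a {}x y /sPS Sx _; apply: SD. Qed.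

Lemma lin_span_gen P : P `<=` lin_span P.
Proof.
by move=> x Px; rewrite -[x]addr0 -[x]scale1r; apply: lspanP => //; apply: lin_span0.
Qed.

Lemma lin_span_closed P : lin_closed (lin_span P).
Proof.
split=> [|a x y Px]; first exact: lin_span0.
elim: Px y => [|b z t Pz _ IH] y Py; first by rewrite scaler0 add0r.
by rewrite scalerDr scalerA -addrA; apply: lspanP => //; apply: IH.
Qed.

Lemma lin_span_mono P S : P `<=` S -> lin_span P `<=` lin_span S.
Proof.
by move=> sPS; apply: lin_span_sub; [apply: lin_span_closed | move=> x /sPS; apply: lin_span_gen].
Qed.

Lemma lin_closedZ S a x : lin_closed S -> S x -> S (a *: x).
Proof. by case=> S0 SD Sx; rewrite -[_ *: _]addr0; apply: SD. Qed.

Lemma lin_closedD S x y : lin_closed S -> S x -> S y -> S (x + y).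
Proof. by case=> S0 SD Sx Sy; rewrite -[x]scale1r; apply: SD. Qed.

Lemma lin_closedN S x : lin_closed S -> S x -> S (- x).
Proof. by rewrite -scaleN1r; apply: lin_closedZ. Qed.

Lemma lin_closedB S x y : lin_closed S -> S x -> S y -> S (x - y).
Proof. by move=> cS Sx Sy; apply: lin_closedD => //; apply: lin_closedN. Qed.

Lemma lin_closed_sum S I (r : seq I) (P : pred I) (F : I -> V) :
  lin_closed S -> (forall i, P i -> S (F i)) -> S (\sum_(i <- r | P i) F i).
Proof.
move=> cS SF; elim/big_ind: _ => // [|x y]; first by case: cS.
exact: lin_closedD.
Qed.

Lemma set0_closed : lin_closed [set (0 : V)].
Proof. by split=> // a x y -> ->; rewrite /= scaler0 addr0. Qed.

End Span.
Arguments lin_span_sub {K V P S}.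

Lemma lin_closed_preim (K : pzRingType) (U V : lmodType K) (f : {linear U -> V})
    (S : set V) : lin_closed S -> lin_closed (f @^-1` S).
Proof.
case=> S0 SD; split=> [|a x y]; rewrite /preimage /= ?raddf0 //.
by rewrite linearP; apply: SD.
Qed.

(** [lie_br] is declared linear in its second argument, to which [lin_closed_preim] applies; this is
    the version for the first argument. *)
Lemma lin_closed_prel (K : fieldType) (L : lieType K) (y : L)
    (S : set L) : lin_closed S -> lin_closed [set x | S (lie_br x y)].
Proof.
case=> S0 SD; split=> [|a x z] /=; rewrite ?br0l //.
by rewrite lie_linearl; apply: SD.
Qed.

(** * The Lie algebra of endomorphisms *)

Section Gl.
Variables (K : fieldType) (V : lmodType K).

(** Operators are made elements of a Lie algebra so that [triangular_rels] and [serre_elt] speak of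
    operators and of elements of [kac_moody] alike. *)
Record gl : Type := Gl { gl_val :> V -> V; gl_linear : linear gl_val }.

HB.instance Definition _ := gen_eqMixin gl.
HB.instance Definition _ := gen_choiceMixin gl.

HB.instance Definition _ (f : gl) :=
  GRing.isLinear.Build K V V *:%R (gl_val f) (gl_linear f).

Lemma gl_ext (f g : gl) : (forall v, f v = g v) -> f = g.
Proof.
case: f g => [f fl] [g gL] /= fg; have {fg} fg : f = g by apply: funext.
by case: g / fg gL => gL; congr Gl; apply: Prop_irrelevance.
Qed.

Fact gl_zero_linear : linear (fun _ : V => 0 : V).
Proof. by move=> a u v; rewrite scaler0 addr0. Qed.
Fact gl_add_linear (f g : gl) : linear (fun v => f v + g v).
Proof. by move=> a u v; rewrite !linearP scalerDr addrACA. Qed.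
Fact gl_opp_linear (f : gl) : linear (fun v => - f v).
Proof. by move=> a u v; rewrite linearP; lmod. Qed.
Fact gl_scale_linear c (f : gl) : linear (fun v => c *: f v).
Proof. by move=> a u v; rewrite linearP; lmod. Qed.
Fact gl_br_linear (f g : gl) : linear (fun v => f (g v) - g (f v)).
Proof. by move=> a u v; rewrite !linearP /=; lmod. Qed.

Definition gl_zero := Gl gl_zero_linear.
Definition gl_add f g := Gl (gl_add_linear f g).
Definition gl_opp f := Gl (gl_opp_linear f).
Definition gl_scale c f := Gl (gl_scale_linear c f).
Definition gl_br f g := Gl (gl_br_linear f g).

Fact gl_addA : associative gl_add.
Proof. by move=> f g h; apply: gl_ext => v /=; rewrite addrA. Qed.
Fact gl_addC : commutative gl_add.
Proof. by move=> f g; apply: gl_ext => v /=; rewrite addrC. Qed.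
Fact gl_add0 : left_id gl_zero gl_add.
Proof. by move=> f; apply: gl_ext => v /=; rewrite add0r. Qed.
Fact gl_addN : left_inverse gl_zero gl_opp gl_add.
Proof. by move=> f; apply: gl_ext => v /=; rewrite addNr. Qed.

HB.instance Definition _ :=
  GRing.isZmodule.Build gl gl_addA gl_addC gl_add0 gl_addN.

Fact gl_scaleA a b f : gl_scale a (gl_scale b f) = gl_scale (a * b) f.
Proof. by apply: gl_ext => v /=; rewrite scalerA. Qed.
Fact gl_scale1 : left_id 1 gl_scale.
Proof. by move=> f; apply: gl_ext => v /=; rewrite scale1r. Qed.
Fact gl_scaleDr : right_distributive gl_scale +%R.
Proof. by move=> a f g; apply: gl_ext => v /=; rewrite scalerDr. Qed.
Fact gl_scaleDl f : {morph gl_scale^~ f : a b / a + b}.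
Proof. by move=> a b; apply: gl_ext => v /=; rewrite scalerDl. Qed.

HB.instance Definition _ := GRing.Zmodule_isLmodule.Build K gl
  gl_scaleA gl_scale1 gl_scaleDr gl_scaleDl.

Fact gl_brl h (a : K) f g : gl_br (a *: f + g) h = a *: gl_br f h + gl_br g h.
Proof.
by apply: gl_ext => v /=; rewrite linearP /=; lmod.
Qed.
Fact gl_brr h (a : K) f g : gl_br h (a *: f + g) = a *: gl_br h f + gl_br h g.
Proof.
by apply: gl_ext => v /=; rewrite linearP /=; lmod.
Qed.
Fact gl_brxx f : gl_br f f = 0.
Proof. by apply: gl_ext => v /=; rewrite subrr. Qed.
Fact gl_jacobi f g h :
  gl_br f (gl_br g h) + gl_br g (gl_br h f) + gl_br h (gl_br f g) = 0.
Proof.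
by apply: gl_ext => v /=; rewrite !raddfB /=; lmod.
Qed.

HB.instance Definition _ := Lmodule_isLie.Build K gl
  gl_brl gl_brr gl_brxx gl_jacobi.

Lemma gl_brE (f g : gl) v : lie_br f g v = f (g v) - g (f v).
Proof. by []. Qed.
Lemma gl_addE (f g : gl) v : (f + g) v = f v + g v.
Proof. by []. Qed.
Lemma gl_scaleE a (f : gl) v : (a *: f) v = a *: f v.
Proof. by []. Qed.
End Gl.

Section Presentation.
Variables (K : fieldType) (X : Type).
Implicit Type L : lieType K.

Fixpoint lie_eval L (u : X -> L) (s : lie_expr K X) : L :=
  match s with
  | LGen x => u x
  | LZero => 0
  | LAdd s t => lie_eval u s + lie_eval u t
  | LScale a s => a *: lie_eval u s
  | LBr s t => lie_br (lie_eval u s) (lie_eval u t)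
  end.

Variable rels : lie_expr K X -> lie_expr K X -> Prop.

Lemma lie_eval_cong L (u : X -> L) s t :
    (forall s t, rels s t -> lie_eval u s = lie_eval u t) ->
  lie_cong rels s t -> lie_eval u s = lie_eval u t.
Proof.
move=> urel; elim=> {s t} //=.
- by move=> s t u' _ -> _ ->.
- by move=> s s' t t' _ -> _ ->.
- by move=> a s s' _ ->.
- by move=> s s' t t' _ -> _ ->.
- by move=> *; rewrite addrA.
- by move=> *; rewrite addrC.
- by move=> *; rewrite add0r.
- by move=> *; rewrite scaleN1r addNr.
- by move=> *; rewrite scalerA.
- by move=> *; rewrite scale1r.
- by move=> *; rewrite scalerDr.
- by move=> *; rewrite scalerDl.
- by move=> *; rewrite lie_linearl.
- by move=> *; rewrite lie_linearr.
- by move=> *; rewrite lie_brxx.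
- by move=> *; rewrite lie_jacobi.
Qed.

Lemma lie_pres_ind (S : set (lie_pres rels)) : lie_subalgebra S ->
  (forall x, S (lp_class rels (LGen x))) -> forall x, S x.
Proof.
case=> S0 SD Sbr Sgen x; have [s ->] := lp_class_surj x.
elim: s => {x} [x||s Ss t St|a s Ss|s Ss t St] //.
- by rewrite lp_classD -[lp_class _ s]scale1r; apply: SD.
- by rewrite lp_classZ -[_ *: _]addr0; apply: SD.
- by rewrite lp_classBr; apply: Sbr.
Qed.

Section Hom.
Variables (L : lieType K) (u : X -> L).
Hypothesis urel : forall s t, rels s t -> lie_eval u s = lie_eval u t.

Definition lie_hom (x : lie_pres rels) : L := lie_eval u (repr x).

Lemma lie_homE s : lie_hom (lp_class rels s) = lie_eval u s.
Proof. exact/(lie_eval_cong urel)/lp_repr. Qed.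

Fact lie_hom_is_linear : linear lie_hom.
Proof.
move=> a x y; have [s ->] := lp_class_surj x; have [t ->] := lp_class_surj y.
by rewrite -lp_classZ -lp_classD !lie_homE.
Qed.

Lemma lie_hom_morphism : lie_morphism lie_hom.
Proof.
move=> x y; have [s ->] := lp_class_surj x; have [t ->] := lp_class_surj y.
by rewrite -lp_classBr !lie_homE.
Qed.

End Hom.

Lemma lie_hom_exists (L : lieType K) (u : X -> L) :
    (forall s t, rels s t -> lie_eval u s = lie_eval u t) ->
  exists phi : {linear lie_pres rels -> L}, lie_morphism phi /\
    forall x, phi (lp_class rels (LGen x)) = u x.
Proof.
move=> urel; pose phi : lie_pres rels -> L := lie_hom u.
pose c := GRing.isLinear.Build K _ L *:%R phi (lie_hom_is_linear urel).
pose Phi : {linear lie_pres rels -> L} := HB.pack phi c.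
exists Phi; split; first exact: lie_hom_morphism.
by move=> x; apply: lie_homE.
Qed.

(* A representation on a subspace N that is stable under operators satisfying
   the relations on N only. *)
Section StableModule.
Variables (V : lmodType K) (u : X -> gl V) (N : set V).
Hypothesis cN : lin_closed N.
Hypothesis uN : forall x v, N v -> N (u x v).

Lemma lie_eval_stable s v : N v -> N (lie_eval u s v).
Proof.
elim: s v => [x||s IHs t IHt|a s IHs|s IHs t IHt] v Nv /=.
- exact: uN.
- by case: cN.
- by apply: lin_closedD; [|exact: IHs|exact: IHt].
- by apply: lin_closedZ; last exact: IHs.
- by apply: lin_closedB => //; do ?[apply: IHs|apply: IHt].
Qed.

Hypothesis urel : forall s t, rels s t ->
  forall v, N v -> lie_eval u s v = lie_eval u t v.

Lemma lie_eval_cong_stable s t : lie_cong rels s t ->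
  forall v, N v -> lie_eval u s v = lie_eval u t v.
Proof.
elim=> {s t} //=; try (by move=> * /=; rewrite ?(raddfB, linearP) /=; lmod).
- by move=> s t _ IH v Nv; rewrite IH.
- by move=> s t w _ IH1 _ IH2 v Nv; rewrite IH1 ?IH2.
- by move=> s s' t t' _ IH1 _ IH2 v Nv; rewrite IH1 ?IH2.
- by move=> a s s' _ IH v Nv; rewrite IH.
- move=> s s' t t' _ IH1 _ IH2 v Nv.
  by rewrite (IH1 v) // (IH2 v) // IH1 ?IH2 //; apply: lie_eval_stable.
Qed.

Definition lie_act (x : lie_pres rels) : gl V := lie_eval u (repr x).

Lemma lie_actE s v : N v -> lie_act (lp_class rels s) v = lie_eval u s v.
Proof. exact/lie_eval_cong_stable/lp_repr. Qed.

Lemma lie_act_stable x v : N v -> N (lie_act x v).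
Proof. exact: lie_eval_stable. Qed.

Lemma lie_actP a x y v : N v ->
  lie_act (a *: x + y) v = a *: lie_act x v + lie_act y v.
Proof.
move=> Nv; have [s ->] := lp_class_surj x; have [t ->] := lp_class_surj y.
by rewrite -lp_classZ -lp_classD !lie_actE.
Qed.

Lemma lie_act_br x y v : N v ->
  lie_act (lie_br x y) v = lie_act x (lie_act y v) - lie_act y (lie_act x v).
Proof.
move=> Nv; have [s ->] := lp_class_surj x; have [t ->] := lp_class_surj y.
by rewrite -lp_classBr !lie_actE //; exact: lie_eval_stable.
Qed.

End StableModule.
End Presentation.

(** * Modules coinduced from the lower triangular part *)

Section SimplyLaced.
Variables (K : fieldType) (n : nat) (A : 'M[int]_n).
Implicit Type L : lieType K.

Definition simply_laced : Prop :=
  [/\ forall i, A i i = 2, forall i j, A i j = A j i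
    & forall i j, i != j -> A i j = 0 \/ A i j = -1].

Local Notation "c %:K" := (c%:~R : K) (at level 2, format "c %:K").

Definition triangular_rels L (e f h : 'I_n -> L) : Prop :=
  [/\ forall i j, lie_br (h i) (h j) = 0,
      forall i j, lie_br (e i) (f j) = (i == j)%:R *: h i,
      forall i j, lie_br (h i) (e j) = (A i j)%:K *: e j
    & forall i j, lie_br (h i) (f j) = - (A i j)%:K *: f j].

Definition serre_elt L (x : 'I_n -> L) i j :=
  iter `|1 - A i j|%N (lie_br (x i)) (x j).

(** The Chevalley involution at the level of relations; it transfers statements about the f_i to the
    e_i. *)
Lemma triangular_swap L (e f h : 'I_n -> L) : triangular_rels e f h ->
  triangular_rels f e (fun i => - h i).
Proof.
case=> hh ef he hf; split=> i j.
- by rewrite brNl brNr opprK hh.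
- rewrite brC ef scalerN eq_sym.
  by have [->|_] := eqVneq i j; rewrite ?scale0r.
- by rewrite brNl hf scaleNr opprK.
- by rewrite brNl he scaleNr.
Qed.

Hypothesis slA : simply_laced.

Lemma serre_eltE L (x : 'I_n -> L) i j : i != j ->
  A i j = 0 /\ serre_elt x i j = lie_br (x i) (x j) \/
  A i j = -1 /\ serre_elt x i j = lie_br (x i) (lie_br (x i) (x j)).
Proof.
by case: slA => _ _ /[apply] -[] Aij; rewrite /serre_elt Aij; [left|right].
Qed.

(** A computation from the triangular relations alone. It therefore applies in the coinduced module,
    where the Serre relations are still to be derived. *)
Lemma serre_commute L (e f h : 'I_n -> L) i j k :
  triangular_rels e f h -> i != j -> lie_br (e k) (serre_elt f i j) = 0.
Proof.
case=> hh ef he hf neq; case: slA => Ad As _.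
have E1 : lie_br (e k) (lie_br (f i) (f j)) =
    (k == j)%:R *: ((A i j)%:K *: f i) - (k == i)%:R *: ((A i j)%:K *: f j).
  rewrite brA !ef brZl brZr [lie_br (f i) _]brC !hf (As k i).
  have [->|_] := eqVneq k i; rewrite ?(negbTE neq).
    by rewrite !mulr0n !mulr1n; lmod.
  by have [->|_] := eqVneq k j; rewrite ?(As j i) ?mulr1n ?mulr0n; lmod.
case: (serre_eltE f neq) => -[Aij ->].
  by rewrite E1 Aij !scale0r !scaler0 subr0.
rewrite brA ef brZl [lie_br (h k) _]brA !hf E1 Aij !brZl !brZr.
have [->|_] := eqVneq k i; last first.
  by rewrite !mulr0n raddfB /= !brZr lie_brxx; lmod.
rewrite Ad Aij (negbTE neq) mulr0n mulr1n raddfB /= !brZr.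
by rewrite !(intrN, mulr1z) /=; lmod.
Qed.

Section Coinduced.
Variables (P : lmodType K) (pf ph : 'I_n -> gl P).
Hypothesis phh : forall i j, lie_br (ph i) (ph j) = 0.
Hypothesis phf : forall i j, lie_br (ph i) (pf j) = - (A i j)%:K *: pf j.
Hypothesis pserre : forall i j, i != j -> serre_elt pf i j = 0.

Local Notation F := (seq 'I_n -> P).

(* The module coinduced from the b_- -module P: the value at [:: i1; ...; ik]
   of the function encoding a map phi is phi (e_ik ... e_i1). *)
Definition coind_e_fun (i : 'I_n) (u : F) : F := fun w => u (i :: w).
Definition coind_h_fun (k : 'I_n) (u : F) : F :=
  fun w => ph k (u w) - (\sum_(i <- w) (A k i)%:K) *: u w.
(** The rule e_i f_k = f_k e_i + (i == k) h_k carries f_k to the left through the word until it acts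
    on P. The sum subtracted in [coind_h_fun] is likewise the weight that h_k picks up on its way to
    the left. *)
Fixpoint coind_f_rec (k : 'I_n) (w : seq 'I_n) (u : F) {struct w} : P :=
  match w with
  | [::] => pf k (u [::])
  | i :: w => coind_f_rec k w (coind_e_fun i u) + (i == k)%:R *: coind_h_fun k u w
  end.

Fact coind_e_linear i : linear (coind_e_fun i).
Proof. by move=> a u v; apply: funext => w. Qed.
Fact coind_h_linear i : linear (coind_h_fun i).
Proof.
move=> a u v; apply: funext => w; rewrite /coind_h_fun !fctE linearP /=; lmod.
Qed.
Fact coind_f_linear i : linear (fun u w => coind_f_rec i w u).
Proof.
move=> a u v; apply: funext => w.
have -> : forall f g : F, (a *: f + g) w = a *: f w + g w by [].
elim: w u v => [|j w IH] u v /=; first by rewrite -linearP.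
rewrite coind_e_linear IH coind_h_linear.
have -> : forall f g : F, (a *: f + g) w = a *: f w + g w by [].
lmod.
Qed.

Definition coind_e i : gl F := Gl (coind_e_linear i).
Definition coind_h i : gl F := Gl (coind_h_linear i).
Definition coind_f i : gl F := Gl (coind_f_linear i).

(** Since (e_i u) w = u (i :: w), an operator commuting with all e_i is determined by its values at
    the empty word. Relations between operators are thus reduced to relations in P. *)
Lemma gl_coind_eq0 (r : gl F) : (forall u, r u [::] = 0) ->
  (forall i, lie_br (coind_e i) r = 0) -> r = 0.
Proof.
move=> r0 er; apply: gl_ext => u; apply: funext => w.
elim: w u => [|i w IH] u; first exact: r0.
have /eqP : r u (i :: w) - r (coind_e i u) w = 0.
  exact: (congr1 (fun g : gl F => g u w) (er i)).
by rewrite subr_eq0 => /eqP ->; apply: IH.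
Qed.

Lemma coind_rels : triangular_rels coind_e coind_f coind_h.
Proof.
have hh i j : lie_br (coind_h i) (coind_h j) = 0.
  apply: gl_ext => u; apply: funext => w.
  have /eqP : ph i (ph j (u w)) - ph j (ph i (u w)) = 0.
    exact: (congr1 (fun g : gl P => g (u w)) (phh i j)).
  rewrite subr_eq0 => /eqP Eij.
  have -> : lie_br (coind_h i) (coind_h j) u w =
    coind_h_fun i (coind_h_fun j u) w - coind_h_fun j (coind_h_fun i u) w by [].
  have -> : (0 : gl F) u w = 0 by [].
  rewrite /coind_h_fun !raddfB /= !linearZ /= Eij; lmod.
have he i j : lie_br (coind_h i) (coind_e j) = (A i j)%:K *: coind_e j.
  apply: gl_ext => u; apply: funext => w.
  have -> : lie_br (coind_h i) (coind_e j) u w =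
    coind_h_fun i (coind_e_fun j u) w - coind_h_fun i u (j :: w) by [].
  have -> : ((A i j)%:K *: coind_e j) u w = (A i j)%:K *: u (j :: w) by [].
  rewrite /coind_h_fun /coind_e_fun big_cons; lmod.
have ef i j : lie_br (coind_e i) (coind_f j) = (i == j)%:R *: coind_h i.
  apply: gl_ext => u; apply: funext => w.
  have -> : lie_br (coind_e i) (coind_f j) u w =
    coind_f_rec j w (coind_e_fun i u) + (i == j)%:R *: coind_h_fun j u w -
    coind_f_rec j w (coind_e_fun i u) by [].
  rewrite addrAC subrr add0r.
  have -> : ((i == j)%:R *: coind_h i) u w = (i == j)%:R *: coind_h_fun i u w by [].
  by have [->|] := eqVneq i j; rewrite ?mulr0n ?scale0r.
split=> // i j; apply/eqP; rewrite -subr_eq0 -scaleNr opprK; apply/eqP.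
apply: gl_coind_eq0 => [u|k].
  have E : ph i (pf j (u [::])) - pf j (ph i (u [::])) = - (A i j)%:K *: pf j (u [::]).
    exact: (congr1 (fun g : gl P => g (u [::])) (phf i j)).
  have -> : (lie_br (coind_h i) (coind_f j) + (A i j)%:K *: coind_f j) u [::] =
    coind_h_fun i (coind_f j u) [::] - pf j (coind_h_fun i u [::]) +
    (A i j)%:K *: pf j (u [::]) by [].
  rewrite /coind_h_fun !big_nil !scale0r !subr0 [_ - _]E; lmod.
rewrite brDr brA [lie_br (coind_e k) (coind_h i)]brC he brNl brZl ef !brZr ef hh.
by have [->|_] := eqVneq k j; rewrite ?mulr1n ?mulr0n; lmod.
Qed.

Lemma coind_serre_f i j : i != j -> serre_elt coind_f i j = 0.
Proof.
move=> neq; apply: gl_coind_eq0 => [u|k]; last exact: serre_commute coind_rels neq.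
have <- : serre_elt pf i j (u [::]) = 0 by rewrite pserre.
have [[Aij ->]|[Aij ->]] := serre_eltE coind_f neq;
  by have [[]|[]] := serre_eltE pf neq; rewrite Aij // => _ ->.
Qed.

Variables (p0 : P) (lam : 'I_n -> K).
Hypothesis php0 : forall i, ph i p0 = lam i *: p0.

Definition coind_v : F := fun w => if w is [::] then p0 else 0.

Lemma coind_e_v i : coind_e i coind_v = 0.
Proof. by apply: funext. Qed.

Lemma coind_h_v i : coind_h i coind_v = lam i *: coind_v.
Proof.
apply: funext => -[|j w]; rewrite !fctE /= /coind_h_fun /=.
  by rewrite big_nil scale0r subr0 php0.
by rewrite raddf0 !scaler0 subr0.
Qed.

Definition coind_word (w : seq 'I_n) : F := foldr coind_f coind_v w.

(** The submodule generated by [coind_v]. On arbitrary functions the e_i only shift words and need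
    not satisfy the Serre relations; here they do. *)
Definition coind_N : set F := lin_span (range coind_word).

Lemma coind_N_closed : lin_closed coind_N. Proof. exact: lin_span_closed. Qed.

Lemma coind_N_v : coind_N coind_v.
Proof. by apply: lin_span_gen; exists [::]. Qed.

Lemma coind_N_f i u : coind_N u -> coind_N (coind_f i u).
Proof.
suff: coind_N `<=` coind_f i @^-1` coind_N by apply.
apply: lin_span_sub; first exact/lin_closed_preim/coind_N_closed.
by move=> _ [w _ <-]; apply: lin_span_gen; exists (i :: w).
Qed.

Lemma coind_h_word i w :
  coind_h i (coind_word w) = (lam i - \sum_(j <- w) (A i j)%:K) *: coind_word w.
Proof.
elim: w => [|k w IH]; first by rewrite big_nil subr0 -coind_h_v.
rewrite -[coind_word (k :: w)]/(coind_f k (coind_word w)).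
case: coind_rels => _ _ _ /(_ i k) /(congr1 (fun g : gl F => g (coind_word w))).
rewrite gl_brE gl_scaleE big_cons => /eqP; rewrite subr_eq => /eqP ->.
rewrite IH linearZ /=; lmod.
Qed.

Lemma coind_N_h i u : coind_N u -> coind_N (coind_h i u).
Proof.
suff: coind_N `<=` coind_h i @^-1` coind_N by apply.
apply: lin_span_sub; first exact/lin_closed_preim/coind_N_closed.
move=> _ [w _ <-]; rewrite /preimage /mkset coind_h_word.
by apply: lin_closedZ coind_N_closed _; apply: lin_span_gen; exists w.
Qed.

Lemma coind_N_e i u : coind_N u -> coind_N (coind_e i u).
Proof.
suff: coind_N `<=` coind_e i @^-1` coind_N by apply.
apply: lin_span_sub; first exact/lin_closed_preim/coind_N_closed.
move=> _ [w _ <-]; rewrite /preimage /mkset.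
have cN := coind_N_closed.
elim: w => [|k w IH]; first by rewrite [coind_e i _]coind_e_v; case: cN.
rewrite -[coind_word (k :: w)]/(coind_f k (coind_word w)).
case: coind_rels => _ /(_ i k) /(congr1 (fun g : gl F => g (coind_word w))) + _ _.
rewrite gl_brE gl_scaleE => /eqP; rewrite subr_eq => /eqP ->.
apply: lin_closedD => //; last exact: coind_N_f.
by apply: lin_closedZ => //; apply: coind_N_h; apply: lin_span_gen; exists w.
Qed.

(** By [serre_commute] with e and f exchanged, the Serre element commutes with every f_k. It kills
    [coind_v], hence every word applied to [coind_v]. *)
Lemma coind_serre_e i j u : i != j -> coind_N u -> serre_elt coind_e i j u = 0.
Proof.
move=> neq; set r := serre_elt _ i j.
suff: coind_N `<=` r @^-1` [set 0] by apply.
apply: lin_span_sub; first exact/lin_closed_preim/set0_closed.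
move=> _ [w _ <-]; rewrite /preimage /mkset.
have fr k := serre_commute k (triangular_swap coind_rels) neq.
elim: w => [|k w IH].
  have br_v (f g : gl F) : f coind_v = 0 -> g coind_v = 0 ->
      lie_br f g coind_v = 0.
    by rewrite gl_brE => -> ->; rewrite !raddf0 addr0.
  have ev k : coind_e k coind_v = 0 by exact: coind_e_v.
  suff : r coind_v = 0 by [].
  rewrite /r; have [[_ ->]|[_ ->]] := serre_eltE coind_e neq.
    by rewrite br_v.
  by rewrite !br_v.
have := congr1 (fun g : gl F => g (coind_word w)) (fr k).
by rewrite gl_brE IH raddf0 sub0r => /eqP; rewrite oppr_eq0 => /eqP.
Qed.

Definition coind_gen (x : chevalley n) : gl F :=
  match x with
  | ChevE i => coind_e i
  | ChevF i => coind_f i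
  | ChevH i => coind_h i
  end.

Lemma coind_gen_N x u : coind_N u -> coind_N (coind_gen x u).
Proof. by case: x => i /=; [apply: coind_N_e|apply: coind_N_f|apply: coind_N_h]. Qed.

End Coinduced.

Lemma lie_eval_iter (X : Type) L (v : X -> L) x s m :
  lie_eval v (iter m (LBr (LGen x)) s) = iter m (lie_br (v x)) (lie_eval v s).
Proof. by elim: m => //= m ->. Qed.

Definition chev_image L (e f h : 'I_n -> L) (x : chevalley n) : L :=
  match x with ChevE i => e i | ChevF i => f i | ChevH i => h i end.

Lemma km_hom_exists L (e f h : 'I_n -> L) :
    triangular_rels e f h ->
    (forall i j, i != j -> serre_elt e i j = 0) ->
    (forall i j, i != j -> serre_elt f i j = 0) ->
  exists phi : {linear kac_moody K A -> L},
    [/\ lie_morphism phi, forall i, phi (km_e A i) = e i,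
        forall i, phi (km_f A i) = f i & forall i, phi (km_h A i) = h i].
Proof.
case=> hh ef he hf se sf.
have urel s t : chevalley_serre A s t ->
    lie_eval (chev_image e f h) s = lie_eval (chev_image e f h) t.
  case=> {s t} [i j|i|i j /negbTE nij|i j|i j|i j nij|i j nij] //=.
  - by rewrite ef eqxx scale1r.
  - by rewrite ef nij scale0r.
  - by rewrite lie_eval_iter; apply: se.
  - by rewrite lie_eval_iter; apply: sf.
have [phi [mor gen]] := lie_hom_exists urel.
by exists phi; split=> // i; apply: gen.
Qed.

End SimplyLaced.

(** * Root spaces *)

Section Sl2.
Variables (K : numFieldType) (L : lieType K) (e f h : L).
Hypothesis ef : lie_br e f = h.
Hypothesis hf : lie_br h f = - 2 *: f.
Hypothesis he : lie_br h e = 2 *: e.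

Lemma sl2_h_f p v m : lie_br h v = p *: v ->
  lie_br h (iter m (lie_br f) v) = (p - 2 * m%:R) *: iter m (lie_br f) v.
Proof.
move=> hv; elim: m => [|m IH] /=; first by rewrite mulr0 subr0.
by rewrite brA hf brZl IH brZr -[m.+1%:R]natr1; lmod.
Qed.

Lemma sl2_e_f p v m : lie_br h v = p *: v ->
  lie_br e (iter m.+1 (lie_br f) v) =
    iter m.+1 (lie_br f) (lie_br e v) + (m.+1%:R * (p - m%:R)) *: iter m (lie_br f) v.
Proof.
move=> hv; elim: m => [|m IH]; first by rewrite /= brA ef hv; lmod.
rewrite iterS brA ef (sl2_h_f m.+1 hv) IH brDr brZr -!iterS -[m.+2%:R]natr1 -[m.+1%:R]natr1.
lmod.
Qed.

(** Induction on r: e v satisfies the hypotheses with p + 2 and q + 1, so e v = 0. Then v is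
    primitive, and e f^(q+1) v = (q+1)(p-q) f^q v with q < p lowers the exponent of f step by step
    to 0. *)
Lemma sl2_inj (p q r : nat) v : (q <= p)%N -> lie_br h v = p%:R *: v ->
  iter q (lie_br f) v = 0 -> iter r (lie_br e) v = 0 -> v = 0.
Proof.
elim: r p q v => [|r IH] p q v le_qp hv fv ev; first exact: ev.
have ev0 : lie_br e v = 0.
  apply: (IH (p + 2)%N q.+1) => //.
  - by rewrite addn2 ltnS leqW.
  - by rewrite brA he hv brZl brZr natrD; lmod.
  - have := sl2_e_f q hv; rewrite fv scaler0 addr0 => <-.
    by rewrite iterS fv !br0r.
  - by rewrite -iterSr.
elim: q le_qp fv => // q IHq lt_qp fv; apply: IHq (ltnW lt_qp) _.
have := sl2_e_f q hv; rewrite fv br0r ev0.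
have -> : iter q.+1 (lie_br f) 0 = 0 by elim: (q.+1) => //= m ->; rewrite br0r.
rewrite add0r => /esym/eqP; rewrite scaler_eq0 mulf_eq0 pnatr_eq0 subr_eq0 eqr_nat /=.
by rewrite gtn_eqF // => /eqP.
Qed.

End Sl2.

(** * Local nilpotency *)

Section AdNilpotent.
Variables (K : fieldType) (L : lieType K) (d : L).

Definition ad_nil (x : L) : Prop := exists m, iter m (lie_br d) x = 0.

Lemma iter_br0 m : iter m (lie_br d) 0 = 0.
Proof. by elim: m => //= m ->; rewrite br0r. Qed.

Lemma iter_brP m (a : K) x y :
  iter m (lie_br d) (a *: x + y) = a *: iter m (lie_br d) x + iter m (lie_br d) y.
Proof. by elim: m => //= m ->; rewrite lie_linearr. Qed.

Lemma iter_br_eq0 m p x : (m <= p)%N -> iter m (lie_br d) x = 0 -> iter p (lie_br d) x = 0.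
Proof. by move=> /subnK <- x0; rewrite iterD x0 iter_br0. Qed.

Lemma iter_br_br_eq0 m p q x y : (p + q <= m)%N ->
    iter p (lie_br d) x = 0 -> iter q (lie_br d) y = 0 ->
  iter m (lie_br d) (lie_br x y) = 0.
Proof.
elim: m p q x y => [|m IH] [|p] [|q] x y //= le_m; try by
  move=> x0 y0; rewrite ?x0 ?y0 ?br0l ?br0r // iter_br0 br0r.
rewrite -!iterS !iterSr => xp yq.
rewrite brA -[lie_br (lie_br d x) y]scale1r iter_brP scale1r.
rewrite (IH p q.+1) ?add0r ?(IH p.+1 q) // ?iterSr //.
by move: le_m; rewrite addSn addnS.
Qed.

Lemma ad_nil_subalgebra : lie_subalgebra ad_nil.
Proof.
split=> [|a x y [p xp] [q yq]|x y [p xp] [q yq]]; first by exists 0%N.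
- exists (p + q)%N; rewrite iter_brP (iter_br_eq0 _ xp) ?leq_addr //.
  by rewrite (iter_br_eq0 _ yq) ?leq_addl // scaler0 addr0.
- by exists (p + q)%N; apply: iter_br_br_eq0 xp yq.
Qed.

End AdNilpotent.

Section KacMoodyTheory.
Variables (K : numFieldType) (n : nat) (A : 'M[int]_n).
Hypothesis slA : simply_laced A.
Hypothesis unitA : map_mx intr A \in @unitmx K n.

Local Notation g := (kac_moody K A).
Local Notation e := (@km_e K n A).
Local Notation f := (@km_f K n A).
Local Notation h := (@km_h K n A).
Local Notation "c %:K" := (c%:~R : K) (at level 2, format "c %:K").
Local Notation Q := 'rV[int]_n.

Lemma km_rel s t : chevalley_serre A s t ->
  lp_class (@chevalley_serre K n A) s = lp_class (@chevalley_serre K n A) t.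
Proof. by move=> st; apply/lp_classP/lc_rel. Qed.

Lemma km_triangular : triangular_rels A e f h.
Proof.
split=> i j.
- by rewrite -[LHS](lp_classBr (@chevalley_serre K n A)) (km_rel (cs_hh K A i j)).
- rewrite -[LHS](lp_classBr (@chevalley_serre K n A)); have [<-|neq] := eqVneq i j.
    by rewrite scale1r (km_rel (cs_ef K A i)).
  by rewrite scale0r (km_rel (cs_ef0 K A neq)).
- rewrite -[LHS](lp_classBr (@chevalley_serre K n A)) (km_rel (cs_he K A i j)).
  by rewrite lp_classZ.
- rewrite -[LHS](lp_classBr (@chevalley_serre K n A)) (km_rel (cs_hf K A i j)).
  by rewrite lp_classZ.
Qed.

Lemma lp_class_iter m (x y : lie_expr K (chevalley n)) :
  lp_class (@chevalley_serre K n A) (iter m (LBr x) y) =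
  iter m (lie_br (lp_class _ x)) (lp_class _ y).
Proof. by elim: m => //= m <-; rewrite lp_classBr. Qed.

Lemma km_serre_e i j : i != j -> serre_elt A e i j = 0.
Proof.
move=> neq; rewrite /serre_elt -[LHS](lp_class_iter _ (LGen (ChevE i)) (LGen (ChevE j))).
exact: (km_rel (cs_ee K A neq)).
Qed.

Lemma km_serre_f i j : i != j -> serre_elt A f i j = 0.
Proof.
move=> neq; rewrite /serre_elt -[LHS](lp_class_iter _ (LGen (ChevF i)) (LGen (ChevF j))).
exact: (km_rel (cs_ff K A neq)).
Qed.

Lemma km_ind (S : set g) : lie_subalgebra S ->
    (forall i, S (e i)) -> (forall i, S (f i)) -> (forall i, S (h i)) ->
  forall x, S x.
Proof.
move=> Sa Se Sf Sh; apply: (lie_pres_ind (S := S)) => [|[] i]; first exact: Sa.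
- exact: Se.
- exact: Sf.
- exact: Sh.
Qed.

Lemma chevalley_involution : exists om : {linear g -> g},
  [/\ lie_morphism om, forall i, om (e i) = f i, forall i, om (f i) = e i,
      forall i, om (h i) = - h i & involutive om].
Proof.
have [om [mor ome omf omh]] :=
  km_hom_exists (triangular_swap km_triangular) km_serre_f km_serre_e.
exists om; split=> //; apply: (@km_ind (fun x => om (om x) = x)).
- split=> [|a x y ex ey|x y ex ey]; first by rewrite !raddf0.
    by rewrite !linearP ex ey.
  by rewrite !mor ex ey.
- by move=> i; rewrite ome omf.
- by move=> i; rewrite omf ome.
- by move=> i; rewrite omh raddfN /= omh opprK.
Qed.

(** The boolean selects the triangular half, [true] for the e_i and [false] for the f_i, so that
    each statement covers both. *)
Definition gen (s : bool) (i : 'I_n) : g := if s then e i else f i.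
Definition sg (s : bool) : int := if s then 1 else -1.

Lemma sgN s : sg (~~ s) = - sg s. Proof. by case: s. Qed.

Lemma gen_h s i j : lie_br (h i) (gen s j) = (sg s * A i j)%:K *: gen s j.
Proof.
case: km_triangular => _ _ he hf; case: s; rewrite /gen /sg /= ?mul1r ?mulN1r //.
by rewrite hf intrN.
Qed.

Lemma gen_gen s i j :
  lie_br (gen s i) (gen (~~ s) j) = ((sg s)%:K * (i == j)%:R) *: h i.
Proof.
case: km_triangular => _ ef _ _; case: s; rewrite /gen /sg /= ?mul1r //.
rewrite brC ef eq_sym; have [->|_] := eqVneq i j; last by rewrite mulr0 !scale0r oppr0.
by rewrite mulr1 scale1r intrN scaleN1r.
Qed.

Lemma gen_serre s i j : i != j -> serre_elt A (gen s) i j = 0.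
Proof. by case: s => neq; [apply: km_serre_e|apply: km_serre_f]. Qed.

(** By the Leibniz rule the elements killed by some power form a subalgebra, so generators suffice.
    The Serre relations deal with those of the same sign; h_j takes two steps, and an opposite
    generator becomes a multiple of h_i after one. *)
Lemma gen_ad_nil s i x : ad_nil (gen s i) x.
Proof.
have [Ad As Ao] := slA.
have nils j : ad_nil (gen s i) (gen s j).
  have [<-|neq] := eqVneq i j; first by exists 1%N; rewrite /= lie_brxx.
  by exists `|1 - A i j|%N; apply: gen_serre.
have nilh j : ad_nil (gen s i) (h j).
  by exists 2%N; rewrite /= [lie_br _ (h j)]brC gen_h brNr brZr lie_brxx scaler0 oppr0.
have nilN j : ad_nil (gen s i) (gen (~~ s) j).
  have [m hm] := nilh i; exists m.+1; rewrite iterSr gen_gen.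
  by rewrite -[_ *: _]addr0 iter_brP hm iter_br0 scaler0 addr0.
move: x; apply: km_ind => [|j|j|j] //; first exact: ad_nil_subalgebra.
- by case: s nils nilN {nilh} => [/(_ j)|_ /(_ j)].
- by case: s nils nilN {nilh} => [_ /(_ j)|/(_ j)].
Qed.

Lemma gen_inj s i (p q : nat) x : (q <= p)%N ->
    lie_br (h i) x = ((sg s)%:K * p%:R) *: x ->
  iter q (lie_br (gen (~~ s) i)) x = 0 -> x = 0.
Proof.
move=> le_qp hx fx; have [r ex] := gen_ad_nil s i x.
have [Ad As Ao] := slA.
have ss : (sg s)%:K * (sg s)%:K = 1 by case: s {hx fx ex}; rewrite /= ?mulr1 // mulrNN mulr1.
apply: (@sl2_inj _ _ (gen s i) (gen (~~ s) i) ((sg s)%:K *: h i) _ _ _ p q r x) => //.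
- by rewrite gen_gen eqxx mulr1.
- rewrite brZl gen_h Ad sgN !intrM intrN scalerA mulrA mulrN ss mulN1r.
  by rewrite -[2%:K]/(2%:R).
- by rewrite brZl gen_h Ad intrM scalerA mulrA ss mul1r.
- by rewrite brZl hx scalerA mulrA ss mul1r.
Qed.

Definition simple (i : 'I_n) : Q := delta_mx 0 i.
Definition qform (k l : Q) : int := (k *m A *m l^T) 0 0.
Definition ht (k : Q) : int := \sum_i k 0 i.

Lemma qformDl k k' l : qform (k + k') l = qform k l + qform k' l.
Proof. by rewrite /qform !mulmxDl mxE. Qed.
Lemma qformZl a k l : qform (a *: k) l = a * qform k l.
Proof. by rewrite /qform -!scalemxAl mxE. Qed.
Lemma qformC k l : qform k l = qform l k.
Proof.
have [Ad As Ao] := slA.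
have AT : A^T = A by apply/matrixP => i j; rewrite mxE As.
by rewrite /qform -[LHS](mxE trmx_key (fun i j => _ j i)) -/(trmx _) !trmx_mul trmxK AT mulmxA.
Qed.
Lemma qformDr k k' l : qform l (k + k') = qform l k + qform l k'.
Proof. by rewrite !(qformC l) qformDl. Qed.
Lemma qformZr a k l : qform l (a *: k) = a * qform l k.
Proof. by rewrite !(qformC l) qformZl. Qed.
Lemma qformNr k l : qform l (- k) = - qform l k.
Proof. by rewrite -scaleN1r qformZr mulN1r. Qed.
Lemma qformNl k l : qform (- k) l = - qform k l.
Proof. by rewrite -scaleN1r qformZl mulN1r. Qed.
Lemma qform0r k : qform k 0 = 0.
Proof. by rewrite -(scale0r 0) qformZr mul0r. Qed.

Lemma qform_simple i k : qform (simple i) k = \sum_j A i j * k 0 j.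
Proof.
rewrite /qform /simple -rowE mxE; apply: eq_bigr => j _.
by rewrite !mxE.
Qed.

Lemma qform_simple2 i j : qform (simple i) (simple j) = A i j.
Proof.
rewrite qform_simple (bigD1 j) //= big1 => [|k nkj].
  by rewrite mxE !eqxx mulr1 addr0.
by rewrite mxE (negbTE nkj) andbF mulr0.
Qed.

Lemma row_simple (k : Q) : k = \sum_i k 0 i *: simple i.
Proof. exact: row_sum_delta. Qed.

Lemma qform_expand k l : qform k l = \sum_i k 0 i * qform (simple i) l.
Proof.
rewrite {1}[k]row_simple /qform !mulmx_suml summxE; apply: eq_bigr => i _.
by rewrite -!scalemxAl mxE.
Qed.

Lemma htD k l : ht (k + l) = ht k + ht l.
Proof. by rewrite /ht -big_split; apply: eq_bigr => i _; rewrite mxE. Qed.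
Lemma htZ a k : ht (a *: k) = a * ht k.
Proof. by rewrite /ht big_distrr; apply: eq_bigr => i _; rewrite mxE. Qed.
Lemma ht0 : ht 0 = 0.
Proof. by rewrite -(scale0r 0) htZ mul0r. Qed.
Lemma ht_simple i : ht (simple i) = 1.
Proof.
rewrite /ht (bigD1 i) //= big1 => [|j nji]; rewrite !mxE ?eqxx ?addr0 //.
by rewrite (negbTE nji).
Qed.

(** The determinant enters here: since A is invertible, the eigenvalues of the h_i separate
    weights. *)
Lemma qform_simple_inj k l : (forall i, qform (simple i) k = qform (simple i) l) -> k = l.
Proof.
move=> kl; pose c (k : Q) : 'cV[K]_n := map_mx intr k^T.
have Ac (m : Q) i : (map_mx intr A *m c m) i 0 = (qform (simple i) m)%:K.
  by rewrite -map_mxM mxE qform_simple mxE; congr _%:K; apply: eq_bigr => j _; rewrite mxE.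
have : c k = c l.
  apply: (can_inj (mulKmx unitA)); apply/matrixP => i j.
  by rewrite ord1 !Ac kl.
move=> /matrixP ckl; apply/matrixP => i j; apply/eqP; rewrite ord1 -(eqr_int K).
by have := ckl j 0; rewrite !mxE => ->.
Qed.

End KacMoodyTheory.

(** * Weight decomposition *)

Section Weights.
Variables (K : numFieldType) (n : nat) (A : 'M[int]_n).
Hypothesis slA : simply_laced A.
Hypothesis unitA : map_mx intr A \in @unitmx K n.

Local Notation g := (kac_moody K A).
Local Notation h := (@km_h K n A).
Local Notation gen := (@gen K n A).
Local Notation qform := (@qform n A).
Local Notation simple := (@simple n).
Local Notation "c %:K" := (c%:~R : K) (at level 2, format "c %:K").
Local Notation Q := 'rV[int]_n.
Fixpoint word (s : bool) (w : seq 'I_n) (i : 'I_n) : g :=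
  if w is j :: w then lie_br (gen s j) (word s w i) else gen s i.
Definition word_wt (w : seq 'I_n) (i : 'I_n) : Q := \sum_(j <- rcons w i) simple j.

Lemma word_wt_cons j w i : word_wt (j :: w) i = simple j + word_wt w i.
Proof. by rewrite /word_wt /= big_cons. Qed.
Lemma word_wt_nil i : word_wt [::] i = simple i.
Proof. by rewrite /word_wt big_seq1. Qed.

Lemma ht_word_wt w i : ht (word_wt w i) = (size w).+1%:Z.
Proof.
elim: w => [|j w IH]; first by rewrite word_wt_nil ht_simple.
by rewrite word_wt_cons htD ht_simple IH.
Qed.

Lemma word_wt_ge0 w i j : 0 <= word_wt w i 0 j.
Proof.
rewrite /word_wt summxE; apply: sumr_ge0 => k _.
by rewrite mxE; case: (_ && _).
Qed.

Lemma word_wt_mem w i j : j \in rcons w i -> word_wt w i 0 j != 0.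
Proof.
rewrite /word_wt; elim: (rcons w i) => // k v IH; rewrite inE big_cons !mxE eqxx /=.
have v_ge0 : 0 <= (\sum_(m <- v) simple m) 0 j.
  by rewrite summxE; apply: sumr_ge0 => m _; rewrite mxE; case: (_ && _).
case/orP=> [/eqP<-|/IH nz]; first by rewrite eqxx gt_eqF // ltr_wpDr ?ltr01.
by rewrite gt_eqF // ltr_wpDl ?ler0n // lt_def nz.
Qed.

(** The h_i count under both signs, so that an opposite generator maps words of sign s to
    combinations of sign s even when it reaches the Cartan subalgebra. *)
Definition sign_gen (s : bool) (k : Q) (x : g) : Prop :=
  (k = 0 /\ exists i, x = h i) \/ exists w i, k = sg s *: word_wt w i /\ x = word s w i.
Definition hom_gen (k : Q) (x : g) : Prop := exists s, sign_gen s k x.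
(** A span of explicit words instead of an eigenspace: sign and height of a weight can then be read
    off its words. [Wt_h] and [Wt_eigen] show that for a single weight both descriptions agree. *)
Definition Wt (P : set Q) : set g := lin_span [set x | exists2 k, P k & hom_gen k x].

Lemma Wt_closed P : lin_closed (Wt P). Proof. exact: lin_span_closed. Qed.

Lemma Wt_gen (P : set Q) k x : P k -> hom_gen k x -> Wt P x.
Proof. by move=> Pk kx; apply: lin_span_gen; exists k. Qed.

Lemma Wt_mono (P R : set Q) : P `<=` R -> Wt P `<=` Wt R.
Proof. by move=> PR; apply: lin_span_mono => x [k /PR Rk kx]; exists k. Qed.

Lemma Wt_map (P R : set Q) (F : {linear g -> g}) (F0 : Q -> Q) :
    (forall k, P k -> R (F0 k)) ->
    (forall k x, hom_gen k x -> Wt [set F0 k] (F x)) ->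
  forall x, Wt P x -> Wt R (F x).
Proof.
move=> PR FW; apply: lin_span_sub; first exact/lin_closed_preim/Wt_closed.
move=> x [k Pk kx]; have := FW k x kx; apply: Wt_mono => _ /= ->; exact: PR.
Qed.

Lemma hom_gen_h i k x : hom_gen k x -> lie_br (h i) x = (qform (simple i) k)%:K *: x.
Proof.
have [hh _ _ _] := km_triangular K A.
case=> s [[-> [j ->]]|[w [j [-> ->]]]]; first by rewrite hh qform0r // scale0r.
rewrite qformZr //; elim: w => [|k' w IH] /=.
  by rewrite gen_h word_wt_nil qform_simple2.
rewrite brA gen_h brZl IH brZr -scalerDl -intrD word_wt_cons qformDr //.
by rewrite qform_simple2 mulrDr.
Qed.

Lemma Wt_h i k x : Wt [set k] x -> lie_br (h i) x = (qform (simple i) k)%:K *: x.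
Proof.
elim=> [|a {}x y [_ -> kx] _ IH]; first by rewrite br0r scaler0.
by rewrite lie_linearr IH (hom_gen_h i kx); lmod.
Qed.

(** By the Jacobi identity the opposite generator moves inwards. At each letter it leaves a multiple
    of some h, which acts on the remaining word by a scalar. *)
Lemma gen_word s j w i : lin_span (sign_gen s (sg s *: word_wt w i - sg s *: simple j))
  (lie_br (gen (~~ s) j) (word s w i)).
Proof.
elim: w => [|j' w IH] /=.
  rewrite -[s in gen s i]negbK gen_gen; have [->|nji] := eqVneq j i.
    apply: lin_closedZ; first exact: lin_span_closed.
    by rewrite word_wt_nil subrr; apply: lin_span_gen; left; split => //; exists i.
  by rewrite mulr0 scale0r; apply: lin_span0.
rewrite brA; apply: lin_closedD; first exact: lin_span_closed.
  rewrite -[s in gen s j']negbK gen_gen; have [->|njj'] := eqVneq j j'; last first.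
    by rewrite mulr0 scale0r br0l; apply: lin_span0.
  rewrite brZl (@hom_gen_h _ (sg s *: word_wt w i)); last by exists s; right; exists w, i.
  do 2![apply: lin_closedZ; first exact: lin_span_closed].
  apply: lin_span_gen; right; exists w, i; split => //.
  by rewrite word_wt_cons scalerDr addrAC subrr add0r.
move: IH; set k := _ - _ => IH; rewrite word_wt_cons scalerDr -addrA -/k.
suff: lin_span (sign_gen s k) `<=`
    lie_br (gen s j') @^-1` lin_span (sign_gen s (sg s *: simple j' + k)) by apply.
apply: lin_span_sub; first exact/lin_closed_preim/lin_span_closed.
move=> x [[k0 [m ->]]|[w' [i' [k0 ->]]]]; rewrite /preimage /mkset k0.
  rewrite brC gen_h -scaleNr; apply: lin_closedZ; first exact: lin_span_closed.
  by apply: lin_span_gen; right; exists [::], j'; rewrite word_wt_nil addr0.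
by apply: lin_span_gen; right; exists (j' :: w'), i'; rewrite word_wt_cons scalerDr.
Qed.

Lemma gen_hom s j k x : hom_gen k x -> Wt [set k + sg s *: simple j] (lie_br (gen s j) x).
Proof.
case=> s' [[-> [i ->]]|[w [i [-> ->]]]].
  rewrite brC gen_h -scaleNr; apply: lin_closedZ; first exact: Wt_closed.
  apply: (Wt_gen (k := sg s *: simple j)); first by rewrite add0r.
  by exists s; right; exists [::], j; rewrite word_wt_nil.
have [->|ss'] := eqVneq s s'.
  apply: (Wt_gen (k := sg s' *: word_wt (j :: w) i)).
    by rewrite word_wt_cons scalerDr addrC.
  by exists s'; right; exists (j :: w), i.
have -> : s = ~~ s' by case: s s' ss' => -[].
rewrite sgN scaleNr; have := gen_word s' j w i.
by apply: lin_span_mono => y ky; exists (sg s' *: word_wt w i - sg s' *: simple j) => //; exists s'.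
Qed.

Lemma Wt_gen_br (P R : set Q) s j x : (forall k, P k -> R (k + sg s *: simple j)) ->
  Wt P x -> Wt R (lie_br (gen s j) x).
Proof.
move=> PR; apply: (Wt_map (F := lie_br (gen s j)) PR) => k y; exact: gen_hom.
Qed.

Lemma Wt_br k l x y : Wt [set k] x -> Wt [set l] y -> Wt [set k + l] (lie_br x y).
Proof.
move=> + ly; have cW := Wt_closed [set k + l].
suff: Wt [set k] `<=` [set x | Wt [set k + l] (lie_br x y)] by apply.
apply: lin_span_sub; first exact: lin_closed_prel.
move=> {}x [_ -> [s [[-> [j ->]]|[w [j [-> ->]]]]]] /= {cW}.
  rewrite (Wt_h j ly) add0r; apply: lin_closedZ => //; exact: Wt_closed.
elim: w l y ly => [|j' w IH] l y ly /=.
  by apply: Wt_gen_br ly => _ -> /=; rewrite word_wt_nil addrC.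
rewrite brAl; apply: lin_closedB; first exact: Wt_closed.
  apply: Wt_gen_br (IH _ _ ly) => _ -> /=.
  by rewrite word_wt_cons scalerDr addrC addrA.
have : Wt [set l + sg s *: simple j'] (lie_br (gen s j') y).
  by apply: Wt_gen_br ly => _ ->.
move/IH; apply: Wt_mono => _ -> /=.
by rewrite word_wt_cons; lmod.
Qed.

(** The spanning half of the triangular decomposition: by [Wt_br] the span of the h_i and of the
    words of one sign is a subalgebra, and it contains the generators. *)
Lemma Wt_setT x : Wt setT x.
Proof.
have cT := Wt_closed setT.
move: x; apply: km_ind => [|i|i|i].
- split=> [|a x y|x y]; [exact: lin_span0|by case: cT => _; apply|].
  move=> Wx Wy; suff: Wt setT `<=` [set x | Wt setT (lie_br x y)] by apply.
  apply: lin_span_sub; first exact: lin_closed_prel.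
  move=> {Wx}x [k _ kx]; suff: Wt setT `<=` lie_br x @^-1` Wt setT by apply.
  apply: lin_span_sub; first exact/lin_closed_preim/Wt_closed.
  move=> {Wy}y [l _ ly]; apply: (@Wt_mono [set k + l]) => //.
  by apply: Wt_br; [apply: Wt_gen kx|apply: Wt_gen ly].
- by apply: (Wt_gen (k := simple i)) => //; exists true; right; exists [::], i;
    rewrite word_wt_nil scale1r.
- by apply: (Wt_gen (k := - simple i)) => //; exists false; right; exists [::], i;
    rewrite word_wt_nil scaleN1r.
- by apply: (Wt_gen (k := 0)) => //; exists true; left; split=> //; exists i.
Qed.

Definition h_stable (S : set g) : Prop := forall i x, S x -> S (lie_br (h i) x).

Lemma weight_components (S : set g) (l : seq Q) (y : Q -> g) :
    lin_closed S -> h_stable S -> uniq l -> (forall k, Wt [set k] (y k)) ->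
  S (\sum_(k <- l) y k) -> forall k, k \in l -> S (y k).
Proof.
move=> cS hS; elim: l y => // k0 l IH y /andP[k0l ul] Wy; rewrite big_cons => Sy.
have Sl k : k \in l -> S (y k).
  (* Some h_i separates k from k0. Subtracting its eigenvalue at k0 kills the component [y k0] and
     rescales the others, at k by a nonzero factor, so the induction hypothesis applies to the
     shorter list. *)
  move=> kl; pose ev i (k : Q) := (qform (simple i) k)%:K.
  have [i di] : exists i, qform (simple i) k != qform (simple i) k0.
    apply/existsP; apply: contraNT k0l => /existsPn eqk.
    suff -> : k0 = k by []; apply: (qform_simple_inj unitA) => i.
    by have /negPn/eqP := eqk i.
  have d0 : ev i k - ev i k0 != 0 by rewrite subr_eq0 eqr_int.
  suff Sd : S ((ev i k - ev i k0) *: y k).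
    by have := lin_closedZ (ev i k - ev i k0)^-1 cS Sd; rewrite scalerA mulVf // scale1r.
  apply: (IH (fun k => (ev i k - ev i k0) *: y k)) kl => // [m|].
    by apply: lin_closedZ => //; exact: Wt_closed.
  have -> : \sum_(k <- l) (ev i k - ev i k0) *: y k =
      lie_br (h i) (y k0 + \sum_(k <- l) y k) - ev i k0 *: (y k0 + \sum_(k <- l) y k).
    rewrite brDr br_sumr (Wt_h i (Wy k0)) scalerDr scaler_sumr opprD addrACA subrr add0r.
    rewrite -sumrB; apply: eq_bigr => m _.
    by rewrite (Wt_h i (Wy m)) scalerBl.
  by apply: lin_closedB => //; [apply: hS|apply: lin_closedZ].
move=> k; rewrite inE => /orP[/eqP->|]; last exact: Sl.
have -> : y k0 = (y k0 + \sum_(k <- l) y k) - \sum_(k <- l) y k by rewrite addrK.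
apply: lin_closedB => //; rewrite big_seq.
by apply: lin_closed_sum => // m; apply: Sl.
Qed.

Lemma Wt_decompose (P : set Q) x : Wt P x -> exists (l : seq Q) (y : Q -> g),
  [/\ uniq l, forall k, k \in l -> P k, forall k, Wt [set k] (y k)
    & x = \sum_(k <- l) y k].
Proof.
elim=> [|a {}x z [k Pk kx] _ [l [y [ul lP yW ->]]]].
  exists [::], (fun=> 0); split=> //; first by move=> k; apply: lin_span0.
  by rewrite big_nil.
pose y' m := (if m == k then a *: x else 0) + (if m \in l then y m else 0).
exists (undup (k :: l)), y'; split.
- exact: undup_uniq.
- by move=> m; rewrite mem_undup inE => /orP[/eqP->|/lP].
- move=> m; apply: lin_closedD; first exact: Wt_closed.
    case: eqP => [->|_]; last exact: lin_span0.
    apply: lin_closedZ; first exact: Wt_closed.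
    exact: (Wt_gen (k := k)).
  by case: ifP => // _; apply: lin_span0.
have uu : uniq (undup (k :: l)) by exact: undup_uniq.
have um m : (m \in undup (k :: l)) = (m == k) || (m \in l) by rewrite mem_undup inE.
move: (undup _) uu um => u uu um; rewrite /y' big_split /=; congr (_ + _).
  rewrite -big_mkcond -big_filter.
  suff -> : [seq i <- u | i == k] = [:: k] by rewrite big_seq1.
  apply: perm_small_eq => //; apply: uniq_perm => [||m] //; first by rewrite filter_uniq.
  by rewrite mem_filter um inE; case: eqP.
rewrite -big_mkcond -[RHS]big_filter; apply: perm_big; apply: uniq_perm => [||m] //.
  by rewrite filter_uniq.
by rewrite mem_filter um; case: (m \in l); rewrite ?orbT.
Qed.

Lemma Wt_split (P S : set _) x : lin_closed S -> h_stable S -> Wt P x -> S x ->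
  lin_span [set y | exists2 k, P k & Wt [set k] y /\ S y] x.
Proof.
move=> cS hS /Wt_decompose[l [y [ul lP yW ->]]] Sx.
rewrite big_seq; apply: lin_closed_sum => [|k kl]; first exact: lin_span_closed.
apply: lin_span_gen; exists k; first exact: lP.
by split=> //; apply: weight_components Sx _ kl.
Qed.

(** The eigenvectors with the given eigenvalues form an h-stable subspace, so the weight components
    of x are such eigenvectors too; a nonzero component then has weight k. *)
Lemma Wt_eigen k x : (forall i, lie_br (h i) x = (qform (simple i) k)%:K *: x) ->
  Wt [set k] x.
Proof.
pose S : set g := [set x | forall i, lie_br (h i) x = (qform (simple i) k)%:K *: x].
have [hh _ _ _] := km_triangular K A.
have cS : lin_closed S.
  split=> [i|a y z Sy Sz i]; first by rewrite br0r scaler0.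
  by rewrite lie_linearr Sy Sz; lmod.
have hS : h_stable S.
  by move=> i y Sy; rewrite Sy; exact: (lin_closedZ _ cS Sy).
move=> Sx; have := Wt_split cS hS (Wt_setT x) Sx.
suff sub : [set y | exists2 k', setT k' & Wt [set k'] y /\ S y] `<=` Wt [set k].
  exact: (lin_span_sub (Wt_closed _) sub).
move=> y [k' _ [Wy Sy]]; have [<- //|nk] := eqVneq k' k.
have [->|ny] := eqVneq y 0; first exact: lin_span0.
case/eqP: nk; apply: (qform_simple_inj unitA) => i; apply/eqP.
rewrite -(eqr_int K) -subr_eq0; apply/eqP; have := Sy i; rewrite (Wt_h i Wy) => /eqP.
by rewrite -subr_eq0 -scalerBl scaler_eq0 (negbTE ny) orbF => /eqP.
Qed.

Lemma Wt_ind1 k x : Wt [set k] x -> lin_span (hom_gen k) x.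
Proof. by apply: lin_span_mono => y [_ ->]. Qed.

Lemma Wt_eq0 k x : (forall y, hom_gen k y -> y = 0) -> Wt [set k] x -> x = 0.
Proof.
move=> k0 /Wt_ind1; apply: (lin_span_sub (set0_closed _)) => y /k0; exact.
Qed.

Lemma Wt_mixed (k : Q) x i j : 0 < k 0 i -> k 0 j < 0 -> Wt [set k] x -> x = 0.
Proof.
move=> ki kj Wx; apply: (Wt_eq0 _ Wx) => y [s [[k0 _]|[w [m [k0 _]]]]].
  by move: ki; rewrite k0 mxE.
move: ki kj; rewrite k0 !mxE; have := word_wt_ge0 w m i; have := word_wt_ge0 w m j.
by case: s {k0} => /=; rewrite ?mul1r ?mulN1r; lia.
Qed.

Lemma simple_inj : injective simple.
Proof.
by move=> i j /matrixP/(_ 0 j); rewrite !mxE !eqxx /=; case: (eqVneq j i).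
Qed.

Lemma Wt_simple s i x : Wt [set sg s *: simple i] x -> exists c, x = c *: gen s i.
Proof.
move/Wt_ind1; suff sub : hom_gen (sg s *: simple i) `<=` [set x | exists c, x = c *: gen s i].
  apply: (lin_span_sub _ sub); split=> [|a y z [c ->] [d ->]]; first by exists 0; rewrite scale0r.
  by exists (a * c + d); lmod.
move=> y [s' [[k0 _]|[w [m [k0 ->]]]]].
  have := congr1 (@ht n) k0; rewrite htZ ht_simple ht0.
  by case: s {k0}; rewrite /= ?mul1r ?mulN1r; lia.
have := congr1 (@ht n) k0; rewrite !htZ ht_word_wt ht_simple => hk.
have es : s' = s by case: s s' {k0} hk => [] [] //=; rewrite ?mul1r ?mulN1r; lia.
have w0 : w = [::].
  apply/size0nil; move: hk; rewrite es.
  by case: s {k0 es}; rewrite /= ?mul1r ?mulN1r; lia.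
rewrite es w0 /=; have -> : m = i; last by exists 1; rewrite scale1r.
move: k0; rewrite es w0 word_wt_nil => /(congr1 (fun k => sg s *: k)).
rewrite !scalerA; have -> : sg s * sg s = 1 by case: (s).
by rewrite !scale1r => /simple_inj.
Qed.

(** A word of this weight has i as its only letter and at least two letters, so its innermost
    bracket is that of a generator with itself. *)
Lemma Wt_multiple s i (c : int) x : 1 < c -> Wt [set (sg s * c) *: simple i] x -> x = 0.
Proof.
move=> c1 Wx; apply: (Wt_eq0 _ Wx) => {Wx} y [s' [[k0 _]|[w [m [k0 ->]]]]].
  have := congr1 (@ht n) k0; rewrite htZ ht_simple ht0.
  by case: s {k0}; rewrite /= ?mul1r ?mulN1r; lia.
have := congr1 (@ht n) k0; rewrite !htZ ht_word_wt ht_simple mulr1.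
have allw j : j \in rcons w m -> j = i.
  move=> /word_wt_mem nz; apply/eqP; apply: contraNT nz => nji.
  have := congr1 (fun k : Q => k 0 j) k0; rewrite !mxE (negbTE nji) mulr0 => /esym/eqP.
  by rewrite mulf_eq0 => /orP[|//]; case: s' {k0}.
have -> : m = i by apply: allw; rewrite mem_rcons inE eqxx.
case: w allw {k0} => [|j w] allw; first by case: s s' => -[]; rewrite /= ?mul1r ?mulN1r; lia.
move=> _; have {allw} wi : all (pred1 i) (j :: w).
  by apply/allP => k kw; apply/eqP/allw; rewrite mem_rcons inE kw orbT.
elim: w j wi => [|j' w IH] j /andP[/eqP -> wi] /=; first by rewrite lie_brxx.
by have /= -> := IH _ wi; rewrite br0r.
Qed.

End Weights.

(** * Reflections and multiplicities *)

Section Multiplicity.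
Variables (K : numFieldType) (n : nat) (A : 'M[int]_n).
Hypothesis slA : simply_laced A.
Hypothesis unitA : map_mx intr A \in @unitmx K n.

Local Notation g := (kac_moody K A).
Local Notation gen := (@gen K n A).
Local Notation qform := (@qform n A).
Local Notation simple := (@simple n).
Local Notation "c %:K" := (c%:~R : K) (at level 2, format "c %:K").
Local Notation Q := 'rV[int]_n.
Local Notation Wt := (@Wt K n A).
Local Notation word := (@word K n A).
Local Notation hom_gen := (@hom_gen K n A).
Lemma iter_linear m (d : g) :
  exists phi : {linear g -> g}, forall x, phi x = iter m (lie_br d) x.
Proof.
elim: m => [|m [phi Hphi]]; first by exists idfun.
by exists (lie_br d \o phi) => x /=; rewrite Hphi.
Qed.

Lemma Wt_iter (k : Q) s i m x : Wt [set k] x ->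
  Wt [set k + (sg s * m%:Z) *: simple i] (iter m (lie_br (gen s i)) x).
Proof.
move=> kx; elim: m => [|m IH] /=; first by rewrite mulr0 scale0r addr0.
apply: (Wt_gen_br slA _ IH) => _ -> /=.
by rewrite -addrA -scalerDl intS mulrDr mulr1 [sg s + _]addrC.
Qed.

Definition wreflect (i : 'I_n) (k : Q) : Q := k - qform (simple i) k *: simple i.

Lemma reflect_norm i k : qform (wreflect i k) (wreflect i k) = qform k k.
Proof.
have [Ad _ _] := slA.
rewrite /wreflect -!scaleNr !(qformDl, qformDr, qformZl, qformZr) //.
rewrite qform_simple2 // Ad (qformC slA k (simple i)); ring.
Qed.

(** Put c = (alpha_i | k) and apply |c| times the generator that moves k towards its mirror image;
    [gen_inj] with p = q = |c| shows that nothing is lost. An injection in this one direction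
    suffices for the descent and replaces the exponentials that lift the Weyl group. *)
Lemma reflect_injection i (k : Q) : exists phi : {linear g -> g}, forall x, Wt [set k] x ->
  Wt [set wreflect i k] (phi x) /\ (phi x = 0 -> x = 0).
Proof.
set c := qform (simple i) k; pose s := 0 <= c.
have [phi phiE] := iter_linear `|c| (gen (~~ s) i).
exists phi => x kx; rewrite phiE; split.
  have := Wt_iter (~~ s) i `|c| kx; rewrite /wreflect -/c -scaleNr.
  suff -> : sg (~~ s) * `|c|%N%:Z = - c by [].
  by rewrite sgN /s; case: (ltP c 0); rewrite /sg; lia.
apply: (gen_inj slA (p := `|c|)) => //; rewrite (Wt_h slA i kx) -/c.
have -> : (`|c|%N%:R : K) = (`|c|%N%:Z)%:~R by [].
rewrite -intrM; congr (_%:K *: _).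
by rewrite /s; case: (ltP c 0); rewrite /sg; lia.
Qed.

Definition mult_le1 (k : Q) : Prop :=
  forall x y, Wt [set k] x -> Wt [set k] y -> x != 0 -> exists c, y = c *: x.

Lemma mult_le1_reflect i (k : Q) : mult_le1 (wreflect i k) -> mult_le1 k.
Proof.
have [phi phiP] := reflect_injection i k.
move=> H x y kx ky x0; have [kpx ix] := phiP x kx; have [kpy iy] := phiP y ky.
have px0 : phi x != 0 by apply: contra x0 => /eqP/ix ->.
have [c pc] := H _ _ kpx kpy px0; exists c; apply/eqP; rewrite -subr_eq0; apply/eqP.
have kz : Wt [set k] (y - c *: x).
  by rewrite -scaleNr addrC; case: (Wt_closed K A [set k]) => _; apply.
by apply: (phiP _ kz).2; rewrite raddfB /= linearZ /= pc subrr.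
Qed.

Lemma Wt_eq0_reflect i (k : Q) : (forall x, Wt [set wreflect i k] x -> x = 0) ->
  forall x, Wt [set k] x -> x = 0.
Proof.
have [phi phiP] := reflect_injection i k.
by move=> H x kx; have [kpx ix] := phiP x kx; apply/ix/H.
Qed.

Lemma mult_le1_eq0 (k : Q) : (forall x, Wt [set k] x -> x = 0) -> mult_le1 k.
Proof. by move=> k0 x y /k0 -> _ /eqP. Qed.

Lemma reflect_coord i j (k : Q) : j != i -> wreflect i k 0 j = k 0 j.
Proof. by move=> ji; rewrite !mxE (negbTE ji) mulr0 subr0. Qed.

Lemma ht_reflect i (k : Q) : ht (wreflect i k) = ht k - qform (simple i) k.
Proof. by rewrite /wreflect -scaleNr htD htZ ht_simple mulr1. Qed.

(** Induction on |ht k|. A descent that does not reach a zero space ends at plus or minus a simple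
    root, which has norm 2 and multiplicity one; reflections carry both conclusions back to k. *)
Lemma mult_norm_ge2 (k : Q) : 2 <= qform k k ->
  mult_le1 k /\ (2 < qform k k -> forall x, Wt [set k] x -> x = 0).
Proof.
have [Ad _ _] := slA.
have [N] := ubnP `|ht k|%N; elim: N k => // N IH k ltN k2.
have done0 : (forall x, Wt [set k] x -> x = 0) ->
    mult_le1 k /\ (2 < qform k k -> forall x, Wt [set k] x -> x = 0).
  by move=> k0; split=> //; apply: mult_le1_eq0.
have mixed0 (l : Q) i j s : 0 < sg s * l 0 i -> sg s * l 0 j < 0 ->
    forall x, Wt [set l] x -> x = 0.
  case: s; rewrite /sg ?mul1r ?mulN1r ?oppr_gt0 ?oppr_lt0 => li lj x.
    exact: (Wt_mixed unitA) li lj.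
  exact: (Wt_mixed unitA) lj li.
(* The norm is the sum of these products, so one of them is positive; the reflection in this i moves
   the coefficient k_i towards zero or past it. *)
have [i ki] : exists i, 0 < k 0 i * qform (simple i) k.
  apply/existsP; apply: contraTT k2 => /existsPn ki.
  rewrite -ltNge (le_lt_trans (y := 0)) // qform_expand; apply: sumr_le0 => i _.
  by rewrite leNgt.
pose s := 0 < k 0 i.
have si : 0 < sg s * k 0 i.
  rewrite /s; case: (ltP 0 (k 0 i)); rewrite /sg; first by rewrite mul1r.
  rewrite le_eqVlt => /orP[/eqP k0|]; first by rewrite k0 mul0r ltxx in ki.
  by rewrite mulN1r oppr_gt0.
have [/existsP[j /mixed0 kj]|/existsPn same] :=
  boolP [exists j, sg s * k 0 j < 0]; first exact/done0/(kj i).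
have [/existsP[j /andP[ji kj]]|/existsPn only_i] :=
    boolP [exists j, (j != i) && (k 0 j != 0)]; last first.
  have kE : k = (sg s * `|(k 0 i)%R|%N) *: simple i.
    rewrite {1}[k]row_simple (bigD1 i) //= big1 => [|j ji].
      rewrite addr0; congr (_ *: _).
      by move: si; rewrite /s; case: (ltP 0 (k 0 i)); rewrite /sg; lia.
    by have := only_i j; rewrite ji /= negbK => /eqP ->; rewrite scale0r.
  have [c1|c1] := ltnP 1 `|(k 0 i)%R|.
    by apply: done0 => x; rewrite kE => /(Wt_multiple unitA); apply.
  have {c1}c1 : `|(k 0 i)%R|%N = 1%N by move: si c1; case: (s); rewrite /sg; lia.
  rewrite kE c1 mulr1; split=> [x y /(Wt_simple unitA)[a ->] /(Wt_simple unitA)[b ->] x0|].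
    have a0 : a != 0 by apply: contra x0 => /eqP ->; rewrite scale0r.
    by exists (b / a); rewrite scalerA divfK.
  by rewrite qformZl qformZr // qform_simple2 // Ad; case: (s).
have skj : 0 < sg s * k 0 j.
  by have := same j; rewrite -leNgt lt_def mulf_neq0 // /sg; case: (s).
(* If the coefficient at i passes zero, the unchanged one at j still has the old sign, and a weight
   with both signs has a zero space. Otherwise the absolute height drops. *)
have [neg|pos] := ltP (sg s * wreflect i k 0 i) 0.
  apply/done0/(@Wt_eq0_reflect i)/(mixed0 _ j i s) => //.
  by rewrite reflect_coord.
suff lt_ht : (`|ht (wreflect i k)| < N)%N.
  have [|m m0] := IH _ lt_ht; first by rewrite reflect_norm.
  rewrite reflect_norm in m0; split; first exact: mult_le1_reflect m.
  by move=> /m0 kr; apply: Wt_eq0_reflect kr.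
have pos_ht : 0 <= sg s * ht (wreflect i k).
  rewrite /ht mulr_sumr; apply: sumr_ge0 => m _.
  have [-> //|mi] := eqVneq m i; rewrite reflect_coord //.
  by have := same m; rewrite -leNgt.
rewrite -ltnS; apply: leq_trans ltN; rewrite ltnS.
move: pos_ht; rewrite ht_reflect; move: si ki.
rewrite /s; case: (ltP 0 (k 0 i)); rewrite /sg => ki0 _ ki.
- by move: ki; rewrite pmulr_rgt0 //; lia.
- have kin : k 0 i < 0.
    by rewrite lt_neqAle ki0 andbT; apply: contraTneq ki => ->; rewrite mul0r ltxx.
  by move: ki; rewrite nmulr_rgt0 //; lia.
Qed.

End Multiplicity.

(** * The invariant form *)

Section HeightsAndFunctionals.
Variables (K : numFieldType) (n : nat) (A : 'M[int]_n).
Hypothesis slA : simply_laced A.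
Hypothesis unitA : map_mx intr A \in @unitmx K n.

Local Notation g := (kac_moody K A).
Local Notation e := (@km_e K n A).
Local Notation f := (@km_f K n A).
Local Notation h := (@km_h K n A).
Local Notation gen := (@gen K n A).
Local Notation qform := (@qform n A).
Local Notation simple := (@simple n).
Local Notation "c %:K" := (c%:~R : K) (at level 2, format "c %:K").
Local Notation Wt := (@Wt K n A).
Local Notation word := (@word K n A).
Local Notation hom_gen := (@hom_gen K n A).
Section Representation.
Variables (P : lmodType K) (pf ph : 'I_n -> gl P).
Hypothesis phh : forall i j, lie_br (ph i) (ph j) = 0.
Hypothesis phf : forall i j, lie_br (ph i) (pf j) = - (A i j)%:K *: pf j.
Hypothesis pserre : forall i j, i != j -> serre_elt A pf i j = 0.
Variables (p0 : P) (lam : 'I_n -> K).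
Hypothesis php0 : forall i, ph i p0 = lam i *: p0.

(** [ev] is evaluation at the empty word. It intertwines the f_i with their action on P, so that
    elements of P can be recovered from the module. *)
Lemma coinduced_module : exists (V : lmodType K) (act : g -> gl V) (N : set V)
    (v0 : V) (ev : {linear V -> P}),
  [/\ lin_closed N, N v0, forall x v, N v -> N (act x v),
      forall a x y v, N v -> act (a *: x + y) v = a *: act x v + act y v
    & forall x y v, N v -> act (lie_br x y) v = act x (act y v) - act y (act x v)] /\
  [/\ forall i, act (e i) v0 = 0, forall i, act (h i) v0 = lam i *: v0,
      ev v0 = p0 & forall i v, N v -> ev (act (f i) v) = pf i (ev v)].
Proof.
pose u := coind_gen A pf ph; pose N := coind_N A pf ph p0.
have rels := coind_rels phh phf.
have cN : lin_closed N := coind_N_closed A pf ph p0.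
have uN x v : N v -> N (u x v) := @coind_gen_N _ _ _ _ _ _ phh phf _ _ php0 x v.
have urel s t : chevalley_serre A s t ->
    forall v, N v -> lie_eval u s v = lie_eval u t v.
  have eqgl (a b : gl (seq 'I_n -> P)) : a = b -> forall v, N v -> a v = b v by move=> ->.
  have [hh ef he hf] := rels.
  case=> {s t} [i j|i|i j /negbTE nij|i j|i j|i j nij|i j nij].
  - exact/eqgl/hh.
  - by apply: eqgl; rewrite /= ef eqxx scale1r.
  - by apply: eqgl; rewrite /= ef nij scale0r.
  - exact/eqgl/he.
  - exact/eqgl/hf.
  - move=> v Nv; rewrite (lie_eval_iter u); exact: (coind_serre_e slA phh phf nij Nv).
  - apply: eqgl; rewrite (lie_eval_iter u); exact: (coind_serre_f slA phh phf pserre nij).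
pose ev0 (v : seq 'I_n -> P) : P := v [::].
have evl : linear ev0 by [].
pose c := GRing.isLinear.Build K _ P *:%R ev0 evl.
pose ev : {linear (seq 'I_n -> P) -> P} := HB.pack ev0 c.
pose w0 : seq 'I_n -> P := coind_v p0.
have N0 : N w0 := coind_N_v A pf ph p0.
have actE s v : N v -> lie_act u (lp_class (@chevalley_serre K n A) s) v = lie_eval u s v.
  exact: (lie_actE cN uN urel).
exists (seq 'I_n -> P), (lie_act u), N, w0, ev; do 2!split; do ?by [].
- by move=> x v Nv; apply: (lie_act_stable cN uN).
- by move=> a x y v Nv; apply: (lie_actP cN uN urel).
- by move=> x y v Nv; apply: (lie_act_br cN uN urel).
- by move=> i; rewrite (actE (LGen (ChevE i))) //; exact: coind_e_v.
- by move=> i; rewrite (actE (LGen (ChevH i))) //; exact: (coind_h_v A php0).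
- by move=> i v Nv; rewrite (actE (LGen (ChevF i))).
Qed.
End Representation.

(** In the module coinduced from a line, with f_i acting by 0 and h_i by [lam i], x is sent to the
    value of x v0 at the empty word. These functionals prove the h_i independent. *)
Lemma cartan_functional (lam : 'I_n -> K) :
  exists rho : {linear g -> K^o}, forall i, rho (h i) = lam i.
Proof.
pose pf (i : 'I_n) : gl K^o := 0.
have phl i : linear (fun p : K^o => (lam i *: p : K^o)).
  by move=> a x y; lmod.
pose ph i : gl K^o := Gl (phl i).
have phh i j : lie_br (ph i) (ph j) = 0.
  by apply: gl_ext => v; rewrite gl_brE /=; lmod.
have phf i j : lie_br (ph i) (pf j) = - (A i j)%:K *: pf j.
  by rewrite /pf br0r scaler0.
have pserre i j : i != j -> serre_elt A pf i j = 0.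
  by move=> neq; have [[_ ->]|[_ ->]] := serre_eltE slA pf neq; rewrite br0l.
have php i : ph i (1 : K^o) = lam i *: (1 : K^o) by [].
have [V [act [N [v0 [ev [[cN N0 actN actP actBr] [e0 h0 ev0 fv]]]]]]] :=
  coinduced_module phh phf pserre php.
pose r0 (x : g) : K^o := ev (act x v0).
have rl : linear r0 by move=> a x y; rewrite /r0 actP // linearP.
pose c := GRing.isLinear.Build K g K^o *:%R r0 rl.
pose rho : {linear g -> K^o} := HB.pack r0 c.
by exists rho => i; rewrite /= /r0 h0 linearZ ev0 /= [_ *: _]mulr1.
Qed.

Definition rho (lam : 'I_n -> K) : {linear g -> K^o} := sval (cid (cartan_functional lam)).

Lemma rho_h lam i : rho lam (h i) = lam i.
Proof. by rewrite /rho; case: cid. Qed.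

Lemma km_h_free (c : 'I_n -> K) : \sum_i c i *: h i = 0 -> forall i, c i = 0.
Proof.
move=> c0 i; have := congr1 (rho (fun j => (j == i)%:R)) c0.
rewrite raddf0 raddf_sum (bigD1 i) //= big1 => [|j ji].
  by rewrite linearZ /= rho_h eqxx addr0 => <-; rewrite [RHS]mulr1.
by rewrite linearZ /= rho_h (negbTE ji) scaler0.
Qed.

(* rhov is the element of the Cartan subalgebra on which every simple root
   takes the value 1, so that its eigenvalues are the heights. *)
Lemma rhov_exists : exists c : 'I_n -> K, forall j, \sum_i c i * (A i j)%:K = 1.
Proof.
have := mulmxKV unitA (const_mx 1 : 'rV[K]_n); move: (_ *m invmx _) => c cA.
exists (fun i => c 0 i) => j; transitivity ((c *m map_mx intr A) 0 j); last by rewrite cA mxE.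
by rewrite mxE; apply: eq_bigr => i _; rewrite mxE.
Qed.

Definition rhov : g := \sum_i sval (cid rhov_exists) i *: h i.

Lemma rhov_hom k x : hom_gen k x -> lie_br rhov x = (ht k)%:K *: x.
Proof.
move=> kx; rewrite /rhov; case: cid => c /= cA; rewrite br_suml.
under eq_bigr => i _ do rewrite brZl (hom_gen_h slA i kx) scalerA.
rewrite -scaler_suml; congr (_ *: x); rewrite /ht rmorph_sum /=.
under eq_bigr => i _ do rewrite qform_simple rmorph_sum /= mulr_sumr.
rewrite exchange_big /=; apply: eq_bigr => j _.
under eq_bigr => i _ do rewrite intrM mulrA.
by rewrite -mulr_suml cA mul1r.
Qed.

Definition Ht (m : int) : set g := Wt [set k | ht k = m].

Lemma Ht_closed m : lin_closed (Ht m). Proof. exact: Wt_closed. Qed.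

Lemma rhov_Ht m x : Ht m x -> lie_br rhov x = m%:K *: x.
Proof.
elim=> [|a {}x y [k <- kx] _ IH]; first by rewrite br0r scaler0.
by rewrite lie_linearr IH (rhov_hom kx); lmod.
Qed.

Lemma Ht_gen m s i x : Ht m x -> Ht (m + sg s) (lie_br (gen s i) x).
Proof.
by apply: Wt_gen_br => // k <- /=; rewrite htD htZ ht_simple mulr1.
Qed.

Lemma Ht_br m m' x y : Ht m x -> Ht m' y -> Ht (m + m') (lie_br x y).
Proof.
move=> mx my; have cH := Ht_closed (m + m').
suff: Ht m `<=` [set x | Ht (m + m') (lie_br x y)] by apply.
apply: lin_span_sub; first exact: lin_closed_prel.
move=> {mx}x [k <- kx] /=.
suff: Ht m' `<=` lie_br x @^-1` Ht (ht k + m') by apply.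
apply: lin_span_sub; first exact/lin_closed_preim/Ht_closed.
move=> {my}y [l <- ly]; apply: (@Wt_mono _ _ _ [set k + l]) => [_ -> /=|].
  by rewrite htD.
by apply: (Wt_br slA); [apply: Wt_gen kx|apply: Wt_gen ly].
Qed.

Lemma Ht_h m i x : Ht m x -> Ht m (lie_br (h i) x).
Proof.
move=> mx; rewrite -[m]add0r; apply: Ht_br mx.
apply: (Wt_gen (k := 0)); first exact: ht0.
by exists true; left; split=> //; exists i.
Qed.

Lemma hom_gen_ht k x : hom_gen k x ->
  ht k = 0 /\ (exists i, x = h i) \/
  exists s w i, ht k = sg s * (size w).+1%:Z /\ x = word s w i.
Proof.
case=> s [[-> xh]|[w [i [-> ->]]]]; first by left; rewrite ht0.
by right; exists s, w, i; rewrite htZ ht_word_wt.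
Qed.

Lemma Ht0 x : Ht 0 x -> lin_span (range h) x.
Proof.
apply: lin_span_mono => y [k k0 /hom_gen_ht[[_ [i ->]]|[s [w [i [hk _]]]]]].
  by exists i.
by move: k0; rewrite /= hk; case: s {hk}; rewrite /= ?mul1r ?mulN1r; lia.
Qed.

Lemma Ht_h0 i : Ht 0 (h i).
Proof.
apply: (Wt_gen (k := 0)); first exact: ht0.
by exists true; left; split=> //; exists i.
Qed.

Lemma Ht_rhov : Ht 0 rhov.
Proof.
apply: lin_closed_sum => [|i _]; first exact: Ht_closed.
by apply: lin_closedZ; [exact: Ht_closed|exact: Ht_h0].
Qed.

Lemma Ht_simple s i : Ht (sg s) (gen s i).
Proof.
apply: (Wt_gen (k := sg s *: simple i)); first by rewrite /= htZ ht_simple mulr1.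
by exists s; right; exists [::], i; rewrite word_wt_nil.
Qed.

(** The argument m counts brackets, so the height is m + 1 up to sign. That finitely many elements
    span each such height makes dual bases possible. *)
Definition Ht_gens (s : bool) (m : nat) : seq g :=
  iter m (fun l => [seq lie_br (gen s j) x | j <- enum 'I_n, x <- l])
    [seq gen s i | i <- enum 'I_n].

Lemma word_Ht_gens s w i : word s w i \in Ht_gens s (size w).
Proof.
elim: w => [|j w IH] /=; first by apply: map_f; rewrite mem_enum.
by apply: allpairs_f => //; rewrite mem_enum.
Qed.

Lemma Ht_gensP s m x : Ht (sg s * m.+1%:Z) x -> lin_span [set` Ht_gens s m] x.
Proof.
apply: lin_span_mono => y [k hk /hom_gen_ht[[k0 _]|[s' [w [i [k0 ->]]]]]]; rewrite /= in hk *.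
  by move: hk; rewrite k0; case: (s); rewrite /= ?mul1r ?mulN1r; lia.
have [-> <-] : s' = s /\ size w = m; last exact: word_Ht_gens.
by move: hk; rewrite k0; case: (s) s' {k0} => -[]; rewrite /= ?mul1r ?mulN1r; split; lia.
Qed.

Lemma Ht_succ s m x : Ht (sg s * m.+1%:Z) x ->
  lin_span [set z | exists i y, Ht (sg s * m%:Z) y /\ z = lie_br (gen s i) y] x.
Proof.
apply: lin_span_mono => z [k hk /hom_gen_ht[[k0 _]|[s' [w [i [k0 ->]]]]]]; rewrite /= in hk *.
  by move: hk; rewrite k0; case: (s); rewrite /= ?mul1r ?mulN1r; lia.
have [-> <-] : s' = s /\ size w = m.
  by move: hk; rewrite k0; case: (s) s' {k0} => -[]; rewrite /= ?mul1r ?mulN1r; split; lia.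
case: w {k0} => [|j w] /=.
  (* A single generator is not built from a shorter word; it is its own bracket with a multiple of
     [rhov], which has height 0. *)
  exists i, (- (sg s)%:K *: rhov); rewrite mulr0; split.
    by apply: lin_closedZ; [exact: Ht_closed|exact: Ht_rhov].
  rewrite brZr brC (rhov_Ht (Ht_simple s i)) scalerN scaleNr opprK scalerA -intrM.
  by case: (s); rewrite /= scale1r.
exists j, (word s w i); split=> //.
apply: (Wt_gen (k := sg s *: word_wt w i)); first by rewrite /= htZ ht_word_wt.
by exists s; right; exists w, i.
Qed.

End HeightsAndFunctionals.

Section InvariantForm.
Variables (K : numFieldType) (n : nat) (A : 'M[int]_n).
Hypothesis slA : simply_laced A.
Hypothesis unitA : map_mx intr A \in @unitmx K n.

Local Notation g := (kac_moody K A).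
Local Notation e := (@km_e K n A).
Local Notation f := (@km_f K n A).
Local Notation h := (@km_h K n A).
Local Notation gen := (@gen K n A).
Local Notation qform := (@qform n A).
Local Notation simple := (@simple n).
Local Notation "c %:K" := (c%:~R : K) (at level 2, format "c %:K").
Local Notation Wt := (@Wt K n A).
Local Notation word := (@word K n A).
Local Notation hom_gen := (@hom_gen K n A).
Local Notation Ht := (@Ht K n A).
Local Notation rhov := (rhov unitA).
Lemma lin_closed_eqK (F G : g -> K) :
  (forall a x y, F (a *: x + y) = a * F x + F y) ->
  (forall a x y, G (a *: x + y) = a * G x + G y) ->
  lin_closed [set x | F x = G x].
Proof.
move=> HF HG; split=> [|a x y /= Ex Ey]; last by rewrite HF HG Ex Ey.
have F0 (H : g -> K) : (forall a x y, H (a *: x + y) = a * H x + H y) -> H 0 = 0.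
  by move=> /(_ (-1) 0 0); rewrite scaler0 addr0 mulN1r addNr.
by rewrite /= !F0.
Qed.

Lemma lin_closed_eqV (V : lmodType K) (F G : g -> V) : linear F -> linear G ->
  lin_closed [set x | F x = G x].
Proof.
move=> HF HG; split=> [|a x y /= Ex Ey]; last by rewrite HF HG Ex Ey.
have F0 (H : g -> V) : linear H -> H 0 = 0.
  by move=> /(_ (-1) 0 0); rewrite scaler0 addr0 scaleN1r addNr.
by rewrite /= !F0.
Qed.

Section Functional.
Variable F : g -> K.
Hypothesis HF : forall a x y, F (a *: x + y) = a * F x + F y.
Lemma funcK0 : F 0 = 0.
Proof. by have := HF (-1) 0 0; rewrite scaler0 addr0 mulN1r addNr. Qed.
Lemma funcKZ a x : F (a *: x) = a * F x.
Proof. by rewrite -[a *: x]addr0 HF funcK0 addr0. Qed.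
Lemma funcKD x y : F (x + y) = F x + F y.
Proof. by rewrite -[x]scale1r HF mul1r scale1r. Qed.
Lemma funcKN x : F (- x) = - F x.
Proof. by rewrite -scaleN1r funcKZ mulN1r. Qed.
Lemma funcK_sum I (r : seq I) (P : pred I) (G : I -> g) :
  F (\sum_(i <- r | P i) G i) = \sum_(i <- r | P i) F (G i).
Proof. by elim/big_rec2: _ => [|i x y _ <-]; rewrite ?funcK0 ?funcKD. Qed.
End Functional.

Definition crho (lam : 'I_n -> K) (x : g) : K := rho slA lam x.
Lemma crhoP lam a x y : crho lam (a *: x + y) = a * crho lam x + crho lam y.
Proof. by rewrite /crho linearP. Qed.
Lemma crho_h lam i : crho lam (h i) = lam i. Proof. exact: rho_h. Qed.

(** On the Cartan subalgebra [al i] is the simple root alpha_i, [co i] the coordinate along h_i, and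
    [tr] the pairing with [rhov]. *)
Local Notation al i := (crho (fun j => (A i j)%:K)).
Local Notation co i := (crho (fun j => (j == i)%:R)).
Local Notation tr := (crho (fun=> 1)).

Lemma cartanE x : Ht 0 x -> x = \sum_i co i x *: h i.
Proof.
move/(Ht0 unitA); have: lin_closed [set x | x = \sum_i co i x *: h i].
  apply: lin_closed_eqV => [//|a y z].
  rewrite scaler_sumr -big_split /=; apply: eq_bigr => i _.
  by rewrite crhoP; lmod.
move/lin_span_sub; apply; move=> _ [i _ <-] /=.
rewrite (bigD1 i) //= big1 => [|j ji]; first by rewrite crho_h eqxx scale1r addr0.
by rewrite crho_h eq_sym (negbTE ji) scale0r.
Qed.

Lemma cartan_e x i : Ht 0 x -> lie_br x (e i) = al i x *: e i.
Proof.
have [_ As _] := slA; have [_ _ he _] := km_triangular K A.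
move=> x0; rewrite {1}(cartanE x0) br_suml {2}(cartanE x0) (funcK_sum (crhoP _)).
rewrite scaler_suml; apply: eq_bigr => j _.
by rewrite brZl he (funcKZ (crhoP _)) crho_h As scalerA.
Qed.

Lemma cartan_br x y : Ht 0 x -> Ht 0 y -> lie_br x y = 0.
Proof.
have [hh _ _ _] := km_triangular K A.
move=> x0 y0; rewrite (cartanE x0) (cartanE y0) br_suml big1 // => i _.
by rewrite br_sumr big1 // => j _; rewrite brZl brZr hh !scaler0.
Qed.

(* The invariant form between the heights m and -m.  For m > 0 invariance forces
   (x | y) = (rhov | [x, y]) / m, and (rhov | h_i) = 1. *)
Definition hform (m : nat) (x y : g) : K :=
  if m is 0%N then \sum_j al j x * co j y else tr (lie_br x y) / m%:R.

Lemma hformPl m a x x' y : hform m (a *: x + x') y = a * hform m x y + hform m x' y.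
Proof.
case: m => [|m] /=; last by rewrite lie_linearl crhoP; ring.
rewrite mulr_sumr -big_split /=; apply: eq_bigr => j _.
by rewrite crhoP; ring.
Qed.

Lemma hformPr m a x y y' : hform m x (a *: y + y') = a * hform m x y + hform m x y'.
Proof.
case: m => [|m] /=; last by rewrite lie_linearr crhoP; ring.
rewrite mulr_sumr -big_split /=; apply: eq_bigr => j _.
by rewrite crhoP; ring.
Qed.

Arguments hform : simpl never.
Local Notation B := hform.

Lemma hform0l m y : B m 0 y = 0.
Proof. exact: (funcK0 (fun a x x' => hformPl m a x x' y)). Qed.
Lemma hformZl m a x y : B m (a *: x) y = a * B m x y.
Proof. exact: (funcKZ (fun a x x' => hformPl m a x x' y)). Qed.
Lemma hformNl m x y : B m (- x) y = - B m x y.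
Proof. exact: (funcKN (fun a x x' => hformPl m a x x' y)). Qed.
Lemma hformDl m x x' y : B m (x + x') y = B m x y + B m x' y.
Proof. exact: (funcKD (fun a x x' => hformPl m a x x' y)). Qed.
Lemma hform0r m x : B m x 0 = 0.
Proof. exact: (funcK0 (fun a y y' => hformPr m a x y y')). Qed.
Lemma hformZr m a x y : B m x (a *: y) = a * B m x y.
Proof. exact: (funcKZ (fun a y y' => hformPr m a x y y')). Qed.
Lemma hformNr m x y : B m x (- y) = - B m x y.
Proof. exact: (funcKN (fun a y y' => hformPr m a x y y')). Qed.
Lemma hformDr m x y y' : B m x (y + y') = B m x y + B m x y'.
Proof. exact: (funcKD (fun a y y' => hformPr m a x y y')). Qed.
Definition hforml := (hform0l, hformZl, hformNl, hformDl).
Definition hformr := (hform0r, hformZr, hformNr, hformDr).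

Lemma hform0_hr x j : B 0 x (h j) = al j x.
Proof.
rewrite /hform (bigD1 j) //= big1 => [|i ij]; first by rewrite crho_h eqxx mulr1 addr0.
by rewrite crho_h eq_sym (negbTE ij) mulr0.
Qed.

Lemma trace_form m x y : Ht m%:Z x -> Ht (- m%:Z) y -> m%:R * B m x y = tr (lie_br x y).
Proof.
case: m => [|m] mx; last by rewrite /hform mulrC divfK // pnatr_eq0.
by rewrite oppr0 => my; rewrite mul0r cartan_br // (funcK0 (crhoP _)).
Qed.

Lemma Ht_e_up m i x : Ht m%:Z x -> Ht m.+1%:Z (lie_br (e i) x).
Proof. by move=> /(Ht_gen slA true i); rewrite intS addrC. Qed.
Lemma Ht_f_up m i x : Ht (- m%:Z) x -> Ht (- m.+1%:Z) (lie_br (f i) x).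
Proof. by move=> /(Ht_gen slA false i); rewrite intS opprD addrC. Qed.
Lemma Ht_e_down m i x : Ht (- m.+1%:Z) x -> Ht (- m%:Z) (lie_br (e i) x).
Proof. by move=> /(Ht_gen slA true i); rewrite intS opprD addrAC addNr add0r. Qed.
Lemma Ht_f_down m i x : Ht m.+1%:Z x -> Ht m%:Z (lie_br (f i) x).
Proof. by move=> /(Ht_gen slA false i); rewrite intS addrAC subrr add0r. Qed.
Lemma Ht_down_f m i x : Ht m.+1%:Z x -> Ht m%:Z (lie_br x (f i)).
Proof.
move=> /(Ht_f_down i); rewrite [lie_br x _]brC; apply: lin_closedN; exact: Ht_closed.
Qed.

Lemma Ht_e_ind m (S : set g) : lin_closed S ->
    (forall i y, Ht m%:Z y -> S (lie_br (e i) y)) ->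
  forall x, Ht m.+1%:Z x -> S x.
Proof.
move=> cS Se x; rewrite -[m.+1%:Z]mul1r => /(Ht_succ slA unitA (s := true)).
by apply: (lin_span_sub cS) => _ [i [y [my ->]]]; apply: Se; rewrite -[m%:Z]mul1r.
Qed.

Lemma Ht_f_ind m (S : set g) : lin_closed S ->
    (forall i y, Ht (- m%:Z) y -> S (lie_br (f i) y)) ->
  forall x, Ht (- m.+1%:Z) x -> S x.
Proof.
move=> cS Se x; rewrite -[- m.+1%:Z]mulN1r => /(Ht_succ slA unitA (s := false)).
by apply: (lin_span_sub cS) => _ [i [y [my ->]]]; apply: Se; rewrite -[- m%:Z]mulN1r.
Qed.

Lemma Ht_e1 x : Ht 1 x -> lin_span (range e) x.
Proof.
rewrite -[1]mul1r => /(Ht_gensP unitA (s := true)); apply: lin_span_mono.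
by move=> _ /mapP[i _ ->]; exists i.
Qed.

(** Four instances of invariance, each feeding the others in an induction on m. This one is (h_i |
    [x, y]) = ([h_i, x] | y). In [br_height1] the coefficient of e_i is ([x, y] | f_i) = - ([x, f_i]
    | y). The last two move f_i and e_j across the form. *)
Definition cartan_inv m := forall x y i, Ht m%:Z x -> Ht (- m%:Z) y ->
  al i (lie_br x y) = B m (lie_br (h i) x) y.
Definition br_height1 m := forall x y, Ht m.+1%:Z x -> Ht (- m%:Z) y ->
  lie_br x y = - \sum_i B m (lie_br x (f i)) y *: e i.
Definition f_inv m := forall x y i, Ht m.+1%:Z x -> Ht (- m%:Z) y ->
  B m (lie_br x (f i)) y = B m.+1 x (lie_br (f i) y).
Definition e_inv m := forall x y j, Ht m%:Z x -> Ht (- m.+1%:Z) y ->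
  B m.+1 (lie_br (e j) x) y = - B m x (lie_br (e j) y).

Lemma Ht_br0 m x y : Ht m%:Z x -> Ht (- m%:Z) y -> Ht 0 (lie_br x y).
Proof. by move=> mx my; rewrite -(subrr m%:Z); apply: (Ht_br slA). Qed.

Lemma hform_h m i x y : Ht m.+1%:Z x -> Ht (- m.+1%:Z) y ->
  B m.+1 x (lie_br (h i) y) = - B m.+1 (lie_br (h i) x) y.
Proof.
move=> mx my; rewrite /hform -mulNr; congr (_ / _).
rewrite -(funcKN (crhoP _)); congr (crho _ _); apply/eqP; rewrite -addr_eq0.
by rewrite addrC -brA cartan_br //; [apply: Ht_h0|apply: Ht_br0 mx my].
Qed.

Lemma sum_delta (V : lmodType K) j (F : 'I_n -> V) :
  \sum_i (j == i)%:R *: F i = F j.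
Proof.
rewrite (bigD1 j) //= eqxx scale1r big1 ?addr0 // => i ij.
by rewrite eq_sym (negbTE ij) scale0r.
Qed.

(** Multiplied by m + 1, the right side is tr [x, [f_i, y]] = tr [[x, f_i], y] + tr [f_i, [x, y]].
    The first term is m ([x, f_i] | y); by [br_height1] the second contributes the same value once
    more. *)
Lemma br_height1_c m : br_height1 m -> f_inv m.
Proof.
have [_ ef _ _] := km_triangular K A.
move=> b x y i mx my; have m1 : m.+1%:R != 0 :> K by rewrite pnatr_eq0.
apply: (mulfI m1); rewrite [RHS](@trace_form m.+1) //; last exact: Ht_f_up.
rewrite brA (funcKD (crhoP _)) -(@trace_form m) //; last exact: Ht_down_f.
rewrite -[m.+1%:R]natr1 mulrDl mul1r; congr (_ + _).
rewrite (b x y mx my) brNr br_sumr (funcKN (crhoP _)) (funcK_sum (crhoP _)) -sumrN.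
rewrite (bigD1 i) //= big1 => [|j ji].
  by rewrite brZr [lie_br (f i) (e _)]brC ef eqxx scale1r (funcKZ (crhoP _)) (funcKN (crhoP _)) crho_h addr0; ring.
rewrite brZr [lie_br (f i) (e _)]brC ef (negbTE ji) scale0r.
by rewrite oppr0 scaler0 (funcK0 (crhoP _)) oppr0.
Qed.

Lemma br_height10 : br_height1 0.
Proof.
have [hh ef he hf] := km_triangular K A; have [_ As _] := slA.
move=> x y /Ht_e1 x1 /(Ht0 unitA); rewrite ?oppr0 => y0.
have lx z : lin_closed [set x | lie_br x z = - \sum_i B 0 (lie_br x (f i)) z *: e i].
  apply: lin_closed_eqV => a u v; first by rewrite lie_linearl.
  rewrite scalerN -opprD scaler_sumr -big_split /=; congr (- _).
  by apply: eq_bigr => i _; rewrite lie_linearl hformPl; lmod.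
move: x1; apply: (lin_span_sub (lx y)) => _ [j _ <-] /=.
have ly : lin_closed [set y | lie_br (e j) y = - \sum_i B 0 (lie_br (e j) (f i)) y *: e i].
  apply: lin_closed_eqV => a u v; first by rewrite lie_linearr.
  rewrite scalerN -opprD scaler_sumr -big_split /=; congr (- _).
  by apply: eq_bigr => i _; rewrite hformPr; lmod.
move: y0; apply: (lin_span_sub ly) => _ [k _ <-] /=.
rewrite brC he; congr (- _).
rewrite -(sum_delta j (fun i => (A k i)%:K *: e i)); apply: eq_bigr => i _.
by rewrite ef hform0_hr (funcKZ (crhoP _)) crho_h scalerA; have [->|_] := eqVneq j i; rewrite ?mul0r.
Qed.

Lemma e_inv0 : e_inv 0.
Proof.
have [hh ef he hf] := km_triangular K A; have [_ As _] := slA.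
move=> x y j x0.
apply: (Ht_f_ind (S := [set y | B 1 (lie_br (e j) x) y = - B 0 x (lie_br (e j) y)])).
  apply: lin_closed_eqK => a u v; first by rewrite hformPr.
  by rewrite lie_linearr hformPr; ring.
move=> i z; rewrite ?oppr0 => z0.
have fz : lie_br (f i) z = al i z *: f i.
  move: z0 => /(cartanE) ->; rewrite br_sumr (funcK_sum (crhoP _)) scaler_suml.
  by apply: eq_bigr => k _; rewrite brZr brC hf (funcKZ (crhoP _)) crho_h As; lmod.
rewrite /= fz !(hformr, brZr) [lie_br (e j) x]brC (cartan_e j x0) !hforml -mulrN; congr (_ * _).
rewrite mulN1r ef; congr (- _); have [->|ij] := eqVneq j i.
  by rewrite scale1r hform0_hr /hform ef eqxx scale1r crho_h divr1 mulr1.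
by rewrite scale0r hformr /hform ef (negbTE ij) scale0r (funcK0 (crhoP _)) mul0r mulr0.
Qed.

Lemma cartan_inv_succ m : cartan_inv m -> br_height1 m -> f_inv m -> cartan_inv m.+1.
Proof.
have [hh ef he hf] := km_triangular K A; have [_ As _] := slA.
move=> a b c x y k mx.
apply: (Ht_f_ind (S := [set y | al k (lie_br x y) = B m.+1 (lie_br (h k) x) y])).
  by apply: lin_closed_eqK => s u v; rewrite ?lie_linearr ?crhoP ?hformPr.
move=> i z mz; rewrite /= brA (funcKD (crhoP _)) a //; last exact: Ht_down_f.
rewrite (b x z) // brNr br_sumr.
have -> : \sum_j lie_br (f i) (B m (lie_br x (f j)) z *: e j) =
    - (B m (lie_br x (f i)) z *: h i).
  rewrite (bigD1 i) //= big1 => [|j ji].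
    by rewrite addr0 brZr [lie_br (f i) (e _)]brC ef eqxx scale1r scalerN.
  by rewrite brZr [lie_br (f i) (e _)]brC ef (negbTE ji) scale0r oppr0 scaler0.
rewrite opprK (funcKZ (crhoP _)) crho_h addrC [B m _ _ * _]mulrC -hformPl.
rewrite -[B m.+1 _ _]c //; last exact: Ht_h.
by congr (B m _ z); rewrite brA hf brZr; lmod.
Qed.

Lemma br_height1_succ m : cartan_inv m.+1 -> br_height1 m -> e_inv m -> br_height1 m.+1.
Proof.
have [hh ef he hf] := km_triangular K A; have [_ As _] := slA.
move=> a b d x y mx my; move: x mx; apply: (Ht_e_ind
  (S := [set x | lie_br x y = - \sum_i B m.+1 (lie_br x (f i)) y *: e i])).
  apply: lin_closed_eqV => s u v; first by rewrite lie_linearl.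
  rewrite scalerN -opprD scaler_sumr -big_split /=; congr (- _).
  by apply: eq_bigr => i _; rewrite lie_linearl hformPl; lmod.
move=> j x mx; rewrite /= brAl [lie_br (e j) (lie_br _ _)]brC.
rewrite (cartan_e j (Ht_br0 mx my)) a // (b x (lie_br (e j) y)) //; last exact: Ht_e_down.
rewrite opprK -(sum_delta j (fun i => B m.+1 (lie_br (h i) x) y *: e i)).
rewrite addrC -sumrB -sumrN.
apply: eq_bigr => i _; rewrite brAl ef !brZr.
rewrite [lie_br x (h j)]brC !hforml d //; last exact: Ht_down_f.
by have [->|_] := eqVneq j i; rewrite ?mulr1n ?mulr0n; lmod.
Qed.

Lemma e_inv_succ m : f_inv m -> f_inv m.+1 -> e_inv m -> e_inv m.+1.
Proof.
have [hh ef he hf] := km_triangular K A; have [_ As _] := slA.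
move=> c c1 d x y j mx.
apply: (Ht_f_ind (S := [set y | B m.+2 (lie_br (e j) x) y = - B m.+1 x (lie_br (e j) y)])).
  apply: lin_closed_eqK => s u v; first by rewrite hformPr.
  by rewrite lie_linearr hformPr; ring.
move=> i z mz; rewrite /= -c1 //; last exact: Ht_e_up.
have -> : lie_br (lie_br (e j) x) (f i) =
    lie_br (e j) (lie_br x (f i)) + (j == i)%:R *: lie_br (h j) x.
  by rewrite brAl ef brZr [lie_br x (h j)]brC; lmod.
rewrite [lie_br (e j) (lie_br (f i) z)]brA ef brZl !hforml !hformr hform_h //.
rewrite d //; last exact: Ht_down_f.
rewrite -c //; last exact: Ht_e_down.
ring.
Qed.

Lemma form_invariant m : [/\ cartan_inv m, br_height1 m, f_inv m & e_inv m].
Proof.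
elim: m => [|m [a b c d]]; last first.
  have a1 := cartan_inv_succ a b c; have b1 := br_height1_succ a1 b d.
  by split=> //; [apply: br_height1_c|apply: e_inv_succ => //; apply: br_height1_c].
split; [|exact: br_height10|exact/br_height1_c/br_height10|exact: e_inv0].
move=> x y i x0; rewrite ?oppr0 => y0.
rewrite !cartan_br //; last exact: Ht_h0.
by rewrite (funcK0 (crhoP _)) hforml.
Qed.

End InvariantForm.

(** * The theorem of Gabber and Kac *)

Section GabberKac.
Variables (K : numFieldType) (n : nat) (A : 'M[int]_n).
Hypothesis slA : simply_laced A.
Hypothesis unitA : map_mx intr A \in @unitmx K n.

Local Notation g := (kac_moody K A).
Local Notation e := (@km_e K n A).
Local Notation f := (@km_f K n A).
Local Notation h := (@km_h K n A).
Local Notation gen := (@gen K n A).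
Local Notation qform := (@qform n A).
Local Notation simple := (@simple n).
Local Notation "c %:K" := (c%:~R : K) (at level 2, format "c %:K").
Local Notation Q := 'rV[int]_n.
Local Notation Wt := (@Wt K n A).
Local Notation word := (@word K n A).
Local Notation hom_gen := (@hom_gen K n A).
Local Notation Ht := (@Ht K n A).
Local Notation rhov := (rhov unitA).
Local Notation B := (hform slA).
Local Notation Ht_gens := (@Ht_gens K n A).
(** Gram-Schmidt for a possibly degenerate pairing of two spaces: what remains of y lies in the left
    radical and disappears once nondegeneracy is known. *)
Lemma dual_family (V W : lmodType K) (b : V -> W -> K) (Ws : set W) (l : seq V) :
    (forall a x x' y, b (a *: x + x') y = a * b x y + b x' y) ->
    (forall a x y y', b x (a *: y + y') = a * b x y + b x y') ->
    lin_closed Ws ->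
  exists ds : seq (V * W),
    (forall p, p \in ds -> lin_span [set` l] p.1 /\ Ws p.2) /\
    forall y w, lin_span [set` l] y -> Ws w ->
      b (y - \sum_(p <- ds) b y p.2 *: p.1) w = 0.
Proof.
move=> bl br cW.
have b0l y : b 0 y = 0 by have := bl (-1) 0 0 y; rewrite scaler0 addr0 mulN1r addNr.
have b0r x : b x 0 = 0 by have := br (-1) x 0 0; rewrite scaler0 addr0 mulN1r addNr.
have bZl a x y : b (a *: x) y = a * b x y by rewrite -[a *: x]addr0 bl b0l addr0.
have bZr a x y : b x (a *: y) = a * b x y by rewrite -[a *: y]addr0 br b0r addr0.
have bNl x y : b (- x) y = - b x y by rewrite -scaleN1r bZl mulN1r.
have bNr x y : b x (- y) = - b x y by rewrite -scaleN1r bZr mulN1r.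
have bDl x x' y : b (x + x') y = b x y + b x' y by rewrite -[x]scale1r bl mul1r scale1r.
have bDr x y y' : b x (y + y') = b x y + b x y' by rewrite -[y]scale1r br mul1r scale1r.
have bsl I (r : seq I) F y : b (\sum_(i <- r) F i) y = \sum_(i <- r) b (F i) y.
  by elim/big_rec2: _ => [|i z t _ <-]; rewrite ?b0l ?bDl.
have bsr I (r : seq I) F x : b x (\sum_(i <- r) F i) = \sum_(i <- r) b x (F i).
  by elim/big_rec2: _ => [|i z t _ <-]; rewrite ?b0r ?bDr.
pose pr (ds : seq (V * W)) y := y - \sum_(p <- ds) b y p.2 *: p.1.
have prP ds : linear (pr ds).
  move=> a x y; rewrite /pr.
  have -> : \sum_(p <- ds) b (a *: x + y) p.2 *: p.1 =
      a *: (\sum_(p <- ds) b x p.2 *: p.1) + \sum_(p <- ds) b y p.2 *: p.1.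
    rewrite scaler_sumr -big_split /=; apply: eq_bigr => p _.
    by rewrite bl; lmod.
  lmod.
have clo ds w : lin_closed [set y | b (pr ds y) w = 0].
  split=> [|a x y /= Ex Ey]; last by rewrite prP bl Ex Ey mulr0 addr0.
  by rewrite /= /pr big1 ?subr0 // => p _; rewrite b0l scale0r.
suff [ds [ds1 ds2]] : exists ds : seq (V * W),
    (forall p, p \in ds -> lin_span [set` l] p.1 /\ Ws p.2) /\
    forall w, Ws w -> forall y, y \in l -> b (pr ds y) w = 0.
  exists ds; split=> // y w + Ww; apply: (lin_span_sub (clo ds w)) => z /=.
  exact: ds2.
elim: l => [|v l [ds [ds1 ds2]]]; first by exists [::].
have lsub : lin_span [set` l] `<=` lin_span [set` v :: l].
  by apply: lin_span_mono => x /= xl; rewrite inE xl orbT.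
have ds1' p : p \in ds -> lin_span [set` v :: l] p.1 /\ Ws p.2.
  by move=> /ds1[/lsub].
have [[w Ww nz]|no] := pselect (exists2 w, Ws w & b (pr ds v) w <> 0); last first.
  exists ds; split=> // w Ww y; rewrite inE => /orP[/eqP->|]; last exact: ds2.
  by apply: contrapT => nz; apply: no; exists w.
pose u := pr ds v; pose w1 := (b u w)^-1 *: w.
have Ww1 : Ws w1 by apply: lin_closedZ.
have uw1 : b u w1 = 1 by rewrite bZr mulVf //; apply/eqP.
(* The correction of w1 makes the pairing of y with the new second entry equal to b (pr ds y) w1.
   The new projection is the old one followed by removal of the component along u, the remainder of
   v. *)
exists ((u, w1 - \sum_(p <- ds) b p.1 w1 *: p.2) :: ds); split.
  move=> p; rewrite inE => /orP[/eqP->/=|]; last exact: ds1'.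
  split.
    apply: lin_closedB; first exact: lin_span_closed.
      by apply: lin_span_gen; rewrite /= inE eqxx.
    rewrite big_seq; apply: lin_closed_sum; first exact: lin_span_closed.
    by move=> q /ds1'[q1 _]; apply: lin_closedZ => //; exact: lin_span_closed.
  apply: lin_closedB => //; rewrite big_seq; apply: lin_closed_sum => // q /ds1[_ q2].
  exact: lin_closedZ.
have prE y : pr ((u, w1 - \sum_(p <- ds) b p.1 w1 *: p.2) :: ds) y =
    pr ds y - b (pr ds y) w1 *: u.
  rewrite {1}/pr big_cons /= opprD addrCA addrC; congr (_ - _ *: _).
  rewrite bDr bNr bsr /pr bDl bNl bsl; congr (_ - _); apply: eq_bigr => p _.
  by rewrite bZl bZr mulrC.
move=> w' Ww' y; rewrite inE prE => /orP[/eqP->|yl].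
  by rewrite -/u uw1 scale1r subrr b0l.
by rewrite (ds2 _ Ww1 _ yl) scale0r subr0 (ds2 _ Ww').
Qed.

Definition right_nondeg (m : nat) : Prop := forall z, Ht (- m%:Z) z ->
  (forall y, Ht m%:Z y -> B m y z = 0) -> z = 0.
Definition left_nondeg (m : nat) : Prop := forall y, Ht m%:Z y ->
  (forall z, Ht (- m%:Z) z -> B m y z = 0) -> y = 0.

Lemma Ht_gens_sub s m x : x \in Ht_gens s m -> Ht (sg s * m.+1%:Z) x.
Proof.
elim: m x => [|m IH] x /=; first by case/mapP=> i _ ->; rewrite mulr1; apply: Ht_simple.
case/allpairsP=> -[i y] /= [_ /IH my ->]; have := Ht_gen slA s i my.
by rewrite [m.+2%:Z]intS mulrDr mulr1 addrC.
Qed.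

Lemma involution_Ht (om : {linear g -> g}) : lie_morphism om ->
    (forall i, om (e i) = f i) -> (forall i, om (f i) = e i) ->
    (forall i, om (h i) = - h i) ->
  forall m x, Ht m x -> Ht (- m) (om x).
Proof.
move=> mor ome omf omh m; apply: (lin_span_sub (lin_closed_preim om (Ht_closed K A (- m)))).
have omg s i : om (gen s i) = gen (~~ s) i by case: s; [apply: ome|apply: omf].
move=> x [k <- [s [[-> [i ->]]|[w [i [-> ->]]]]]]; rewrite /preimage /=.
  rewrite omh ht0 oppr0; apply: lin_closedN; first exact: Ht_closed.
  exact: Ht_h0.
have -> : om (word s w i) = word (~~ s) w i.
  by elim: w => [|j w IH] /=; [apply: omg|rewrite mor omg IH].
apply: (Wt_gen (k := sg (~~ s) *: word_wt w i)); first by rewrite /= !htZ sgN mulNr.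
by exists (~~ s); right; exists w, i.
Qed.

(** The Chevalley involution exchanges opposite heights and negates the trace on the Cartan
    subalgebra, so it maps the left radical into the right one. *)
Lemma left_right_nondeg m : right_nondeg m.+1 -> left_nondeg m.+1.
Proof.
have [om [mor ome omf omh omK]] := chevalley_involution K A.
have omH := involution_Ht mor ome omf omh.
move=> rn y my y0; apply: (can_inj omK); rewrite raddf0; apply: rn => [|z mz].
  exact: omH.
have omz := omH _ _ mz; have := y0 _ omz; rewrite /hform => /eqP.
rewrite mulf_eq0 invr_eq0 pnatr_eq0 orbF => /eqP t0.
suff -> : crho slA (fun=> 1) (lie_br z (om y)) = 0 by rewrite mul0r.
have trom x : Ht 0 x -> crho slA (fun=> 1) (om x) = - crho slA (fun=> 1) x.
  move/(Ht0 unitA); have cl : lin_closed [set x | crho slA (fun=> 1) (om x) = - crho slA (fun=> 1) x].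
    by apply: lin_closed_eqK => a u v; rewrite ?linearP crhoP //; ring.
  by apply: (lin_span_sub cl) => _ [i _ <-] /=; rewrite omh (funcKN (crhoP slA _)).
have {1}-> : z = om (om z) by rewrite omK.
rewrite -mor trom; last by have := Ht_br slA omz my; rewrite addNr.
by rewrite brC (funcKN (crhoP slA _)) t0 !oppr0.
Qed.

(** Dual bases, recorded through the two expansions that the Casimir computation uses. *)
Definition dual_pair (m : nat) (ds : seq (g * g)) : Prop :=
  [/\ forall p, p \in ds -> Ht m%:Z p.1 /\ Ht (- m%:Z) p.2,
      forall y, Ht m%:Z y -> y = \sum_(p <- ds) B m y p.2 *: p.1
    & forall z, Ht (- m%:Z) z -> z = \sum_(p <- ds) B m p.1 z *: p.2].

Lemma dual_pair_exists m : right_nondeg m.+1 -> exists ds, dual_pair m.+1 ds.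
Proof.
move=> rn; have ln := left_right_nondeg rn.
have [ds [ds1 ds2]] := dual_family (Ht_gens true m) (hformPl slA m.+1) (fun a x => hformPr slA m.+1 a x)
  (Ht_closed K A (- m.+1%:Z)).
have gensP x : lin_span [set` Ht_gens true m] x <-> Ht m.+1%:Z x.
  split=> [|mx]; last by apply: (Ht_gensP unitA); rewrite mul1r.
  apply: (lin_span_sub (Ht_closed K A _)) => y /Ht_gens_sub.
  by rewrite mul1r.
have dsH p : p \in ds -> Ht m.+1%:Z p.1 /\ Ht (- m.+1%:Z) p.2.
  by move=> /ds1[/gensP].
have cH := Ht_closed K A.
have yE y : Ht m.+1%:Z y -> y = \sum_(p <- ds) B m.+1 y p.2 *: p.1.
  move=> my; apply/eqP; rewrite -subr_eq0; apply/eqP; apply: ln => [|z mz].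
    apply: lin_closedB => //; rewrite big_seq; apply: lin_closed_sum => // p /dsH[p1 _].
    exact: lin_closedZ.
  by apply: ds2 => //; apply/gensP.
exists ds; split=> // z mz; apply/eqP; rewrite -subr_eq0; apply/eqP; apply: rn => [|y my].
  apply: lin_closedB => //; rewrite big_seq; apply: lin_closed_sum => // p /dsH[_ p2].
  exact: lin_closedZ.
rewrite hformDr hformNr {1}(yE y my) (funcK_sum (fun a u v => hformPl slA m.+1 a u v z)).
rewrite (funcK_sum (fun a u v => hformPr slA m.+1 a y u v)) -sumrB big1 // => p _.
by rewrite hformZl hformZr mulrC subrr.
Qed.

(** * The truncated Casimir operator *)

Section Casimir.
Variables (V : lmodType K) (act : g -> gl V) (N : set V) (v0 : V).
Hypothesis cN : lin_closed N.
Hypothesis N0 : N v0.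
Hypothesis actN : forall x v, N v -> N (act x v).
Hypothesis actP : forall a x y v, N v -> act (a *: x + y) v = a *: act x v + act y v.
Hypothesis actBr : forall x y v, N v ->
  act (lie_br x y) v = act x (act y v) - act y (act x v).
Hypothesis act_e0 : forall i, act (e i) v0 = 0.
Hypothesis act_h0 : forall i, act (h i) v0 = 0.

Lemma act0 v : N v -> act 0 v = 0.
Proof. by move=> /(actP (-1) 0 0); rewrite scaler0 addr0 scaleN1r addNr. Qed.
Lemma actZ a x v : N v -> act (a *: x) v = a *: act x v.
Proof. by move=> Nv; rewrite -[a *: x]addr0 actP // act0 // addr0. Qed.
Lemma actD x y v : N v -> act (x + y) v = act x v + act y v.
Proof. by move=> Nv; rewrite -{1}[x]scale1r actP // scale1r. Qed.
Lemma actNl x v : N v -> act (- x) v = - act x v.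
Proof. by move=> Nv; rewrite -scaleN1r actZ // scaleN1r. Qed.
Lemma act_sum I (r : seq I) (F : I -> g) v : N v ->
  act (\sum_(i <- r) F i) v = \sum_(i <- r) act (F i) v.
Proof. by move=> Nv; elim/big_rec2: _ => [|i x y _ <-]; rewrite ?act0 ?actD //. Qed.
Lemma act_swap x y v : N v -> act x (act y v) = act y (act x v) + act (lie_br x y) v.
Proof. by move=> Nv; rewrite actBr // addrC subrK. Qed.

Definition mword (w : seq 'I_n) : V := foldr (fun i => act (f i)) v0 w.
Definition word_wts (w : seq 'I_n) : Q := \sum_(i <- w) simple i.

Lemma mword_N w : N (mword w).
Proof. by elim: w => //= i w IH; apply: actN. Qed.

Lemma ht_word_wts w : ht (word_wts w) = (size w)%:Z.
Proof.
elim: w => [|i w IH]; first by rewrite /word_wts big_nil ht0.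
by rewrite /word_wts big_cons htD ht_simple IH.
Qed.

Lemma mword_h i w : act (h i) (mword w) = - (qform (simple i) (word_wts w))%:K *: mword w.
Proof.
have [_ _ _ hf] := km_triangular K A.
elim: w => [|j w IH]; first by rewrite /word_wts big_nil qform0r // oppr0 scale0r; apply: act_h0.
have Nw := mword_N w; rewrite /= act_swap // IH linearZ /= hf actZ //.
by rewrite /word_wts big_cons qformDr // qform_simple2 // -/(word_wts w); lmod.
Qed.

Definition mweight (k : Q) : set V := lin_span [set mword w | w in [set w | word_wts w = k]].
(** The vector v0 is excluded on purpose, so that depth 0 is the zero space. As the highest weight
    is 0, e_i f_j v0 = 0, and the e_i still lower the depth by one. *)
Definition mdepth (d : nat) : set V :=
  lin_span [set mword w | w in [set w | size w = d /\ (0 < d)%N]].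

Lemma mdepth_N d u : mdepth d u -> N u.
Proof. by apply: (lin_span_sub cN) => _ [w _ <-]; apply: mword_N. Qed.

Lemma mdepth0 u : mdepth 0 u -> u = 0.
Proof. by apply: (lin_span_sub (set0_closed V)) => _ [w [] _ /= + <-]. Qed.

Lemma mdepth_map d d' (phi : {linear V -> V}) :
  (forall w, size w = d -> (0 < d)%N -> mdepth d' (phi (mword w))) ->
  forall u, mdepth d u -> mdepth d' (phi u).
Proof.
move=> H; apply: (lin_span_sub (lin_closed_preim phi (lin_span_closed _))).
by move=> _ [w [sw d0] <-]; apply: H.
Qed.

Lemma mdepth_f d i u : (0 < d)%N -> mdepth d u -> mdepth d.+1 (act (f i) u).
Proof.
move=> d0; apply: (mdepth_map (phi := act (f i))) => w sw _.
by apply: lin_span_gen; exists (i :: w) => //=; rewrite sw.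
Qed.

Lemma mdepth_e d i u : mdepth d u -> mdepth d.-1 (act (e i) u).
Proof.
have [_ ef _ _] := km_triangular K A.
apply: (mdepth_map (phi := act (e i))) => w <- {d}; case: w => // j w _.
suff : mdepth (size w) (act (e i) (mword (j :: w))) by [].
elim: w j => [|j' w IH] j.
  rewrite /= act_swap // act_e0 raddf0 add0r ef actZ // act_h0 scaler0.
  exact: lin_span0.
have Nw := mword_N (j' :: w).
rewrite -[mword (j :: _)]/(act (f j) (mword (j' :: w))) act_swap // ef actZ // mword_h.
apply: lin_closedD; first exact: lin_span_closed.
  have := IH j'; have [->|nw] := eqVneq w [::].
    by move=> /mdepth0 ->; rewrite raddf0; apply: lin_span0.
  by apply: mdepth_f; case: (w) nw.
do 2![apply: lin_closedZ; first exact: lin_span_closed].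
by apply: lin_span_gen; exists (j' :: w).
Qed.

Lemma mdepth_pos m d y u : (d <= m.+1)%N -> Ht m.+1%:Z y -> mdepth d u -> act y u = 0.
Proof.
move=> dm + du; have Nu := mdepth_N du.
have cl : lin_closed [set y | act y u = 0].
  split=> [|a x z /= Ex Ez]; first exact: act0.
  by rewrite actP // Ex Ez scaler0 addr0.
rewrite -[m.+1%:Z]mul1r => /(Ht_gensP unitA (s := true)).
apply: (lin_span_sub cl) => {}y /= ym; apply: mdepth0.
(* Each of the m + 1 letters lowers the depth by one; truncated subtraction absorbs the case where
   depth 0 is reached early. *)
have -> : 0%N = (d - m.+1)%N by apply/esym/eqP.
clear dm cl Nu; move: y ym u du; elim: m d => [|m IH] d y /= ym u du.
  by case/mapP: ym => i _ ->; rewrite subn1; apply: mdepth_e.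
case/allpairsP: ym => -[i z] /= [_ mz ->].
rewrite actBr; last exact: mdepth_N du.
apply: lin_closedB; first exact: lin_span_closed.
  have := mdepth_e i (IH d z mz u du); by rewrite -subnS.
have := IH d.-1 z mz _ (mdepth_e i du).
by rewrite -subn1 -subnDA add1n.
Qed.

Variables (M : nat) (ds : nat -> seq (g * g)).
Hypothesis dsP : forall m, (m < M)%N -> dual_pair m.+1 (ds m).

(* The Casimir operator of g truncated to the heights 1, ..., M; u is meant
   to have weight - k. *)
Definition casimir (k : Q) (u : V) : V :=
  (qform k k - 2 * ht k)%:K *: u +
  2 *: \sum_(0 <= m < M) \sum_(p <- ds m) act p.2 (act p.1 u).

(** The contribution of height 1 to the commutator with f_j: [p.1, f_j] is (p.1 | f_j) h_j, and
    these coefficients reassemble f_j from the p.2. *)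
Lemma casimir_h j u : (0 < M)%N -> N u ->
  \sum_(p <- ds 0) act p.2 (act (lie_br p.1 (f j)) u) = act (f j) (act (h j) u).
Proof.
have [_ ef _ _] := km_triangular K A.
move=> M0 Nu; have [ds1 _ zE] := dsP M0.
have Hfj : Ht (- 1%:Z) (f j) by exact: (Ht_simple K A false j).
rewrite {2}(zE (f j) Hfj) act_sum; last exact: actN.
rewrite !big_seq; apply: eq_bigr => p /ds1[p1 _].
rewrite actZ; last exact: actN.
have -> : lie_br p.1 (f j) = B 1 p.1 (f j) *: h j; last first.
  by rewrite actZ //; exact: linearZ.
move: p.1 p1 => x /(Ht_e1 unitA).
have cl : lin_closed [set x | lie_br x (f j) = B 1 x (f j) *: h j].
  apply: lin_closed_eqV => a y z; first by rewrite lie_linearl.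
  by rewrite hformPl; lmod.
apply: (lin_span_sub cl) => _ [i _ <-] /=; rewrite /hform ef (funcKZ (crhoP slA _)) crho_h.
by have [->|_] := eqVneq i j; rewrite ?mulr1n ?mulr0n ?mul0r ?mulr1 ?divr1 ?scale0r.
Qed.

(** After expansion in the dual pairs both sides have the same coefficients by [f_inv]. Hence
    consecutive heights cancel in the commutator with f_j. *)
Lemma casimir_shift m j u : (m.+1 < M)%N -> N u ->
  \sum_(p <- ds m.+1) act p.2 (act (lie_br p.1 (f j)) u) =
  - \sum_(q <- ds m) act (lie_br q.2 (f j)) (act q.1 u).
Proof.
move=> mM Nu; have [ds1 _ zE] := dsP mM; have [dq1 qyE _] := dsP (ltnW mM).
have [_ _ c _] := form_invariant slA unitA m.+1.
transitivity (\sum_(p <- ds m.+1) \sum_(q <- ds m)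
    (B m.+2 p.1 (lie_br (f j) q.2)) *: act p.2 (act q.1 u)).
  rewrite !big_seq; apply: eq_bigr => p /ds1[p1 _].
  have p1f := Ht_down_f slA j p1.
  rewrite {1}(qyE _ p1f) act_sum // raddf_sum !big_seq; apply: eq_bigr => q /dq1[_ q2].
  by rewrite actZ // -c //; exact: linearZ.
rewrite exchange_big /= -sumrN !big_seq; apply: eq_bigr => q /dq1[q1 q2].
have Nq : N (act q.1 u) by exact: actN.
rewrite [lie_br q.2 _]brC actNl // opprK.
rewrite [in RHS](zE (lie_br (f j) q.2)); last exact: Ht_f_up.
by rewrite act_sum //; apply: eq_bigr => p _; rewrite actZ.
Qed.

(** Induction on the word, commuting the operator past f_j. The heights telescope to 2 f_j h_j u = -
    2 (alpha_j | k) f_j u, which the growth of the scalar from k to k + alpha_j compensates. *)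
Lemma casimir_mword w : (0 < size w <= M.+1)%N -> casimir (word_wts w) (mword w) = 0.
Proof.
have [Ad _ _] := slA.
elim: w => // j w IH lew; rewrite /casimir.
(* For one letter the scalar is 2 - 2 = 0, and elements of positive height kill f_j v0. *)
have [w0|nw] := eqVneq w [::].
  rewrite w0 /word_wts big_seq1 qform_simple2 // Ad ht_simple mulr1 subrr scale0r add0r.
  rewrite big_nat big1 ?scaler0 // => m /= mM.
  have [ds1 _ _] := dsP mM; rewrite big_seq big1 // => p /ds1[p1 _].
  rewrite (mdepth_pos (d := 1) _ p1) ?raddf0 //.
  by apply: lin_span_gen; exists [:: j].
have sw : (0 < size w)%N by case: (w) nw.
have {}lew : (size w <= M)%N by [].
have {}IH := IH _; rewrite /casimir sw leqW // in IH; have {}IH := IH isT.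
set u := mword w in IH *; have Nu : N u := mword_N w.
have du : mdepth (size w) u by apply: lin_span_gen; exists w.
have -> : mword (j :: w) = act (f j) u by [].
have -> : \sum_(0 <= m < M) \sum_(p <- ds m) act p.2 (act p.1 (act (f j) u)) =
    act (f j) (\sum_(0 <= m < M) \sum_(p <- ds m) act p.2 (act p.1 u)) +
    (\sum_(0 <= m < M) \sum_(p <- ds m) act (lie_br p.2 (f j)) (act p.1 u) +
     \sum_(0 <= m < M) \sum_(p <- ds m) act p.2 (act (lie_br p.1 (f j)) u)).
  rewrite raddf_sum -!big_split /=; apply: eq_bigr => m _.
  rewrite raddf_sum -!big_split /=; apply: eq_bigr => p _.
  rewrite [act p.1 (act (f j) u)]act_swap // raddfD /= act_swap; last exact: actN.
  by rewrite addrA.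
have -> : \sum_(0 <= m < M) \sum_(p <- ds m) act (lie_br p.2 (f j)) (act p.1 u) +
    \sum_(0 <= m < M) \sum_(p <- ds m) act p.2 (act (lie_br p.1 (f j)) u) =
    act (f j) (act (h j) u).
  have [M' EM] : exists M', M = M'.+1 by case: (M) lew sw => [|M' _ _]; [case: (size w)|exists M'].
  rewrite EM big_nat_recr //= [X in _ + X]big_nat_recl //= casimir_h ?EM //.
  have dsM' := dsP (m := M'); rewrite EM in dsM'; have {dsM'}[ds1 _ _] := dsM' (leqnn _).
  (* The top height has no partner to cancel with. It vanishes because p.1 has height M and u depth
     at most M; the bound on the length of the word serves here. *)
  have -> : \sum_(p <- ds M') act (lie_br p.2 (f j)) (act p.1 u) = 0.
    rewrite big_seq big1 // => p /ds1[p1 _].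
    by rewrite (mdepth_pos _ p1 du) ?raddf0 // -EM.
  rewrite addr0 addrC -addrA -big_split /= big_nat big1 ?addr0 // => m mM'.
  by rewrite casimir_shift ?EM ?addNr.
have lin2 a b x y : act (f j) (a *: x + b *: y) = a *: act (f j) x + b *: act (f j) y.
  by rewrite raddfD; congr (_ + _); exact: linearZ.
have := congr1 (act (f j)) IH; rewrite raddf0 lin2 => E.
rewrite mword_h -/u.
have -> : act (f j) (- (qform (simple j) (word_wts w))%:K *: u) =
  - (qform (simple j) (word_wts w))%:K *: act (f j) u by exact: linearZ.
rewrite -[RHS]E.
rewrite /word_wts big_cons -/(word_wts w) !(qformDl, qformDr) // qform_simple2 // Ad htD ht_simple.
rewrite (qformC slA (word_wts w) (simple j)).
set a := qform _ _; set b := qform _ _; set t := ht _.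
rewrite !(rmorphD, rmorphB, rmorphM, rmorphN) /=.
lmod.
Qed.

Lemma casimir_linear k : linear (casimir k).
Proof.
move=> a u v; rewrite /casimir.
have -> : \sum_(0 <= m < M) \sum_(p <- ds m) act p.2 (act p.1 (a *: u + v)) =
    a *: (\sum_(0 <= m < M) \sum_(p <- ds m) act p.2 (act p.1 u)) +
    \sum_(0 <= m < M) \sum_(p <- ds m) act p.2 (act p.1 v).
  rewrite scaler_sumr -big_split /=; apply: eq_bigr => m _.
  rewrite scaler_sumr -big_split /=; apply: eq_bigr => p _.
  have lin (f : gl V) : f (a *: u + v) = a *: f u + f v by exact: linearP.
  by rewrite lin; exact: linearP.
lmod.
Qed.

Lemma casimir_mweight k u : ht k = M.+1%:Z -> mweight k u -> casimir k u = 0.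
Proof.
move=> hk; have cl : lin_closed [set u | casimir k u = 0].
  have c0 : casimir k 0 = 0.
    by have := casimir_linear k (-1) 0 0; rewrite scaler0 addr0 scaleN1r addNr.
  by split=> // a x y /= Ex Ey; rewrite casimir_linear Ex Ey scaler0 addr0.
apply: (lin_span_sub cl) => _ [w /= kw <-] /=; rewrite -kw; apply: casimir_mword.
by move: hk; rewrite -kw ht_word_wts => -[->]; rewrite ltnSn.
Qed.

Lemma act_mweight l w i u : mweight l u -> mweight (l + word_wt w i) (act (word false w i) u).
Proof.
have actf l' j v : mweight l' v -> mweight (l' + simple j) (act (f j) v).
  apply: (lin_span_sub (lin_closed_preim (act (f j)) (lin_span_closed _))) => _ [w' /= <- <-].
  by apply: lin_span_gen; exists (j :: w') => //=; rewrite /word_wts big_cons addrC.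
have mN l' v : mweight l' v -> N v.
  by apply: (lin_span_sub cN) => _ [w' _ <-]; apply: mword_N.
elim: w l u => [|j w IH] l u lu /=; first by rewrite word_wt_nil; apply: actf.
rewrite actBr; last exact: mN lu.
apply: lin_closedB; first exact: lin_span_closed.
  by have := actf _ j _ (IH _ _ lu); rewrite word_wt_cons -addrA [simple j + _]addrC.
by have := IH _ _ (actf _ j _ lu); rewrite word_wt_cons -addrA.
Qed.

Lemma act_v0_mweight k x : 0 < ht k -> Wt [set - k] x -> mweight k (act x v0).
Proof.
move=> hk.
have cl : lin_closed [set x | mweight k (act x v0)].
  split=> [|a y z /= my mz]; rewrite /= ?act0 //; first exact: lin_span0.
  by rewrite actP //; case: (lin_span_closed [set mword w | w in [set w | word_wts w = k]]) => _; apply.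
apply: (lin_span_sub cl) => y [_ ->] [s [[k0 _]|[w [i [k0 ->]]]]] /=.
  by move: hk; rewrite -[k]opprK k0 oppr0 ht0.
have kE : k = word_wt w i.
  case: s k0 => /=; last by rewrite scaleN1r => /oppr_inj.
  by rewrite scale1r => k0; move: hk; rewrite -[k]opprK k0 -scaleN1r htZ ht_word_wt.
have -> : s = false.
  by case: s k0 => //; rewrite /= scale1r => k0; move: hk;
    rewrite -[k]opprK k0 -scaleN1r htZ ht_word_wt.
rewrite kE -[word_wt w i in X in mweight X]add0r; apply: act_mweight.
by apply: lin_span_gen; exists [::] => //=; rewrite /word_wts big_nil.
Qed.

Lemma act_pos_kill m x y : (forall i, lie_br (e i) x = 0) -> Ht m.+1%:Z y ->
  act y (act x v0) = 0.
Proof.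
move=> ex; set u := act x v0; have Nu : N u by exact: actN.
have eu i : act (e i) u = 0.
  by rewrite /u act_swap // act_e0 ex act0 // raddf0 addr0.
have cl : lin_closed [set y | act y u = 0].
  split=> [|a y' z /= Ex Ez]; first exact: act0.
  by rewrite actP // Ex Ez scaler0 addr0.
rewrite -[m.+1%:Z]mul1r => /(Ht_gensP unitA (s := true)).
apply: (lin_span_sub cl) => {}y /=.
elim: m y => [|m IH] y /=; first by case/mapP => i _ ->.
by case/allpairsP=> -[i z] /= [_ /IH zu ->]; rewrite actBr // eu zu !raddf0 addr0.
Qed.

(** Positive heights kill x v0 by [act_pos_kill], so only the scalar part of the operator
    survives. *)
Lemma casimir_primitive k x : ht k = M.+1%:Z -> Wt [set - k] x ->
    (forall i, lie_br (e i) x = 0) ->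
  (qform k k - 2 * ht k)%:K *: act x v0 = 0.
Proof.
move=> hk kx ex; have hk0 : 0 < ht k by rewrite hk.
have := casimir_mweight hk (act_v0_mweight hk0 kx); rewrite /casimir.
rewrite big_nat big1 ?scaler0 ?addr0 // => m /= mM; have [ds1 _ _] := dsP mM.
by rewrite big_seq big1 // => p /ds1[p1 _]; rewrite (act_pos_kill ex p1) raddf0.
Qed.
End Casimir.

Definition ad_gl (x : g) : gl g := Gl (fun a y z => lie_linearr x a y z).

Lemma ad_gl_br x y : lie_br (ad_gl x) (ad_gl y) = ad_gl (lie_br x y).
Proof. by apply: gl_ext => z; rewrite gl_brE /= brAl. Qed.

(* This module replaces the Verma module with highest weight 0: on it the lower
   triangular part of g acts faithfully on the generating vector. *)
Lemma adjoint_module : exists (V : lmodType K) (act : g -> gl V) (N : set V)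
    (v0 : V) (ev : {linear V -> g}),
  [/\ lin_closed N, N v0, forall x v, N v -> N (act x v),
      forall a x y v, N v -> act (a *: x + y) v = a *: act x v + act y v
    & forall x y v, N v -> act (lie_br x y) v = act x (act y v) - act y (act x v)] /\
  [/\ forall i, act (e i) v0 = 0, forall i, act (h i) v0 = 0
    & forall m x, Ht (- m.+1%:Z) x -> ev (act x v0) = m.+1%:R *: x].
Proof.
have [hh ef he hf] := km_triangular K A.
have phh i j : lie_br (ad_gl (h i)) (ad_gl (h j)) = 0.
  by rewrite ad_gl_br hh; apply: gl_ext => z; rewrite /= br0l.
have phf i j : lie_br (ad_gl (h i)) (ad_gl (f j)) = - (A i j)%:K *: ad_gl (f j).
  by rewrite ad_gl_br hf; apply: gl_ext => z; rewrite gl_scaleE /= brZl.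
have pserre i j : i != j -> serre_elt A (fun i => ad_gl (f i)) i j = 0.
  move=> neq; have := km_serre_f K A neq.
  have -> : serre_elt A (fun i => ad_gl (f i)) i j = ad_gl (serre_elt A f i j).
    by rewrite /serre_elt; elim: `|_|%N => //= m ->; rewrite ad_gl_br.
  by move=> ->; apply: gl_ext => z; rewrite /= br0l.
(* The choice of [rhov] as base vector has two reasons: the h_i kill it, so the highest weight is 0,
   and [x, rhov] is a nonzero multiple of x at every negative height. *)
have php i : ad_gl (h i) rhov = 0 *: rhov.
  by rewrite /= scale0r (cartan_br slA unitA (Ht_h0 K A i) (Ht_rhov unitA)).
have [V [act [N [v0 [ev [[cN N0 actN actP actBr] [e0 h0 ev0 fv]]]]]]] :=
  coinduced_module slA phh phf pserre php.
exists V, act, N, v0, ev; split; split=> // [i|m x mx]; first by rewrite h0 scale0r.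
suff {x mx} evx v x : N v -> Ht (- m.+1%:Z) x -> ev (act x v) = lie_br x (ev v).
  by rewrite evx // ev0 brC (rhov_Ht slA unitA mx) intrN scaleNr opprK.
move=> + mx; have {mx} : lin_span [set` Ht_gens false m] x.
  by apply: (Ht_gensP unitA); rewrite mulN1r.
move=> xl Nv; have a0 : act 0 v = 0.
  by have := actP (-1) 0 0 v Nv; rewrite scaler0 addr0 scaleN1r addNr.
have cl : lin_closed [set x | ev (act x v) = lie_br x (ev v)].
  split=> [|a y z /= Ey Ez]; first by rewrite /= a0 raddf0 br0l.
  by rewrite actP // linearP Ey Ez lie_linearl.
move: xl; apply: (lin_span_sub cl) => {cl a0}y.
elim: m y v Nv => [|m IH] y v Nv /=; first by case/mapP => i _ ->; rewrite fv.
case/allpairsP=> -[i z] /= [_ mz ->]; rewrite actBr // raddfB /= fv; last exact: actN.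
rewrite (IH z v Nv mz) (IH z _ (actN _ _ Nv) mz) fv //=.
by rewrite brAl.
Qed.

Lemma right_nondeg0 : right_nondeg 0.
Proof.
move=> z; rewrite oppr0 => z0 bz; rewrite (cartanE slA unitA z0).
pose c : 'cV[K]_n := \col_i crho slA (fun j => (j == i)%:R) z.
suff c0 : c = 0.
  by rewrite big1 // => i _; have := congr1 (fun c : 'cV_n => c i 0) c0; rewrite !mxE => ->; rewrite scale0r.
apply: (can_inj (mulKmx unitA)); rewrite mulmx0; apply/matrixP => i j; rewrite !mxE.
rewrite -[RHS](bz (h i)); last exact: Ht_h0.
have [_ As _] := slA.
by rewrite /hform; apply: eq_bigr => k _; rewrite crho_h !mxE As.
Qed.

Theorem right_nondegP m : right_nondeg m.
Proof.
have [m' ltm] := ubnP m; elim: m' m ltm => // m' IH [_|m ltm]; first exact: right_nondeg0.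
have {}IH k : (k <= m)%N -> right_nondeg k by move=> km; apply: IH; exact: (leq_ltn_trans km ltm).
have ex_ds k : exists d, (k < m)%N -> dual_pair k.+1 d.
  have [km|] := boolP (k < m)%N; last by exists [::].
  by have [d dP] := dual_pair_exists (IH _ km); exists d.
have [ds dsP] := boolp.choice ex_ds.
have [_ _ _ invd] := form_invariant slA unitA m.
pose S : set g := [set z | Ht (- m.+1%:Z) z /\ forall y, Ht m.+1%:Z y -> B m.+1 y z = 0].
have cS : lin_closed S.
  have cH := Ht_closed K A (- m.+1%:Z).
  split=> [|a x y [mx Bx] [my By]]; split.
  - by case: cH.
  - by move=> y _; rewrite hform0r.
  - by case: cH => _; apply.
  - by move=> z mz; rewrite hformPr Bx // By // mulr0 addr0.
have hS : h_stable S.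
  move=> i x [mx Bx]; split=> [|y my]; first exact: Ht_h.
  by rewrite (hform_h slA unitA) // Bx ?oppr0 //; apply: Ht_h.
move=> z mz Bz; have := Wt_split slA unitA cS hS mz (conj mz Bz).
apply: (lin_span_sub (set0_closed _)) => {mz Bz}y [k0 hk0 [ky [my By]]] /=.
pose k := - k0; have hk : ht k = m.+1%:Z by rewrite /k -scaleN1r htZ hk0 mulN1r opprK.
have {}ky : Wt [set - k] y by rewrite /k opprK.
(* By [e_inv] the vector [e_i, y] lies in the radical for m, which is zero by the induction
   hypothesis. *)
have ey i : lie_br (e i) y = 0.
  apply: (IH m) => // [|x mx]; first exact: Ht_e_down.
  by apply/eqP; rewrite -oppr_eq0 -invd // By //; apply: Ht_e_up.
apply: contrapT => y0.
have k_ge0 i : 0 <= k 0 i.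
  rewrite leNgt; apply/negP => ki; apply: y0.
  have [j kj] : exists j, 0 < k 0 j.
    apply/existsP; apply: contraT => /existsPn npos.
    have : ht k <= 0 by apply: sumr_le0 => j _; rewrite leNgt npos.
    by rewrite hk.
  by apply: (Wt_mixed unitA (i := i) (j := j) _ _ ky); rewrite mxE ?oppr_gt0 ?oppr_lt0.
(* The h_i-weight of y is - (alpha_i | k), and e_i kills y. A nonzero vector killed by e_i on which
   f_i is nilpotent cannot have negative weight. *)
have kle0 i : qform (simple i) k <= 0.
  rewrite leNgt; apply/negP => ki; apply: y0.
  apply: (gen_inj slA (s := false) (i := i) (p := `|qform (simple i) k|) (q := 1)) => //.
  - by lia.
  - rewrite (Wt_h slA i ky) qformNr // -[_%:R]/(`|qform (simple i) k|%:Z%:~R) gtz0_abs //.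
    by rewrite intrN mulN1r.
  - exact: ey.
have neg : qform k k - 2 * ht k < 0.
  have : qform k k <= 0.
    by rewrite qform_expand; apply: sumr_le0 => j _; apply: mulr_ge0_le0.
  by rewrite hk; lia.
have [V [act [N [v0 [ev [[cN N0 actN actP actBr] [e0 h0 evx]]]]]]] := adjoint_module.
have := casimir_primitive cN N0 actN actP actBr e0 h0 dsP hk ky ey => /eqP.
rewrite scaler_eq0 intr_eq0 lt_eqF //= => /eqP v00; apply: y0.
have := evx _ _ my; rewrite v00 raddf0 => /esym/eqP.
by rewrite scaler_eq0 pnatr_eq0 => /eqP.
Qed.

(* The theorem of Gabber and Kac, for simply laced matrices of nonzero
   determinant. *)
Theorem ideal_cartan_eq0 (S : set g) : lin_closed S ->
    (forall x y, S y -> S (lie_br x y)) ->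
    (forall x, S x -> Ht 0 x -> x = 0) ->
  forall x, S x -> x = 0.
Proof.
move=> cS idS S0 x Sx.
have hS : h_stable S by move=> i y; apply: idS.
have := Wt_split slA unitA cS hS (Wt_setT slA x) Sx.
apply: (lin_span_sub (set0_closed _)) => {Sx}y [k _ [ky Sy]] /=.
have my : Ht (ht k) y by apply: Wt_mono ky => _ ->.
(* At nonzero height, brackets of y with the opposite height lie in the ideal and in the Cartan
   subalgebra, hence vanish. So y is in the radical of the form. *)
case hk : (ht k) my => [[|m]|m] my; first exact: S0.
- apply: (left_right_nondeg (@right_nondegP m.+1) my) => z mz.
  rewrite /hform [lie_br y z]S0 ?(funcK0 (crhoP slA _)) ?mul0r //.
    by rewrite brC; apply: lin_closedN => //; apply: idS.
  exact: Ht_br0 my mz.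
- rewrite NegzE in my; apply: (right_nondegP my) => z mz.
  by rewrite /hform [lie_br z y]S0 ?(funcK0 (crhoP slA _)) ?mul0r //; [apply: idS|apply: Ht_br0 mz my].
Qed.

End GabberKac.

(** * Embeddings given by real roots *)

Section RootPairs.
Variables (K : numFieldType) (n : nat) (A : 'M[int]_n).
Hypothesis slA : simply_laced A.
Hypothesis unitA : map_mx intr A \in @unitmx K n.

Local Notation g := (kac_moody K A).
Local Notation e := (@km_e K n A).
Local Notation f := (@km_f K n A).
Local Notation h := (@km_h K n A).
Local Notation gen := (@gen K n A).
Local Notation qform := (@qform n A).
Local Notation simple := (@simple n).
Local Notation "c %:K" := (c%:~R : K) (at level 2, format "c %:K").
Local Notation Q := 'rV[int]_n.
Local Notation Wt := (@Wt K n A).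
Local Notation word := (@word K n A).
Local Notation hom_gen := (@hom_gen K n A).
Local Notation Ht := (@Ht K n A).
Local Notation rhov := (rhov unitA).
Local Notation Ht_gens := (@Ht_gens K n A).
(** A simply laced root of norm 2 and its coroot have the same coordinates, in the alpha_i and in
    the h_i. *)
Definition coroot (k : Q) : g := \sum_i (k 0 i)%:K *: h i.

Definition root_pair (k : Q) (E F : g) : Prop :=
  [/\ Wt [set k] E, Wt [set - k] F & lie_br E F = coroot k].

Lemma corootD k l : coroot (k + l) = coroot k + coroot l.
Proof.
by rewrite /coroot -big_split /=; apply: eq_bigr => i _; rewrite mxE intrD; lmod.
Qed.

Lemma coroot_simple i : coroot (simple i) = h i.
Proof.
rewrite /coroot (bigD1 i) //= big1 => [|j ji]; rewrite mxE ?eqxx ?scale1r ?addr0 //.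
by rewrite (negbTE ji) scale0r.
Qed.

Lemma coroot_br k l x : Wt [set l] x -> lie_br (coroot k) x = (qform k l)%:K *: x.
Proof.
move=> lx; rewrite /coroot br_suml qform_expand rmorph_sum scaler_suml /=.
by apply: eq_bigr => i _; rewrite brZl (Wt_h slA i lx) scalerA intrM.
Qed.

Lemma root_pair_simple i : root_pair (simple i) (e i) (f i).
Proof.
have [_ ef _ _] := km_triangular K A.
split; last by rewrite ef eqxx scale1r coroot_simple.
- apply: (Wt_gen (k := simple i)) => //.
  by exists true; right; exists [::], i; rewrite word_wt_nil scale1r.
- apply: (Wt_gen (k := - simple i)) => //.
  by exists false; right; exists [::], i; rewrite word_wt_nil scaleN1r.
Qed.

Lemma Wt_norm_gt2 (k : Q) x : 2 < qform k k -> Wt [set k] x -> x = 0.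
Proof. by move=> k2 kx; have [_ z] := mult_norm_ge2 slA unitA (ltW k2); apply: z. Qed.

(** The vector k - alpha_i has norm 2 + 2 + 2 = 6, so [f_i, E] = [e_i, F] = 0, and the bracket of
    the new pair reduces to h_i plus the coroot of k. The order in [F, f_i] makes the sign come out
    right. *)
Lemma root_pair_step (k : Q) E F i : qform k k = 2 -> qform (simple i) k = -1 ->
  root_pair k E F -> root_pair (simple i + k) (lie_br (e i) E) (lie_br F (f i)).
Proof.
have [_ ef _ _] := km_triangular K A; have [Ad _ _] := slA.
move=> k2 ik [kE kF EF]; have [ie jf _] := root_pair_simple i.
have norm3 : 2 < qform (k - simple i) (k - simple i).
  rewrite !(qformDl, qformDr, qformNl, qformNr) // qform_simple2 // Ad.
  by rewrite k2 ik qformC // ik.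
have fE : lie_br (f i) E = 0.
  by apply: Wt_norm_gt2 norm3 _; have := Wt_br slA jf kE; rewrite addrC.
have eF : lie_br (e i) F = 0.
  apply: (@Wt_norm_gt2 (simple i - k)); last exact: Wt_br.
  by rewrite -opprB qformNl qformNr // opprK.
split; first exact: Wt_br.
- by rewrite opprD addrC; apply: Wt_br.
- have EFi : lie_br (lie_br (e i) E) F = e i.
    rewrite brAl EF eF br0r subr0 brC (coroot_br k ie) qformC // ik.
    by rewrite mulrN1z scaleN1r opprK.
  have Efi : lie_br (lie_br (e i) E) (f i) = - E.
    rewrite brAl [lie_br E (f i)]brC fE oppr0 br0r ef eqxx scale1r sub0r.
    by rewrite brC (Wt_h slA i kE) ik opprK mulrN1z scaleN1r.
  by rewrite brA EFi Efi ef eqxx scale1r brNr -[lie_br F E]opprK -brC EF corootD coroot_simple opprK.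
Qed.

(* The sums simple i_1 + ... + simple i_m along a path of roots: every partial sum,
   built from the end of the list, is again a real root. *)
Fixpoint root_path (p : seq 'I_n) : bool :=
  if p is i :: q then nilp q || ((\sum_(j <- q) A i j == -1) && root_path q) else false.

Lemma root_path_pair p : root_path p ->
  let k := \sum_(i <- p) simple i in
  qform k k = 2 /\ exists E F, root_pair k E F.
Proof.
have [Ad _ _] := slA; elim: p => //= i p IH /orP[/nilP ->|/andP[/eqP ip /IH[k2 [E [F EF]]]]].
  rewrite big_seq1 qform_simple2 // Ad; split=> //.
  by exists (e i), (f i); apply: root_pair_simple.
rewrite big_cons; set k := \sum_(_ <- _) _ in k2 EF *.
have ik : qform (simple i) k = -1.
  rewrite -ip /k; elim: (p) => [|j q IHq]; first by rewrite !big_nil qform0r.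
  by rewrite !big_cons qformDr // IHq qform_simple2.
split; last by exists (lie_br (e i) E), (lie_br F (f i)); apply: root_pair_step.
by rewrite !(qformDl, qformDr) // qform_simple2 // Ad k2 ik qformC // ik.
Qed.

Lemma weight_eval_delta (k : Q) (c : 'rV[K]_n) :
  weight_eval A (map_mx intr k) c = \sum_i c 0 i * (qform (simple i) k)%:K.
Proof.
apply: eq_bigr => i _; rewrite qform_simple rmorph_sum mulr_sumr /=.
by apply: eq_bigr => j _; rewrite mxE intrM mulrA.
Qed.

Lemma cartan_elt_delta i : cartan_elt A (delta_mx 0 i : 'rV[K]_n) = h i.
Proof.
rewrite /cartan_elt (bigD1 i) //= big1 => [|j ji]; rewrite mxE ?eqxx ?scale1r ?addr0 //.
by rewrite (negbTE ji) scale0r.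
Qed.

(** The bridge, for integral weights, from the eigenspaces of the statement to the spans of words
    used in the proof. *)
Lemma root_spaceP (k : Q) x : root_space A (map_mx intr k) x <-> Wt [set k] x.
Proof.
split=> [kx|kx c].
  apply: (Wt_eigen slA unitA) => i; rewrite -(cartan_elt_delta i) kx weight_eval_delta.
  congr (_ *: _); rewrite (bigD1 i) //= big1 => [|j ji]; rewrite mxE ?eqxx ?mul1r ?addr0 //.
  by rewrite (negbTE ji) mul0r.
rewrite /cartan_elt br_suml weight_eval_delta scaler_suml; apply: eq_bigr => i _.
by rewrite brZl (Wt_h slA i kx) scalerA.
Qed.

Lemma simple_reflection_int i (k : Q) :
  simple_reflection A i (map_mx intr k : 'rV[K]_n) = map_mx intr (wreflect A i k).
Proof.
rewrite /simple_reflection weight_eval_delta (bigD1 i) //= big1 => [|j ji].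
  apply/rowP => j; rewrite !mxE !eqxx mul1r addr0 intrB intrM; congr (_ - _ * _).
  by case: (j == i).
by rewrite mxE (negbTE ji) mul0r.
Qed.

Lemma real_root_int (a : 'rV[K]_n) : is_real_root A a ->
  exists2 k : Q, a = map_mx intr k & qform k k = 2.
Proof.
have [Ad _ _] := slA.
case=> _ [w [i ->]]; elim: w => [|j w [k kE k2]] /=.
  exists (simple i); last by rewrite qform_simple2 // Ad.
  by apply/rowP => j; rewrite !mxE; case: (j == i).
by exists (wreflect A j k); [rewrite kE simple_reflection_int|rewrite reflect_norm].
Qed.

End RootPairs.

(** * The embedding attached to an isometry of root lattices *)

Section RootEmbedding.
Variables (K : numFieldType) (n : nat) (A A' U : 'M[int]_n).
Hypotheses (slA : simply_laced A) (slA' : simply_laced A').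
Hypothesis unitA : map_mx intr A \in @unitmx K n.
Hypothesis isoU : U *m A' *m U^T = A.

Local Notation g := (kac_moody K A).
Local Notation g' := (kac_moody K A').
Local Notation "c %:K" := (c%:~R : K) (at level 2, format "c %:K").
Local Notation UK := (map_mx intr U : 'M[K]_n).
Local Notation Wt' := (@Wt K n A').

(** The factors of an invertible product of square matrices are invertible. The matrix of E10 is
    proved invertible in this way, from that of DE10. *)
Lemma isometry_unit : UK \in unitmx /\ map_mx intr A' \in @unitmx K n.
Proof.
have := unitA; rewrite -isoU !map_mxM !unitmx_mul => /andP[/andP[-> ->]].
by [].
Qed.
Let unitU := isometry_unit.1.
Let unitA' := isometry_unit.2.

Lemma qform_isometry k l : qform A' (k *m U) (l *m U) = qform A k l.
Proof. by rewrite /qform trmx_mul -isoU !mulmxA. Qed.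

Lemma qform_row i j : qform A' (row i U) (row j U) = A i j.
Proof. by rewrite !rowE qform_isometry qform_simple2. Qed.

Variables E F : 'I_n -> g'.
Hypothesis EF : forall i, root_pair (row i U) (E i) (F i).

(* All the defining relations hold because the weights they would otherwise
   have are vectors of norm greater than 2, which are not roots. *)
Lemma root_embedding_rels : let H i := coroot K A' (row i U) in
  [/\ triangular_rels A E F H, forall i j, i != j -> serre_elt A E i j = 0
    & forall i j, i != j -> serre_elt A F i j = 0].
Proof.
have [Ad As Ao] := slA; pose r i := row i U.
have qr i j : qform A' (r i) (r j) = A i j by exact: qform_row.
have kE i : Wt' [set r i] (E i) by case: (EF i).
have kF i : Wt' [set - r i] (F i) by case: (EF i).
have zero := Wt_norm_gt2 slA' unitA'.
have qE := (qformDl, qformDr slA', qformNl, qformNr slA', qr, Ad).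
split.
- split=> i j.
  + have hW : Wt' [set 0] (coroot K A' (r j)).
      apply: lin_closed_sum => [|m _]; first exact: Wt_closed.
      apply: lin_closedZ; first exact: Wt_closed.
      by apply: (Wt_gen (k := 0)) => //; exists true; left; split=> //; exists m.
    by rewrite (coroot_br slA' (r i) hW) qform0r // scale0r.
  + have [<-|neq] := eqVneq i j; first by case: (EF i) => _ _ ->; rewrite scale1r.
    rewrite scale0r; apply: zero (Wt_br slA' (kE i) (kF j)).
    by rewrite !qE (As j i); case: (Ao i j neq) => ->.
  + by rewrite (coroot_br slA' _ (kE j)) qr.
  + by rewrite (coroot_br slA' _ (kF j)) qformNr // qr intrN.
- move=> i j neq; have [[Aij ->]|[Aij ->]] := serre_eltE slA E neq.
    by apply: zero (Wt_br slA' (kE i) (kE j)); rewrite !qE (As j i) Aij.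
  apply: zero (Wt_br slA' (kE i) (Wt_br slA' (kE i) (kE j))).
  by rewrite !qE (As j i) Aij.
- move=> i j neq; have [[Aij ->]|[Aij ->]] := serre_eltE slA F neq.
    by apply: zero (Wt_br slA' (kF i) (kF j)); rewrite !qE (As j i) Aij.
  apply: zero (Wt_br slA' (kF i) (Wt_br slA' (kF i) (kF j))).
  by rewrite !qE (As j i) Aij.
Qed.

(** The kernel is an ideal, so by [ideal_cartan_eq0] only its part in the Cartan subalgebra matters.
    There phi acts by the invertible matrix U on coordinates with respect to the independent h_i. *)
Lemma root_embedding : exists phi : {linear g -> g'},
  [/\ lie_morphism phi, injective phi, forall i, phi (km_e A i) = E i,
      forall i, phi (km_f A i) = F i
    & forall i, phi (km_h A i) = coroot K A' (row i U)].
Proof.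
have [tr sE sF] := root_embedding_rels.
have [phi [mor phie phif phih]] := km_hom_exists tr sE sF.
exists phi; split=> //.
suff ker0 x : phi x = 0 -> x = 0.
  by move=> x y xy; apply/eqP; rewrite -subr_eq0; apply/eqP/ker0; rewrite raddfB /= xy subrr.
apply: (ideal_cartan_eq0 slA unitA (S := [set x | phi x = 0])).
- split=> [|a y z /= y0 z0]; first exact: raddf0.
  by rewrite linearP y0 z0 scaler0 addr0.
- by move=> y z /= z0; rewrite mor z0 br0r.
move=> y /= py0 y0; rewrite (cartanE slA unitA y0); apply: big1 => i _.
move: py0; rewrite {1}(cartanE slA unitA y0) raddf_sum.
have pZ (a : K) (z : g) : phi (a *: z) = a *: phi z by exact: linearZ.
pose c : 'rV[K]_n := \row_j crho slA (fun k => (k == j)%:R) y.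
have -> : \sum_j phi (crho slA (fun k => (k == j)%:R) y *: km_h A j) =
    \sum_k (c *m UK) 0 k *: km_h A' k.
  have term j : phi (crho slA (fun k => (k == j)%:R) y *: km_h A j) =
      \sum_k crho slA (fun k => (k == j)%:R) y *: ((U j k)%:K *: km_h A' k).
    apply: etrans (pZ _ _) _; rewrite phih /coroot scaler_sumr.
    by apply: eq_bigr => k _; rewrite mxE.
  under eq_bigr => j _ do rewrite term.
  rewrite exchange_big /=; apply: eq_bigr => k _.
  by rewrite mxE scaler_suml; apply: eq_bigr => j _; rewrite scalerA !mxE.
move/(km_h_free slA') => c0; have {}c0 : c = 0.
  apply: (can_inj (mulmxK unitU)); rewrite mul0mx; apply/rowP => k.
  by rewrite c0 mxE.
by have := congr1 (fun c : 'rV[K]_n => c 0 i) c0; rewrite !mxE => ->; rewrite scale0r.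
Qed.

Section Properties.
Variable phi : {linear g -> g'}.
Hypothesis mor : lie_morphism phi.
Hypothesis inj : injective phi.
Hypothesis phih : forall i, phi (km_h A i) = coroot K A' (row i U).

Let pZ (a : K) (z : g) : phi (a *: z) = a *: phi z. Proof. exact: linearZ. Qed.

Lemma root_embedding_cartan c : phi (cartan_elt A c) = cartan_elt A' (c *m UK).
Proof.
rewrite /cartan_elt raddf_sum.
have term j : phi (c 0 j *: km_h A j) = \sum_k c 0 j *: ((U j k)%:K *: km_h A' k).
  apply: etrans (pZ _ _) _; rewrite phih /coroot scaler_sumr.
  by apply: eq_bigr => k _; rewrite mxE.
transitivity (\sum_j \sum_k c 0 j *: ((U j k)%:K *: km_h A' k)).
  by apply: eq_bigr => j _; exact: term.
rewrite exchange_big /=; apply: eq_bigr => k _.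
by rewrite mxE scaler_suml; apply: eq_bigr => j _; rewrite scalerA mxE.
Qed.

Lemma weight_evalE (B : 'M[int]_n) (k c : 'rV[K]_n) :
  weight_eval B k c = (c *m map_mx intr B *m k^T) 0 0.
Proof.
rewrite mxE /weight_eval exchange_big /=; apply: eq_bigr => j _.
by rewrite mxE mulr_suml; apply: eq_bigr => i _; rewrite !mxE.
Qed.

(** Valid for every weight over K: phi acts on the Cartan subalgebra by c |-> c U, which is onto,
    and U A' U^T = A makes the evaluations of a and a U agree. *)
Lemma root_embedding_root_space (a : 'rV[K]_n) x :
  root_space A a x -> root_space A' (a *m UK) (phi x).
Proof.
move=> ax c; have {1}-> : c = (c *m invmx UK) *m UK by rewrite mulmxKV.
rewrite -root_embedding_cartan -mor ax; apply: etrans (pZ _ _) _; congr (_ *: _).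
rewrite !weight_evalE -isoU !map_mxM trmx_mul map_trmx !mulmxA.
by rewrite mulmxKV.
Qed.

Lemma root_embedding_cartan_bij : set_bij (cartan K A) (cartan K A') phi.
Proof.
split.
- by move=> _ [c _ <-]; exists (c *m UK); rewrite ?root_embedding_cartan.
- by move=> x y _ _; apply: inj.
- move=> _ [c _ <-]; exists (cartan_elt A (c *m invmx UK)); first by exists (c *m invmx UK).
  by rewrite root_embedding_cartan mulmxKV.
Qed.

(** Surjectivity is a dimension count: the image contains a nonzero vector, and the target weight
    has norm 2, hence multiplicity at most one. *)
Lemma root_embedding_real_bij (a : 'rV[K]_n) : is_real_root A a ->
  set_bij (root_space A a) (root_space A' (a *m UK)) phi.
Proof.
move=> ra; split.
- by move=> x ax; apply: root_embedding_root_space.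
- by move=> x y _ _; apply: inj.
have [k kE k2] := real_root_int slA ra.
have [[_ [x ax x0]] _] := ra.
have kU : a *m UK = map_mx intr (k *m U) by rewrite kE map_mxM.
have px := root_embedding_root_space ax.
have px0 : phi x != 0 by rewrite -(raddf0 phi) (inj_eq inj).
rewrite kU in px *; move=> y /(root_spaceP slA' unitA') ky.
move/(root_spaceP slA' unitA') in px.
have qk : 2 <= qform A' (k *m U) (k *m U) by rewrite qform_isometry k2.
have [c yc] := (mult_norm_ge2 slA' unitA' qk).1 _ _ px ky px0.
exists (c *: x); last by rewrite yc; exact: pZ.
by move=> d; rewrite brZr ax !scalerA mulrC.
Qed.
End Properties.
End RootEmbedding.

(** * The embedding of DE10 in E10 *)

(** Identities between matrices of size 10 are turned into boolean tests on natural numbers below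
    10, which [vm_compute] evaluates without meeting ordinals or matrices. *)
Lemma sum_ord10 (F : nat -> int) :
  \sum_(k < 10) F k = foldr (fun k s => F k + s) 0 (iota 0 10).
Proof.
rewrite -(big_mkord xpredT F) /index_iota subn0.
by elim: (iota 0 10) => [|k r IH]; rewrite ?big_nil // big_cons IH.
Qed.

Lemma forall_ord10 (P : pred nat) : all P (iota 0 10) -> forall i : 'I_10, P i.
Proof. by move=> /allP H i; apply: H; rewrite mem_iota add0n ltn_ord. Qed.

Definition diagram_entry (edges : seq (int * int)) (i j : nat) : int :=
  let a := i%:Z - 1 in let b := j%:Z - 1 in
  if i == j then 2 else if ((a, b) \in edges) || ((b, a) \in edges) then -1 else 0.

Lemma diagram_cartanE edges i j : diagram_cartan edges i j = diagram_entry edges i j.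
Proof. by rewrite mxE /diagram_entry -val_eqE. Qed.

Lemma diagram_simply_laced edges : simply_laced (diagram_cartan edges).
Proof.
split=> [i|i j|i j /negbTE nij]; rewrite !diagram_cartanE /diagram_entry.
- by rewrite eqxx.
- by rewrite eq_sym orbC.
- have -> : (i == j :> nat) = false by [].
  by case: ifP; [right|left].
Qed.

Definition E10_edges : seq (int * int) :=
  [:: (-1, 0); (0, 1); (1, 2); (2, 3); (3, 4); (4, 5); (5, 6); (6, 7); (5, 8)].
Definition DE10_edges : seq (int * int) :=
  [:: (-1, 0); (0, 1); (1, 2); (2, 3); (3, 4); (4, 5); (5, 6); (1, 7); (5, 8)].

(* - 2 times the inverse of the Cartan matrix of DE10. *)
Definition DE10_inverse : seq (seq nat) :=
  [:: [:: 0; 2; 4; 4; 4; 4; 4; 2; 2; 2];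
      [:: 2; 4; 8; 8; 8; 8; 8; 4; 4; 4];
      [:: 4; 8; 12; 12; 12; 12; 12; 6; 6; 6];
      [:: 4; 8; 12; 10; 10; 10; 10; 5; 6; 5];
      [:: 4; 8; 12; 10; 8; 8; 8; 4; 6; 4];
      [:: 4; 8; 12; 10; 8; 6; 6; 3; 6; 3];
      [:: 4; 8; 12; 10; 8; 6; 4; 2; 6; 2];
      [:: 2; 4; 6; 5; 4; 3; 2; 0; 3; 1];
      [:: 2; 4; 6; 6; 6; 6; 6; 3; 2; 3];
      [:: 2; 4; 6; 5; 4; 3; 2; 1; 3; 0]]%N.

Lemma DE10_unit (K : numFieldType) : map_mx intr DE10_matrix \in @unitmx K 10.
Proof.
pose T : 'M[int]_10 := \matrix_(i, j) (nth 0%N (nth [::] DE10_inverse i) j)%:Z.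
have AT : DE10_matrix *m T = (-2)%:M.
  apply/matrixP => i j; rewrite !mxE.
  pose F (i j k : nat) : int :=
    diagram_entry DE10_edges i k * (nth 0%N (nth [::] DE10_inverse k) j)%:Z.
  transitivity (\sum_(k < 10) F i j k); first by apply: eq_bigr => k _; rewrite !mxE.
  rewrite (sum_ord10 (F i j)).
  have ok : all (fun i => all (fun j => foldr (fun k s => F i j k + s) 0 (iota 0 10) ==
      - 2 *+ (i == j)) (iota 0 10)) (iota 0 10) by vm_compute.
  by have /eqP -> := forall_ord10 (forall_ord10 ok i) j.
have : map_mx intr DE10_matrix *m map_mx intr T = (-2)%:M :> 'M[K]_10.
  by rewrite -map_mxM AT map_scalar_mx /= rmorphN.
move=> AT2; have : (map_mx intr DE10_matrix *m map_mx intr T) \in @unitmx K 10.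
  by rewrite AT2 unitmxE det_scalar unitfE expf_neq0 // oppr_eq0 pnatr_eq0.
by rewrite unitmx_mul => /andP[].
Qed.

(** The index k belongs to the node labelled k - 1; thus index 4 is alpha_3 and index 9 is
    alpha_8. *)
Definition alpha_entry (m : int) (k : nat) : int := (k%:Z - 1 == m)%:R.
Definition xi_entry (k : nat) : int :=
  alpha_entry 2 k + 2 * alpha_entry 3 k + 2 * alpha_entry 4 k + 2 * alpha_entry 5 k +
  alpha_entry 6 k + alpha_entry 8 k.
Definition upsilon_entries : seq (nat -> int) :=
  [:: alpha_entry (-1); alpha_entry 0; alpha_entry 1; xi_entry; alpha_entry 7;
      alpha_entry 6; alpha_entry 5; alpha_entry 4; alpha_entry 2; alpha_entry 8].

Definition upsilon_mx : 'M[int]_10 := \matrix_(i, j) nth (fun=> 0) upsilon_entries i j.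

Lemma upsilon_isometry : upsilon_mx *m E10_matrix *m upsilon_mx^T = DE10_matrix.
Proof.
apply/matrixP => i j.
pose u (i k : nat) := nth (fun=> 0) upsilon_entries i k.
pose F (i l k : nat) : int := u i k * diagram_entry E10_edges k l.
pose G (i j l : nat) : int := foldr (fun k s => F i l k + s) 0 (iota 0 10) * u j l.
transitivity (\sum_(l < 10) G i j l).
  rewrite mxE; apply: eq_bigr => l _; rewrite !mxE; congr (_ * _).
  rewrite -(sum_ord10 (F i l)); apply: eq_bigr => k _.
  by rewrite !mxE.
rewrite (sum_ord10 (G i j)) [RHS]diagram_cartanE.
have ok : all (fun i => all (fun j => foldr (fun l s => G i j l + s) 0 (iota 0 10) ==
      diagram_entry DE10_edges i j) (iota 0 10)) (iota 0 10) by vm_compute.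
by have /eqP -> := forall_ord10 (forall_ord10 ok i) j.
Qed.

Section MainTheorem.
Variable R : realType.
Local Notation C := (complex R).

Lemma alphaE m : alpha R m = map_mx intr (\row_(k < 10) alpha_entry m k).
Proof. by apply/rowP => k; rewrite !mxE /alpha_entry /label; case: (_ == m). Qed.

Lemma upsilonE (k : 'rV[C]_10) : upsilon k = k *m map_mx intr upsilon_mx.
Proof.
have imE (i : 'I_10) : (upsilon_images R)`_i = map_mx intr (row i upsilon_mx).
  have -> : upsilon_images R =
      map (fun u : nat -> int => map_mx intr (\row_(k < 10) u k)) upsilon_entries.
    rewrite /upsilon_images /= -!alphaE; congr [:: _, _, _, _ & _].
    by rewrite /xi !alphaE; apply/rowP => j; rewrite !mxE !rmorphD !rmorphM /=.
  rewrite (nth_map (fun=> 0)) //; apply/rowP => j.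
  by rewrite !mxE.
rewrite /upsilon mulmx_sum_row; apply: eq_bigr => i _.
by rewrite imE map_row.
Qed.

Let A := E10_matrix.
Let sl : simply_laced A := diagram_simply_laced _.
Let un : map_mx intr A \in @unitmx C 10 :=
  (isometry_unit (DE10_unit C) upsilon_isometry).2.

(* For every gamma_i, a path of roots ending at upsilon(gamma_i); the one for
   gamma_2 climbs to xi, the highest root of the subsystem D_6. *)
Definition upsilon_paths : seq (seq nat) :=
  [:: [:: 0]; [:: 1]; [:: 2]; [:: 4; 5; 6; 9; 7; 6; 5; 4; 3]; [:: 8]; [:: 7]; [:: 6];
      [:: 5]; [:: 3]; [:: 9]]%N.

Fixpoint root_path_nat (p : seq nat) : bool :=
  if p is i :: q then
    nilp q || ((foldr (fun j s => diagram_entry E10_edges i j + s) 0 q == -1) &&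
               root_path_nat q)
  else false.

Lemma root_path_inord p : all (gtn 10) p ->
  root_path A (map inord p) = root_path_nat p.
Proof.
elim: p => //= i q IH /andP[i10 q10]; rewrite IH // /nilp size_map.
congr (_ || ((_ == _) && _)); elim: q q10 {IH} => [|j q IH] /=; first by rewrite big_nil.
by case/andP=> j10 q10; rewrite big_cons IH // diagram_cartanE !inordK.
Qed.

Lemma upsilon_path_row (i : 'I_10) :
  row i upsilon_mx = \sum_(j <- map inord (nth [::] upsilon_paths i)) simple j.
Proof.
apply/rowP => k; rewrite !mxE summxE big_map.
pose G (i k : nat) := foldr (fun j s => (k == j)%:R + s : int) 0 (nth [::] upsilon_paths i).
have ok : all (fun i => all (gtn 10) (nth [::] upsilon_paths i) && all (fun k =>
    nth (fun=> 0) upsilon_entries i k == G i k) (iota 0 10)) (iota 0 10) by vm_compute.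
have /andP[p10 uG] := forall_ord10 ok i; have /eqP -> := forall_ord10 uG k.
rewrite /G; elim: (nth _ _ _) p10 => [|j p IH] /=; first by rewrite big_nil.
case/andP=> j10 p10; rewrite big_cons -IH // mxE; congr (_%:R + _).
by rewrite -(val_eqE k) /= inordK.
Qed.

Lemma upsilon_root_pair (i : 'I_10) :
  exists EF : kac_moody C A * kac_moody C A, root_pair (row i upsilon_mx) EF.1 EF.2.
Proof.
have ok : all (fun i => all (gtn 10) (nth [::] upsilon_paths i) &&
  root_path_nat (nth [::] upsilon_paths i)) (iota 0 10) by vm_compute.
have /andP[p10 rp] := forall_ord10 ok i; rewrite -root_path_inord // in rp.
have [_ [E [F EF]]] := root_path_pair sl un rp.
by exists (E, F); rewrite upsilon_path_row.
Qed.

Lemma lie_generated_subalgebra (L : lieType C) (G : set L) :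
  lie_subalgebra (lie_generated G).
Proof.
split=> [S [[S0 _ _] _] //|a x y Gx Gy S SG|x y Gx Gy S SG]; have [[_ SD SB] _] := SG.
- by apply: SD; [apply: Gx|apply: Gy].
- by apply: SB; [apply: Gx|apply: Gy].
Qed.

Lemma lie_generated_gen (L : lieType C) (G : set L) : G `<=` lie_generated G.
Proof. by move=> x Gx S [_]; apply. Qed.

(** Evenness is visible on the images of the simple roots: alpha_3 occurs only in xi =
    upsilon(gamma_2), with coefficient 2. *)
Lemma g_inv_row (i : 'I_10) (s : bool) (x : kac_moody C A) :
  Wt [set sg s *: row i upsilon_mx] x -> g_inv (R := R) x.
Proof.
move=> kx; set k := _ *: _ in kx.
(* Zero lies in every subalgebra; a nonzero x also witnesses that its weight is a root. *)
have [->|x0] := eqVneq x 0; first by case: (lie_generated_subalgebra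
  (cartan C E10_matrix `|` \bigcup_(k in [set k | is_root E10_matrix k /\ even_weight k])
      root_space E10_matrix k)).
have k0 : k != 0.
  apply: contraTneq (isT : (2 : int) != 0) => k0.
  have := qform_row upsilon_isometry i i; rewrite [RHS]diagram_cartanE /diagram_entry eqxx.
  have -> : row i upsilon_mx = sg s *: k.
    have ss : sg s * sg s = 1 by case: (s).
    by rewrite /k scalerA ss scale1r.
  by rewrite k0 scaler0 qform0r // => <-.
apply: lie_generated_gen; right; exists (map_mx intr k); last exact/root_spaceP.
split; first split.
- apply: contra_neq k0 => k0; apply/rowP => j; apply/eqP; rewrite mxE -(eqr_int C).
  by have /rowP/(_ j) := k0; rewrite !mxE => ->.
- by exists x => //; apply/root_spaceP.
move=> j j3; have j4 : (j : nat) = 4%N by move: j3; rewrite /label; lia.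
have ok : all (fun i => nth (fun=> 0) upsilon_entries i 4 == 2 * (i == 3)%:R) (iota 0 10).
  by vm_compute.
exists (sg s * (i == 3%N :> nat)%:R); rewrite !mxE j4 (eqP (forall_ord10 ok i)).
by rewrite mulrCA.
Qed.

End MainTheorem.

Theorem mainTheorem2 (R : realType) :
  exists phi : {linear DE10 R -> E10 R},
    [/\ lie_morphism phi,
        injective phi,
        range phi `<=` g_inv (R := R)
      & [/\ (* (a) *)
        forall a : 'rV[complex R]_10, is_root DE10_matrix a ->
          phi @` root_space DE10_matrix a
            `<=` root_space E10_matrix (upsilon a)
          /\ set_inj (root_space DE10_matrix a) phi,
        (* (b) *)
        set_bij (cartan (complex R) DE10_matrix)
          (cartan (complex R) E10_matrix) phi
      & (* (c) *)
        forall a : 'rV[complex R]_10, is_real_root DE10_matrix a ->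
          set_bij (root_space DE10_matrix a)
            (root_space E10_matrix (upsilon a)) phi]].
Proof.
have slE : simply_laced E10_matrix := diagram_simply_laced _.
have slD : simply_laced DE10_matrix := diagram_simply_laced _.
have unD := DE10_unit (complex R).
have iso := upsilon_isometry.
have [EF EFP] := boolp.choice (@upsilon_root_pair R).
have [phi [mor inj phie phif phih]] := root_embedding slD slE unD iso EFP.
exists phi; split=> //; last split.
(* As [g_inv] is a subalgebra, generators suffice: the images of e_i and f_i lie in even weight
   spaces, those of h_i in the Cartan subalgebra. *)
- move=> _ [x _ <-]; move: x.
  have [G0 GD GB] : lie_subalgebra (g_inv (R := R)) := lie_generated_subalgebra _.
  apply: (@km_ind _ _ _ (fun x => g_inv (R := R) (phi x))) => [|i|i|i].
  + split=> [|a x y Gx Gy|x y Gx Gy]; first by rewrite raddf0.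
      by rewrite linearP; apply: GD.
    by rewrite mor; apply: GB.
  + have [kE _ _] := EFP i; rewrite phie; apply: (@g_inv_row R i true).
    by rewrite scale1r.
  + have [_ kF _] := EFP i; rewrite phif; apply: (@g_inv_row R i false).
    by rewrite scaleN1r.
  + apply: lie_generated_gen; left; rewrite -(cartan_elt_delta _ _ i).
    by rewrite (root_embedding_cartan phih); eexists.
- move=> a _; split=> [_ [x ax <-]|x y _ _]; last exact: inj.
  by rewrite upsilonE; apply: (root_embedding_root_space unD iso mor phih).
- exact: (root_embedding_cartan_bij unD iso inj phih).
- move=> a ra; rewrite upsilonE.
  exact: (root_embedding_real_bij slD slE unD iso mor inj phih).
Qed.
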